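(* The character of $\mathfrak{a}_3=\mathfrak{a}\cap A_3$ is $$\mathrm{ch}_q\,\mathfrak{a}_3=\sum_d\dim(\mathfrak{a}\cap A_{d,3})\,q^d=q^3\,\frac{(1-q^{p-2})(1-q^{p-1})}{(1-q)(1-q^2)(1-q^3)}.$$
   Context: Setting. Let $p\ge 4$ be an integer not divisible by $3$, $c'=1-\frac{2(p-3)^2}{p}$. Let $M_{1,1}$, $M_{2,1}$ be the irreducible highest weight modules over the Virasoro algebra (modes $L'_n$, current $T'(z)=\sum_n L'_n z^{-n-2}$) with central charge $c'$, highest weights $0$ and $\frac{p-2}{4}$, and highest weight vectors $|1,1\rangle$, $|2,1\rangle$. Let $\psi(z)$ be the $(2,1)$ primary field of the $(3,p)$ Virasoro minimal model, acting $M_{1,1}\to M_{2,1}$ with expansion $\psi(z)=\sum_{n\in\mathbb{Z}}\psi_n z^{-n}$ and $M_{2,1}\to M_{1,1}$ with expansion $\psi(z)=\sum_{n\in\mathbb{Z}}\psi_n z^{-n-\frac{p-2}{2}}$; it is characterized by $[L'_m,\psi(z)]=z^m\bigl(z\frac{d}{dz}+(m+1)\frac{p-2}{4}\bigr)\psi(z)$ and $\psi_0|1,1\rangle=|2,1\rangle$, $\psi_0|2,1\rangle=|1,1\rangle$. Matrix elements of $(z-w)^{(p-2)/2}\psi(z)\psi(w)$ continue analytically to $\mathbb{C}^\times\times\mathbb{C}^\times$, coincide with those of $(w-z)^{(p-2)/2}\psi(w)\psi(z)$, and expand as $I+\frac{p-2}{2c'}(z-w)^2T'(w)+O((z-w)^3)$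 as $z\to w$. Let $h_n$ ($n\in\mathbb{Z}$) generate the Heisenberg algebra $[h_m,h_n]=m\delta_{m+n,0}$, and let $\mathcal{F}_\gamma=\mathbb{C}[h_{-1},h_{-2},\dots]|\gamma\rangle$ be the Fock space with $h_n|\gamma\rangle=0$ ($n>0$), $h_0|\gamma\rangle=\gamma|\gamma\rangle$. Let $\phi_\alpha(z)=\exp\bigl(-\alpha\sum_{n<0}\frac{h_n}{n}z^{-n}\bigr)e^{\alpha Q}z^{\alpha h_0}\exp\bigl(-\alpha\sum_{n>0}\frac{h_n}{n}z^{-n}\bigr):\mathcal{F}_\gamma\to\mathcal{F}_{\gamma+\alpha}$, where $e^{\alpha Q}$ is the isomorphism $\mathcal{F}_\gamma\to\mathcal{F}_{\gamma+\alpha}$ commuting with $h_n$, $n\ne0$, and sending $|\gamma\rangle$ to $|\gamma+\alpha\rangle$. Put $\beta=\sqrt{(p-2)/2}$, $V=\bigoplus_{n\in\mathbb{Z}}V_n$ with $V_n=M_{1,1}\otimes\mathcal{F}_{n\beta}$ for $n$ even and $V_n=M_{2,1}\otimes\mathcal{F}_{n\beta}$ for $n$ odd, and $a(z)=\psi(z)\phi_\beta(z)=\sum_{n\in\mathbb{Z}}a_nz^{-n-1}$, $a_n\in\mathrm{End}(V)$ ($\psi$ acts on the first tensor factor, $\phi_\beta$ on the second). The $a_n$ commute with each other. Let $v_0=|1,1\rangle\otimes|0\rangle$. $A=\mathbb{C}[\xi_{-1},\xi_{-2},\dots]=\bigoplus A_{d,n}$ is bigraded by giving $\xi_{-d}$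 bidegree $(d,1)$, $A_n=\bigoplus_dA_{d,n}$, and $\mathfrak{a}\subset A$ is the (bihomogeneous) ideal of polynomials $P$ with $P(a_{-1},a_{-2},\dots)v_0=0$ (with $\xi_{-n}$ replaced by $a_{-n}$). *)

(* Defs.v *)
From HB Require Import structures.
From mathcomp Require Import all_boot all_order all_algebra finmap.
From mathcomp.multinomials Require Import monalg.
From mathcomp Require Import all_classical all_reals.
From mathcomp Require Import complex.

Set Implicit Arguments.
Unset Strict Implicit.
Unset Printing Implicit Defensive.

Import GRing.Theory Num.Theory.

Local Open Scope classical_set_scope.
Local Open Scope ring_scope.

(** * Virasoro modules *)

Section Virasoro.
Variable C : fieldType.

Definition virasoro_rel (c : C) (M : lmodType C) (L : int -> {linear M -> M}) :=
  forall (m n : int) (x : M),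
    L m (L n x) - L n (L m x) =
      (m - n)%:~R *: L (m + n) x
      + (if m + n == 0 then c / 12%:R * (m ^+ 3 - m)%:~R else 0) *: x.

Definition highest_weight_vector (h : C) (M : lmodType C)
    (L : int -> {linear M -> M}) (v : M) :=
  [/\ v != 0, L 0 v = h *: v & forall n : int, (0 < n)%R -> L n v = 0].

Definition L_submodule (M : lmodType C) (L : int -> {linear M -> M})
    (S : set M) :=
  [/\ S 0,
      forall (a : C) (x y : M), S x -> S y -> S (a *: x + y)
    & forall (n : int) (x : M), S x -> S (L n x)].

(* The highest weight vector is nonzero, so M itself is nonzero; irreducibility
   makes v a generator. *)
Definition irreducible_hw_module (c h : C) (M : lmodType C)
    (L : int -> {linear M -> M}) (v : M) :=
  [/\ virasoro_rel c L, highest_weight_vector h L v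
    & forall S : set M, L_submodule L S -> S = [set 0] \/ S = [set: M]].

(* The family psi is the field psi(z) = sum_n psi_n z^(-n-s). The relation is
   the coefficient of z^(-n-s) in
   [L_m, psi(z)] = z^m (z d/dz + (m+1) Delta) psi(z). *)
Definition primary_field (Delta s : C) (M N : lmodType C)
    (LM : int -> {linear M -> M}) (LN : int -> {linear N -> N})
    (psi : int -> {linear M -> N}) :=
  forall (m n : int) (x : M),
    LN m (psi n x) - psi n (LM m x) =
      ((- (n + m)%:~R - s) + (m + 1)%:~R * Delta) *: psi (n + m) x.

End Virasoro.

(** * Fock spaces and vertex operators *)

(* C[x_0, x_1, ...]. It is used both for A (x_i is xi_(-(i+1))) and for each
   Fock space F_gamma (x_i is h_(-(i+1)), and 1 is |gamma>). *)
Notation cpoly C := {malg C[{cmonom nat}]}.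

Section Fock.
Variable C : fieldType.
Implicit Types f : cpoly C.

(* On F_gamma, the relations force h_n to be n d/dh_(-n) for n > 0. *)
Definition lowering (i : nat) f : cpoly C :=
  \sum_(m <- msupp f)
    << (i.+1 * m i)%:R * f@_m *g divcm m (ucm i) >>.

Definition heis (gamma : C) (n : int) f : cpoly C :=
  match n with
  | Posz 0 => gamma *: f
  | Posz i.+1 => lowering i f
  | Negz i => << ucm i >> * f
  end.

(* X i is the coefficient of t^i in an operator-valued power series X(t);
   opser_pow X k i is the coefficient of t^i in X(t)^k. *)
Fixpoint opser_pow (U : lmodType C) (X : nat -> U -> U) (k i : nat) (u : U) : U :=
  if k is k'.+1 then \sum_(j < i.+1) X j (opser_pow X k' (i - j) u)
  else if i == 0%N then u else 0.

(* The coefficient of t^i in exp X(t), for X(t) without constant term (so that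
   X(t)^k does not contribute for k > i). *)
Definition opser_exp (U : lmodType C) (X : nat -> U -> U) (i : nat) (u : U) : U :=
  \sum_(k < i.+1) (k`!%:R)^-1 *: opser_pow X k i u.

(* Coefficient of z^i in exp(- alpha sum_(n<0) h_n / n z^-n). *)
Definition exp_creation (alpha gamma : C) : nat -> cpoly C -> cpoly C :=
  opser_exp (fun i f =>
    if i == 0%N then 0
    else - (alpha / (- i%:Z)%:~R) *: heis gamma (- i%:Z) f).

(* Coefficient of z^-i in exp(- alpha sum_(n>0) h_n / n z^-n). *)
Definition exp_annihilation (alpha gamma : C) : nat -> cpoly C -> cpoly C :=
  opser_exp (fun i f =>
    if i == 0%N then 0 else - (alpha / i%:R) *: heis gamma i%:Z f).

(* Coefficient of z^(s + alpha gamma) in phi_alpha(z) : F_gamma -> F_(gamma+alpha).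
   The isomorphism e^(alpha Q) is the identity of C[h_-1, h_-2, ...]. The sum
   is finite, since exp_annihilation _ _ j f vanishes for large j. *)
Definition vertex_coef (alpha gamma : C) (s : int) f : cpoly C :=
  \sum_(ij \in [set ij : nat * nat | ij.1%:Z - ij.2%:Z = s])
    exp_creation alpha (gamma + alpha) ij.1
      (exp_annihilation alpha gamma ij.2 f).

End Fock.

(** * Tensor products with Fock spaces *)

(* The tensor product of M with a vector space of basis K, as the space of
   finitely supported functions K -> M. The library scales {malg G[K]} only
   for a ring G. *)
Definition tens (C : fieldType) (M : lmodType C) (K : choiceType) : Type :=
  {malg M[K]}.

Section TensLmodule.
Variables (C : fieldType) (M : lmodType C) (K : choiceType).

HB.instance Definition _ := GRing.Zmodule.copy (tens M K) {malg M[K]}.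

Definition tens_scale (a : C) (g : tens M K) : tens M K :=
  [malg k in msupp (g : {malg M[K]}) => a *: (g : {malg M[K]})@_k].

Lemma tens_scaleE a (g : tens M K) k :
  (tens_scale a g : {malg M[K]})@_k = a *: (g : {malg M[K]})@_k.
Proof. by rewrite mcoeffE; case: msuppP => //; rewrite scaler0. Qed.

Fact tens_scaleA a b (g : tens M K) :
  tens_scale a (tens_scale b g) = tens_scale (a * b) g.
Proof. by apply/malgP=> k; rewrite !tens_scaleE scalerA. Qed.

Fact tens_scale1 : left_id 1 tens_scale.
Proof. by move=> g; apply/malgP=> k; rewrite tens_scaleE scale1r. Qed.

Fact tens_scaleDr : right_distributive tens_scale +%R.
Proof.
by move=> a g h; apply/malgP=> k; rewrite !(mcoeffD, tens_scaleE) scalerDr.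
Qed.

Fact tens_scaleDl (g : tens M K) : {morph tens_scale^~ g : a b / a + b}.
Proof.
by move=> a b; apply/malgP=> k; rewrite !(mcoeffD, tens_scaleE) scalerDl.
Qed.

HB.instance Definition _ := GRing.Zmodule_isLmodule.Build C (tens M K)
  tens_scaleA tens_scale1 tens_scaleDr tens_scaleDl.

End TensLmodule.

(* The direct sum over k : int of copies of M (x) C[h_-1, h_-2, ...]. *)
Notation tensF M := (tens M (int * {cmonom nat})%type).

(* x (x) f in the k-th summand. *)
Definition tensF_in (C : fieldType) (M : lmodType C) (k : int) (x : M)
    (f : cpoly C) : tensF M :=
  \sum_(m <- msupp f) (<< f@_m *: x *g (k, m) >> : {malg M[_]}).

(* Linear extension of T, where T k x f is the image of x (x) f in the k-th
   summand. *)
Definition tensF_ext (C : fieldType) (M : lmodType C) (W : lmodType C)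
    (T : int -> M -> cpoly C -> W) (g : tensF M) : W :=
  \sum_(km <- msupp (g : {malg M[_]}))
    T km.1 (g : {malg M[_]})@_km (<< km.2 >> : cpoly C).

(** * The current a(z) and the ideal of relations *)

Section Current.
Variables (C : numClosedFieldType) (p : nat).

Definition central_charge : C := 1 - 2%:R * (p%:R - 3%:R) ^+ 2 / p%:R.
Definition weight21 : C := (p%:R - 2%:R) / 4%:R.
Definition shift21 : C := (p%:R - 2%:R) / 2%:R.
Definition beta : C := sqrtC ((p%:R - 2%:R) / 2%:R).

Variables (M11 M21 : lmodType C) (v11 : M11).
Variables (psi_up : int -> {linear M11 -> M21}).
Variables (psi_dn : int -> {linear M21 -> M11}).

(* V: the k-th summand of the first component is V_(2k), the k-th summand of
   the second one is V_(2k+1). *)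
Definition V : lmodType C := (tensF M11 * tensF M21)%type.

(* Coefficient of z^(-n-1) in psi(z)x (x) phi_beta(z)f, placed in the k-th
   summand, for f in F_gamma and psi(z) = sum_r psi_r z^(-r-s). The pair (r, t)
   collects the term z^(-r-s) of psi and the term z^(t + beta gamma) of phi. *)
Definition current_coef (M N : lmodType C) (s : C) (psi : int -> {linear M -> N})
    (gamma : C) (k n : int) (x : M) (f : cpoly C) : tensF N :=
  \sum_(rt \in [set rt : int * int |
        (- rt.1%:~R - s) + (rt.2%:~R + beta * gamma) = - n%:~R - 1])
    tensF_in k (psi rt.1 x) (vertex_coef beta gamma rt.2 f).

Definition a_mode (n : int) (v : V) : V :=
  (tensF_ext (fun k => current_coef shift21 psi_dn
                         ((2 * k + 1)%:~R * beta) (k + 1) n) v.2,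
   tensF_ext (fun k => current_coef 0 psi_up
                         ((2 * k)%:~R * beta) k n) v.1).

Definition v0 : V := (tensF_in 0 v11 1, 0).

(* The a_n commute, so the order of the factors is immaterial. *)
Definition monomial_act (m : {cmonom nat}) : V :=
  foldr (fun i v => iter (m i) (a_mode (- (i.+1)%:Z)) v) v0 (finsupp m).

Definition poly_act (P : cpoly C) : V :=
  \sum_(m <- msupp P) P@_m *: monomial_act m.

Definition ideal_a : set (cpoly C) := [set P | poly_act P = 0].

End Current.

(** * Bigrading, dimensions, characters *)

Definition weight (m : {cmonom nat}) : nat :=
  (\sum_(i <- finsupp m) m i * i.+1)%N.

(* A_(d,n), as a subspace of A *)
Definition bihomog (C : fieldType) (d n : nat) : set (cpoly C) :=
  [set P | forall m, m \in msupp P -> weight m = d /\ mdeg m = n].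

Definition has_dim (C : fieldType) (U : lmodType C) (S : set U) (k : nat) :=
  exists b : 'I_k -> U,
    [/\ forall i, S (b i),
        forall c : 'I_k -> C, \sum_i c i *: b i = 0 -> forall i, c i = 0
      & forall x, S x -> exists c : 'I_k -> C, x = \sum_i c i *: b i].

(* sum_d (u d) q^d is the power series expansion of N(q)/D(q), where D(0) is
   invertible. *)
Definition expansion_of (u : nat -> int) (N D : {poly int}) :=
  D`_0 \is a GRing.unit /\
  forall d : nat, \sum_(i < d.+1) D`_i * u (d - i)%N = N`_d.

(* Main.v *)
Require Import Defs.
From mathcomp Require Import all_boot all_order all_algebra finmap ring zify.
From mathcomp.multinomials Require Import monalg.
From mathcomp Require Import all_classical all_reals.
From mathcomp Require Import complex.

(** Put N = p - 2, so that beta^2 = N / 2. A cubic relation is a linear relation between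
   the vectors a_(-i-1) a_(-j-1) a_(-k-1) v0 of V_3, hence an element of the annihilator
   of the space J of their matrix elements: the arrays
   phi (a_(-i-1) a_(-j-1) a_(-k-1) v0), for linear functionals phi on V_3, read as power
   series in x, y, z. The proof determines J.

   Let h_n be the Heisenberg modes and T_n the sum of the Virasoro operators of the two
   tensor factors. From [h_n, a_m] = beta a_(m+n) and
   [T_n, a_m] = (- (m+n+1) + (n+1) beta^2) a_(m+n) (hop_cur, top_cur), replacing phi by
   phi o h_n multiplies its array by beta p_n, with p_n the power sum, and replacing it by
   phi o T_n applies the vector field sum x^(n+1) d/dx plus (n+1) beta^2 p_n. As the
   Virasoro modules are irreducible, the functionals obtained in this way from the vacuum
   functional phi0 separate the points of each sector (sector_separate). The same
   argument on V_1 and V_2 shows a_m v0 = 0 and a_m a_n v0 = 0 for m >= 0 (cre2_eq0), so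
   the arrays are polynomials.

   The array g of phi0 is translation invariant and homogeneous of degree N, because of
   T_(-1) and T_0. It satisfies a second order equation (g_null), because
   phi0 (L_2 - (3 / p) L_1^2) = 0 by the singular vector of weight (p - 2) / 4 + 2 of the
   Verma module that covers M_(2,1). These equations have one solution up to a factor
   (array_unique). A solution is found among the polynomials in the invariants Q and R of
   degrees 2 and 3, for which the equation becomes D^2 G = N (N + 1) Q G with
   D Q = R and D R = 6 Q^2 (null_equation). Expanding in powers of the discriminant
   4 Q^3 - R^2 solves it by a recurrence that terminates if N is not 1 modulo 3
   (graded_solution_exists). So g is a multiple of G, and J is the ideal generated by G
   and D G among the symmetric polynomials (gen_in_ideal, ideal_represented): the
   equation keeps it stable under all the vector fields.

   Finally G and D G have no common factor, since D lowers by one the order of a zero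
   off the discriminant, where G vanishes only together with Q (solution_coprime). Hence their syzygies are the multiples of the trivial one
   (syzygy), the dimension of J in degree n is
   |I_(n-N)| + |I_(n-N-1)| - |I_(n-2N-1)|, where I_k is the set of exponents of the
   monomials e1^a Q^b R^c of degree k, and the annihilator has the complementary
   dimension in the space of symmetric polynomials (annihilator_dim). The generating
   function of |I_k| is 1 / ((1 - q) (1 - q^2) (1 - q^3)), and the alternating sum
   produces the numerator (1 - q^N) (1 - q^(N+1)). *)


Set Implicit Arguments.
Unset Strict Implicit.
Unset Printing Implicit Defensive.

Import Order.TTheory GRing.Theory Num.Theory.

Local Open Scope classical_set_scope.
Local Open Scope ring_scope.

(** * Derivations of three-variable polynomials *)

Definition derivation (S : comNzRingType) (d : S -> S) :=
  (forall a b, d (a + b) = d a + d b) /\ (forall a b, d (a * b) = d a * b + a * d b).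

Section Derivations.
Variables (S : comNzRingType) (d : S -> S).
Hypothesis dd : derivation d.

Lemma der0 : d 0 = 0.
Proof. by apply: (addrI (d 0)); rewrite -dd.1 !addr0. Qed.

Lemma der1 : d 1 = 0.
Proof. by apply: (addrI (d 1)); rewrite addr0 -{3}[1]mulr1 dd.2 mulr1 mul1r. Qed.

Lemma derN a : d (- a) = - d a.
Proof. by apply: (addrI (d a)); rewrite -dd.1 !subrr der0. Qed.

Lemma der_nat n : d n%:R = 0.
Proof. by elim: n => [|n IH]; rewrite ?der0 // -natr1 dd.1 IH der1 addr0. Qed.

Lemma derX a n : d (a ^+ n) = n%:R * a ^+ n.-1 * d a.
Proof.
elim: n => [|n IH]; first by rewrite expr0 der1 !mul0r.
rewrite exprS dd.2 IH -natr1 /=.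
case: n {IH} => [|n] /=; rewrite ?expr0 ?exprS; ring.
Qed.

Lemma der_sum I (r : seq I) (P : pred I) F :
  d (\sum_(i <- r | P i) F i) = \sum_(i <- r | P i) d (F i).
Proof.
by elim/big_rec2: _ => [|i y1 y2 _ <-]; rewrite ?der0 // dd.1.
Qed.

Lemma derivation_map_poly : derivation (map_poly d).
Proof.
split=> a b; apply/polyP=> i.
  by rewrite coefD !coef_map_id0 ?der0 // coefD dd.1.
rewrite coefD coef_map_id0 ?der0 // !coefM der_sum -big_split /=.
by apply: eq_bigr => j _; rewrite !coef_map_id0 ?der0 // dd.2.
Qed.

Lemma derivation_deriv : derivation (@deriv S).
Proof. by split=> a b; rewrite ?derivD ?derivM. Qed.

Lemma derivation_mul a : derivation (fun x => a * d x).
Proof. by split=> x y; rewrite ?dd.1 ?dd.2; ring. Qed.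

End Derivations.

Lemma derivation_add (S : comNzRingType) (d1 d2 : S -> S) :
  derivation d1 -> derivation d2 -> derivation (fun x => d1 x + d2 x).
Proof. by move=> h1 h2; split=> x y; rewrite ?h1.1 ?h1.2 ?h2.1 ?h2.2; ring. Qed.


(** * Three-variable polynomials *)

(** The interface through which C[x, y, z] is used: a domain with partial
   derivatives, coefficients indexed by integers, and evaluation. Working over
   an arbitrary model keeps the nested polynomials folded. *)
Record polynomials3 (C : numClosedFieldType) := Polynomials3 {
  carrier3 :> idomainType;
  xx : carrier3;
  yy : carrier3;
  zz : carrier3;
  kc : {rmorphism C -> carrier3};
  dX : carrier3 -> carrier3;
  dY : carrier3 -> carrier3;
  dZ : carrier3 -> carrier3;
  dX_der : derivation dX;
  dY_der : derivation dY;
  dZ_der : derivation dZ;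
  dXE : [/\ dX xx = 1, dX yy = 0, dX zz = 0 & forall c, dX (kc c) = 0];
  dYE : [/\ dY xx = 0, dY yy = 1, dY zz = 0 & forall c, dY (kc c) = 0];
  dZE : [/\ dZ xx = 0, dZ yy = 0, dZ zz = 1 & forall c, dZ (kc c) = 0];
  cf : carrier3 -> int -> int -> int -> C;
  cfD : forall f g i j k, cf (f + g) i j k = cf f i j k + cf g i j k;
  cfZ : forall c f i j k, cf (kc c * f) i j k = c * cf f i j k;
  cf1 : forall i j k, cf 1 i j k = ((i == 0) && (j == 0) && (k == 0))%:R;
  cf_xx : forall f i j k, cf (xx * f) i j k = cf f (i - 1) j k;
  cf_yy : forall f i j k, cf (yy * f) i j k = cf f i (j - 1) k;
  cf_zz : forall f i j k, cf (zz * f) i j k = cf f i j (k - 1);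
  cf_dX : forall f i j k, cf (dX f) i j k = (i + 1)%:~R * cf f (i + 1) j k;
  cf_dY : forall f i j k, cf (dY f) i j k = (j + 1)%:~R * cf f i (j + 1) k;
  cf_dZ : forall f i j k, cf (dZ f) i j k = (k + 1)%:~R * cf f i j (k + 1);
  cf_neg : forall f i j k, cf f i j k != 0 -> [&& 0 <= i, 0 <= j & 0 <= k];
  cf_inj : forall f, (forall i j k, cf f i j k = 0) -> f = 0;
  ev3 : C -> C -> C -> {rmorphism carrier3 -> C};
  ev3E : forall a b c, [/\ ev3 a b c xx = a, ev3 a b c yy = b, ev3 a b c zz = c
                         & forall t, ev3 a b c (kc t) = t]
}.

Section Model.
Variable S : comNzRingType.
Implicit Types p q : {poly S}.

Definition icoef (p : {poly S}) (i : int) : S := if i is Posz n then p`_n else 0.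

Lemma icoefD p q i : icoef (p + q) i = icoef p i + icoef q i.
Proof. by case: i => n /=; rewrite ?coefD ?addr0. Qed.

Lemma icoefC c p i : icoef (c%:P * p) i = c * icoef p i.
Proof. by case: i => n /=; rewrite ?coefCM ?mulr0. Qed.

Lemma icoefz (m : int) p i : icoef (m%:~R * p) i = m%:~R * icoef p i.
Proof. by rewrite -icoefC rmorph_int. Qed.

Lemma icoef0 i : icoef 0 i = 0.
Proof. by case: i => n //=; rewrite coef0. Qed.

Lemma icoef1 i : icoef 1 i = (i == 0)%:R.
Proof. by case: i => n //=; rewrite coef1. Qed.

Lemma icoefX p i : icoef ('X * p) i = icoef p (i - 1).
Proof.
case: i => [[|n]|n]; first by rewrite /= coefXM.
  by rewrite (_ : n.+1%:Z - 1 = n%:Z) /= ?coefXM //; lia.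
by rewrite (_ : Negz n - 1 = Negz n.+1) //; lia.
Qed.

Lemma icoef_deriv p i : icoef p^`() i = (i + 1)%:~R * icoef p (i + 1).
Proof.
case: i => [n|[|n]].
- by rewrite (_ : n%:Z + 1 = n.+1%:Z) /= ?coef_deriv ?mulr_natl //; lia.
- by rewrite mul0r.
by rewrite (_ : Negz n.+1 + 1 = Negz n) ?mulr0 //; lia.
Qed.

Lemma icoef_map (d : S -> S) p i : d 0 = 0 -> icoef (map_poly d p) i = d (icoef p i).
Proof. by move=> d0; case: i => n //=; rewrite coef_map_id0. Qed.

Lemma icoef_neg p i : icoef p i != 0 -> 0 <= i.
Proof. by case: i => n //=; rewrite eqxx. Qed.

Lemma icoef_inj p : (forall i, icoef p i = 0) -> p = 0.
Proof. by move=> h; apply/polyP=> n; rewrite coef0; exact: (h (Posz n)). Qed.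

Lemma map_polyC_der (d : S -> S) (a : S) :
  d 0 = 0 -> map_poly d a%:P = (d a)%:P.
Proof.
move=> d0; apply/polyP=> i; rewrite coef_map_id0 // !coefC.
by case: (i == 0)%N.
Qed.

Lemma map_polyC1 (d : S -> S) (a : S) : d 0 = 0 -> d a = 1 -> map_poly d a%:P = 1.
Proof. by move=> d0 da; rewrite map_polyC_der // da. Qed.

Lemma map_polyC0 (d : S -> S) (a : S) : d 0 = 0 -> d a = 0 -> map_poly d a%:P = 0.
Proof. by move=> d0 da; rewrite map_polyC_der // da. Qed.

Lemma map_polyX_der (d : S -> S) : derivation d -> map_poly d 'X = 0.
Proof.
move=> dd; apply/polyP=> i; rewrite coef_map_id0 ?der0 // coefX coef0.
by case: (i == 1)%N; rewrite ?der1 ?der0.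
Qed.

End Model.

(** The nested polynomials C[z][y][x], whose outermost variable is x. *)
Lemma polynomials3_inhabited (C : numClosedFieldType) : inhabited (polynomials3 C).
Proof.
pose K1 := {poly C}; pose K2 := {poly K1}; pose K3 := {poly K2}.
pose kc := (@polyC K2 \o (@polyC K1 \o @polyC C) : {rmorphism C -> K3}).
have D0 := derivation_deriv C; have D1 := derivation_deriv K1.
have D2 := derivation_map_poly D0; have D3 := derivation_map_poly D2.
have z0 := der0 D0; have z1 := der0 D1; have z2 := der0 D2.
pose cf (f : K3) i j k := icoef (icoef (icoef f i) j) k.
pose ev a b c := (horner_eval (a : C) \o (horner_eval (b%:P : K1) \o horner_eval (c%:P%:P : K2))
   : {rmorphism K3 -> C}).
constructor.
apply: (@Polynomials3 C K3 'X ('X%:P) ('X%:P%:P) kc (@deriv _) (map_poly (@deriv _))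
   (map_poly (map_poly (@deriv _))) _ _ _ _ _ _ cf _ _ _ _ _ _ _ _ _ _ _
   (fun a b c => ev c b a)).
- exact: derivation_deriv.
- exact/derivation_map_poly/derivation_deriv.
- exact: D3.
- split; [exact: derivX | exact: derivC | exact: derivC | by move=> c; exact: derivC].
- split.
  + exact: (map_polyX_der D1).
  + exact: (map_polyC1 z1 (derivX _)).
  + exact: (map_polyC0 z1 (derivC _)).
  + by move=> c; exact: (map_polyC0 z1 (derivC _)).
- split.
  + exact: (map_polyX_der D2).
  + exact: (map_polyC0 z2 (map_polyX_der D0)).
  + exact: (map_polyC1 z2 (map_polyC1 z0 (derivX _))).
  + by move=> c; exact: (map_polyC0 z2 (map_polyC0 z0 (derivC _))).
- by move=> f g i j k; rewrite /cf icoefD icoefD icoefD.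
- by move=> c f i j k; rewrite /cf icoefC icoefC icoefC.
- move=> i j k; rewrite /cf icoef1; case: (i == 0); last by rewrite icoef0 icoef0.
  by rewrite icoef1; case: (j == 0); rewrite ?icoef1 ?icoef0.
- by move=> f i j k; rewrite /cf icoefX.
- by move=> f i j k; rewrite /cf icoefC icoefX.
- by move=> f i j k; rewrite /cf icoefC icoefC icoefX.
- by move=> f i j k; rewrite /cf icoef_deriv icoefz icoefz.
- by move=> f i j k; rewrite /cf (icoef_map _ _ z1) icoef_deriv icoefz.
- by move=> f i j k; rewrite /cf (icoef_map _ _ z2) (icoef_map _ _ z0) icoef_deriv.
- move=> f i j k h; apply/and3P; split.
  + by apply: (@icoef_neg _ f); apply: contraNneq h; rewrite /cf => ->; rewrite icoef0 icoef0.
  + by apply: (@icoef_neg _ (icoef f i)); apply: contraNneq h; rewrite /cf => ->; rewrite icoef0.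
  + exact: (icoef_neg h).
- move=> f h; apply: icoef_inj => i; apply: icoef_inj => j; apply: icoef_inj => k; exact: h.
- move=> a b c; rewrite /= /horner_eval; split.
  + by rewrite hornerX hornerC hornerC.
  + by rewrite hornerC hornerX hornerC.
  + by rewrite hornerC hornerC hornerX.
  + by move=> t; rewrite hornerC hornerC hornerC.
Qed.

Section ThreeVariables.
Variables (C : numClosedFieldType) (K : polynomials3 C).
Implicit Types f g : K.
Local Notation xx := (xx K).
Local Notation yy := (yy K).
Local Notation zz := (zz K).
Local Notation kc := (kc K).

(** The vector field x^m d/dx in all three variables: the mode L_(m - 1) of the
   Witt algebra. *)
Definition EE (m : nat) f : K := xx ^+ m * dX f + yy ^+ m * dY f + zz ^+ m * dZ f.

Lemma EE_der m : derivation (EE m).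
Proof.
apply: derivation_add; first apply: derivation_add.
- exact/derivation_mul/dX_der.
- exact/derivation_mul/dY_der.
- exact/derivation_mul/dZ_der.
Qed.

Lemma EExx m : EE m xx = xx ^+ m.
Proof. by rewrite /EE; case: (dXE K) (dYE K) (dZE K) => -> _ _ _ [-> _ _ _] [-> _ _ _]; ring. Qed.
Lemma EEyy m : EE m yy = yy ^+ m.
Proof. by rewrite /EE; case: (dXE K) (dYE K) (dZE K) => _ -> _ _ [_ -> _ _] [_ -> _ _]; ring. Qed.
Lemma EEzz m : EE m zz = zz ^+ m.
Proof. by rewrite /EE; case: (dXE K) (dYE K) (dZE K) => _ _ -> _ [_ _ -> _] [_ _ -> _]; ring. Qed.
Lemma EEkc m c : EE m (kc c) = 0.
Proof. by rewrite /EE; case: (dXE K) (dYE K) (dZE K) => _ _ _ -> [_ _ _ ->] [_ _ _ ->]; ring. Qed.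

Lemma EED m f g : EE m (f + g) = EE m f + EE m g.
Proof. exact: (EE_der m).1. Qed.
Lemma EEM m f g : EE m (f * g) = EE m f * g + f * EE m g.
Proof. exact: (EE_der m).2. Qed.
Lemma EEX m f n : EE m (f ^+ n) = n%:R * f ^+ n.-1 * EE m f.
Proof. exact: derX (EE_der m) f n. Qed.
Lemma EEN m f : EE m (- f) = - EE m f.
Proof. exact: derN (EE_der m) f. Qed.
Lemma EEn m n : EE m n%:R = 0.
Proof. exact: der_nat (EE_der m) n. Qed.
Lemma EE_sum m I (r : seq I) (P : pred I) F :
  EE m (\sum_(i <- r | P i) F i) = \sum_(i <- r | P i) EE m (F i).
Proof. exact: der_sum (EE_der m) I r P F. Qed.
Lemma EEZ m c f : EE m (kc c * f) = kc c * EE m f.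
Proof. by rewrite EEM EEkc mul0r add0r. Qed.

Definition EEE := (EEn, EExx, EEyy, EEzz, EEkc, EED, EEM, EEX, EEN).

Definition e1 : K := xx + yy + zz.
Definition e2 : K := xx * yy + yy * zz + zz * xx.
Definition e3 : K := xx * yy * zz.
Definition pp n : K := xx ^+ n + yy ^+ n + zz ^+ n.
(** Q and R generate the translation invariant symmetric polynomials. *)
Definition QQ : K := e1 ^+ 2 - 3%:R * e2.
Definition RR : K := 2%:R * e1 ^+ 3 - 9%:R * (e1 * e2) + 27%:R * e3.

(** Each of x, y, z is a root of t^3 - e1 t^2 + e2 t - e3. *)
Lemma EE_rec m f : EE m.+3 f = e1 * EE m.+2 f - e2 * EE m.+1 f + e3 * EE m f.
Proof. by rewrite /EE /e1 /e2 /e3 !(exprS _ _.+2) !(exprS _ _.+1) !(exprS _ m); ring. Qed.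

Lemma pp_rec m : pp m.+3 = e1 * pp m.+2 - e2 * pp m.+1 + e3 * pp m.
Proof. by rewrite /pp /e1 /e2 /e3 !(exprS _ _.+2) !(exprS _ _.+1) !(exprS _ m); ring. Qed.

(** Three times the vector field that E_2 induces on translation invariant
   functions; the factor keeps the coefficients integral. *)
Definition DD f : K := 3%:R * EE 2 f - 2%:R * e1 * EE 1 f.

Lemma DD_der : derivation DD.
Proof. by split=> a b; rewrite /DD ?EED ?EEM; ring. Qed.

Lemma EE0Q : EE 0 QQ = 0. Proof. by rewrite /QQ /e1 /e2 !EEE /=; ring. Qed.
Lemma EE0R : EE 0 RR = 0. Proof. by rewrite /RR /e1 /e2 /e3 !EEE /=; ring. Qed.
Lemma EE1e1 : EE 1 e1 = e1. Proof. by rewrite /e1 !EEE /=; ring. Qed.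
Lemma EE2e1 : EE 2 e1 = pp 2. Proof. by rewrite /e1 /pp !EEE /=; ring. Qed.
Lemma EE1Q : EE 1 QQ = 2%:R * QQ. Proof. by rewrite /QQ /e1 /e2 !EEE /=; ring. Qed.
Lemma EE1R : EE 1 RR = 3%:R * RR. Proof. by rewrite /RR /e1 /e2 /e3 !EEE /=; ring. Qed.
Lemma DDQ : DD QQ = RR.
Proof. by rewrite /DD /QQ /RR /e1 /e2 /e3 !EEE /=; ring. Qed.
Lemma DDR : DD RR = 6%:R * QQ ^+ 2.
Proof. by rewrite /DD /QQ /RR /e1 /e2 /e3 !EEE /=; ring. Qed.

(** Homogeneous translation invariant solutions of the second order equation
   satisfy the null vector equation. *)
Lemma null_equation N (G : K) :
  EE 0 G = 0 -> EE 1 G = N%:R * G -> EE 1 (DD G) = N.+1%:R * DD G ->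
  DD (DD G) = (N%:R * N.+1%:R) * QQ * G ->
  3%:R * (4%:R * EE 2 (EE 2 G) - 2%:R * EE 2 (N%:R * pp 1 * G)
          - 2%:R * N%:R * pp 1 * EE 2 G + N%:R ^+ 2 * pp 1 ^+ 2 * G)
  = N.+2%:R * (4%:R * EE 3 G - N%:R * pp 1 ^+ 2 * G).
Proof.
move=> G0 G1 GD1 GD.
have p1 : pp 1 = e1 by rewrite /pp !expr1.
have H2 : DD G = 3%:R * EE 2 G - 2%:R * N%:R * e1 * G by rewrite /DD G1; ring.
have HE (A : K) : EE 2 (3%:R * A - 2%:R * N%:R * e1 * G) =
    3%:R * EE 2 A - 2%:R * N%:R * (pp 2 * G + e1 * EE 2 G).
  by rewrite !(EE2e1, EEE); ring.
have HP (A : K) : EE 2 (N%:R * e1 * A) = N%:R * (pp 2 * A + e1 * EE 2 A).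
  by rewrite !(EE2e1, EEE); ring.
have HD : DD (DD G) = 3%:R * (3%:R * EE 2 (EE 2 G)
    - 2%:R * N%:R * (pp 2 * G + e1 * EE 2 G)) - 2%:R * e1 * (N.+1%:R * DD G).
  by rewrite {1}/DD GD1 {1}H2 HE.
have {GD HD} := etrans (esym HD) GD; rewrite H2 => GD.
have n3 : 3%:R != 0 :> K by rewrite -(rmorph_nat (kc)) fmorph_eq0 pnatr_eq0.
apply: (mulfI n3); apply/eqP; rewrite -subr_eq0; apply/eqP.
rewrite EE_rec G0 G1 p1 HP mulr0 addr0.
have p2 : pp 2 = e1 ^+ 2 - 2%:R * e2 by rewrite /pp /e1 /e2; ring.
have Q2 : QQ = e1 ^+ 2 - 3%:R * e2 by [].
move/eqP: GD; rewrite -subr_eq0 p2 Q2 => /eqP GD.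
move: (EE 2 (EE 2 G)) (EE 2 G) e1 e2 GD => B A u v GD.
rewrite -(mulr0 4%:R) -GD; ring.
Qed.

End ThreeVariables.

(** * The polynomial solution of the second order equation *)

Section Univariate.
Variable C : numClosedFieldType.
Implicit Types (f g h : {poly C}).

(** The restriction of 2 DD to Q = 1, on functions of weight k; the variable is R. *)
Definition th (k : int) f : {poly C} := 3%:R * (4%:R - 'X ^+ 2) * f^`() + k%:~R * 'X * f.

(** The discriminant at Q = 1. *)
Definition disc : {poly C} := 4%:R - 'X ^+ 2.

Lemma deriv_disc : disc^`() = - (2%:R * 'X).
Proof. by rewrite /disc derivB derivXn derivMn derivC mul0rn sub0r expr1 -mulr_natl. Qed.

Lemma thD k f g : th k (f + g) = th k f + th k g.
Proof. by rewrite /th derivD; ring. Qed.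

Lemma thC k c f : th k (c%:P * f) = c%:P * th k f.
Proof. by rewrite /th derivM derivC; ring. Qed.

(** The discriminant is a constant of motion of weight six. *)
Lemma th_disc k f j : th k (disc ^+ j * f) = disc ^+ j * th (k - (6 * j)%N%:Z) f.
Proof.
elim: j k => [|j IH] k; first by rewrite !expr0 !mul1r subr0.
have -> : k - (6 * j.+1)%N%:Z = k - 6 - (6 * j)%N%:Z by lia.
rewrite !exprS -!mulrA -(IH (k - 6)) /th derivM deriv_disc -/disc.
have -> : (k - 6)%:~R = k%:~R - 6%:R :> {poly C} by rewrite rmorphB.
by move: ((disc ^+ j * f)^`()) => d; move: (disc ^+ j * f) => g; ring.
Qed.

Lemma thz k (q : int) f : th k (q%:~R * f) = q%:~R * th k f.
Proof. by rewrite -(rmorph_int (@polyC C)) thC. Qed.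

Lemma th1 k : th k 1 = k%:~R * 'X.
Proof. by rewrite /th -(rmorph1 (@polyC C)) derivC mulr0 add0r mulr1. Qed.

Lemma thX k : th k 'X = 3%:R * disc + k%:~R * 'X ^+ 2.
Proof. by rewrite /th derivX mulr1 -mulrA. Qed.

(** On the basis disc^j R^e the square of th is bidiagonal: one diagonal raises j
   by one. This is what turns the second order equation into a two-term recurrence. *)
Lemma th_th (e : bool) k j : th (k + 1) (th k (disc ^+ j * 'X ^+ e)) =
  (4%:R * (k - (6 * j)%N%:Z)%:~R * (k - (6 * j)%N%:Z + 1)%:~R
   - (k - (6 * j)%N%:Z - (3 * e)%N%:Z)%:~R * (k - (6 * j)%N%:Z - 2 - (3 * e)%N%:Z)%:~R * disc)
  * (disc ^+ j * 'X ^+ e).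
Proof.
rewrite !th_disc (_ : k + 1 - (6 * j)%N%:Z = k - (6 * j)%N%:Z + 1); last by ring.
move: (k - _) => {}k; rewrite [RHS]mulrCA; congr (_ * _).
have X2 : 'X ^+ 2 = 4%:R - disc :> {poly C} by rewrite /disc; ring.
case: e; rewrite ?expr1 ?expr0 ?muln1 ?muln0 ?subr0.
  rewrite thX X2; have -> : 3%:R * disc + k%:~R * (4%:R - disc) =
      (4 * k)%:~R * 1 + (3 - k)%:~R * disc by ring.
  have th_d l : th l disc = disc * ((l - 6)%:~R * 'X).
    by have := th_disc l 1 1; rewrite expr1 mulr1 muln1 th1.
  by rewrite thD !thz th1 th_d; ring.
by rewrite th1 thz thX X2; ring.
Qed.

(** The support condition for R^c to occur in weight k - t at Q = 1. *)
Definition graded (t k : nat) f :=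
  forall c, f`_c != 0 -> (t + 3 * c <= k)%N && ~~ odd (t + c + k).

Lemma gradedD t k f g : graded t k f -> graded t k g -> graded t k (f + g).
Proof.
move=> hf hg c; rewrite coefD; have [->|/hf //] := eqVneq f`_c 0.
by rewrite add0r; apply: hg.
Qed.

Lemma gradedC t k c f : graded t k f -> graded t k (c%:P * f).
Proof. by move=> hf i; rewrite coefCM mulf_eq0 negb_or => /andP[_ /hf]. Qed.

Lemma graded0 t k : graded t k 0.
Proof. by move=> c; rewrite coef0 eqxx. Qed.

Lemma graded_widen t k l f : graded t k f -> ~~ odd l -> graded t (k + l) f.
Proof. by move=> hf ol c /hf; lia. Qed.

Lemma graded_disc t k f : graded t k f -> graded t (k + 6) (disc * f).
Proof.
move=> hf c; rewrite /disc mulrBl coefB mulr_natl coefMn coefXnM.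
case: ltnP => hc.
  by rewrite subr0 -mulr_natl mulf_eq0 negb_or => /andP[_ /hf]; lia.
have [f0|/hf h _] := eqVneq f`_c 0; last by lia.
by rewrite f0 mul0rn sub0r oppr_eq0 => /hf; lia.
Qed.

(** The recurrence in powers of the discriminant. It can always be solved upwards,
   since the indicial factor 6 j (2 N + 1 - 6 j) is nonzero for j > 0, and it stops at
   the last power allowed in weight N exactly when N is not 1 modulo 3. Only the term
   without discriminant survives at the cusps R = 2 and R = -2. *)
Lemma graded_solution_exists N : (N %% 3 != 1)%N ->
  exists f, [/\ graded 0 N f, th (N%:Z + 1) (th N f) = (4 * N * N.+1)%:R * f,
                f.[2%:R] != 0 & f.[- 2%:R] != 0].
Proof.
move=> hN; pose e := odd N; pose q j : int := N%:Z - (6 * j)%N%:Z.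
pose t j : C := - ((q j - (3 * e)%N%:Z)%:~R * (q j - 2 - (3 * e)%N%:Z)%:~R).
pose den j : C := 4%:R * ((q j)%:~R * (q j + 1)%:~R - N%:R * N.+1%:R).
have den0 j : den j.+1 != 0.
  rewrite /den -[N%:R]/(N%:Z%:~R) -[N.+1%:R]/(N.+1%:Z%:~R) -!rmorphM -rmorphB /=.
  rewrite mulf_neq0 ?pnatr_eq0 // intr_eq0 /q.
  have -> : (N%:Z - (6 * j.+1)%N%:Z) * (N%:Z - (6 * j.+1)%N%:Z + 1) - N%:Z * N.+1%:Z
     = - (6 * j.+1)%N%:Z * (2 * N%:Z + 1 - (6 * j.+1)%N%:Z) by lia.
  by rewrite mulf_neq0 //; lia.
pose c := fix c j : C := if j is i.+1 then - (c i * t i) / den j else 1.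
have cS j : c j.+1 * den j.+1 = - (c j * t j) by rewrite /= divfK.
pose term j : {poly C} := (c j)%:P * (disc ^+ j * 'X ^+ e).
pose F n := \sum_(j < n) term j.
have thterm j : th (N%:Z + 1) (th N (term j)) - (4 * N * N.+1)%:R * term j =
    (c j * den j)%:P * (disc ^+ j * 'X ^+ e) + (c j * t j)%:P * (disc ^+ j.+1 * 'X ^+ e).
  rewrite /term !thC th_th -/(q j) /den /t exprS.
  rewrite !(polyCM, polyCN, polyCB) !(rmorph_nat, rmorph_int) !natrM; ring.
have eqF n : th (N%:Z + 1) (th N (F n.+1)) - (4 * N * N.+1)%:R * F n.+1 =
    (c n * t n)%:P * (disc ^+ n.+1 * 'X ^+ e).
  elim: n => [|n IH].
    rewrite /F big_ord1 thterm /den /q muln0 subr0 (_ : _ * (_ * _ - _) = 0); first by rewrite mulr0 mul0r add0r.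
    by rewrite -[(N%:Z)%:~R]/(N%:R) (_ : (N%:Z + 1)%:~R = N.+1%:R) ?subrr ?mulr0 // -natr1 rmorphD.
  have -> : F n.+2 = F n.+1 + term n.+1 by rewrite /F big_ord_recr.
  have split_eq (u v x y w : {poly C}) : u + v - w * (x + y) = (u - w * x) + (v - w * y) by ring.
  rewrite (thD N) (thD (N%:Z + 1)) split_eq IH thterm.
  by rewrite cS polyCN mulNr addrA subrr add0r.
pose J := ((N - 3 * e) %/ 6)%N.
(* The last admissible j: q J - 3 e is 0 or 2. *)
have tJ : t J = 0.
  rewrite /t /q; apply/eqP; rewrite oppr_eq0 mulf_eq0 !intr_eq0.
  by move: hN; rewrite /J /e; lia.
have hJ : (6 * J + 3 * e <= N)%N /\ ~~ odd (6 * J + 3 * e + N).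
  by move: hN; rewrite /J /e; lia.
have gr j : graded 0 (6 * j + 3 * e) (disc ^+ j * 'X ^+ e).
  elim: j => [|j IH].
    rewrite expr0 mul1r => i; rewrite coefXn; case: (i =P e :> nat) => [->|_]; last by rewrite eqxx.
    by case: (e).
  rewrite exprS -mulrA (_ : 6 * j.+1 + 3 * e = 6 * j + 3 * e + 6)%N; last by lia.
  exact: graded_disc.
have ev x : disc.[x] = 0 -> x != 0 -> (F J.+1).[x] != 0.
  move=> dx x0; rewrite /F horner_sum big_ord_recl big1 => [|i _].
    by rewrite addr0 /term expr0 mul1r hornerM hornerC mul1r hornerXn expf_neq0.
  by rewrite /term !hornerM horner_exp dx expr0n /= mul0r mulr0.
exists (F J.+1); split.
- rewrite /F; elim/big_ind: _ => [|f g|i _]; [exact: graded0|exact: gradedD|].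
  apply: gradedC; rewrite (_ : N = 6 * i + 3 * e + (N - (6 * i + 3 * e)))%N.
    by apply: graded_widen => //; have := ltn_ord i; case: hJ; lia.
  by have := ltn_ord i; case: hJ; lia.
- by apply/eqP; rewrite -subr_eq0 eqF tJ mulr0 mul0r.
- by apply: ev; rewrite ?pnatr_eq0 // /disc !hornerE /=; ring.
- by apply: ev; rewrite ?oppr_eq0 ?pnatr_eq0 // /disc !hornerE /=; ring.
Qed.

Lemma coef_th k g c : (th k g)`_c.+1 =
  12%:R * c.+2%:R * g`_c.+2 + (k - (3 * c)%N%:Z)%:~R * g`_c.
Proof.
have -> : th k g = 12%:R * g^`() - 3%:R * ('X ^+ 2 * g^`()) + k%:~R * ('X * g).
  by rewrite /th; ring.
have cn n (q : {poly C}) i : (n%:R * q)`_i = n%:R * q`_i.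
  by rewrite -(rmorph_nat (@polyC C)) coefCM.
have cz n (q : {poly C}) i : (n%:~R * q)`_i = n%:~R * q`_i.
  by rewrite -(rmorph_int (@polyC C)) coefCM.
rewrite coefD coefB !cn cz coefXM coefXnM /= coef_deriv -mulr_natr.
have -> : (k - (3 * c)%N%:Z)%:~R = k%:~R - 3%:R * c%:R :> C.
  by rewrite rmorphB /= -natrM.
case: c => [|c] /=; first by ring.
by rewrite subn2 /= coef_deriv -mulr_natr; ring.
Qed.

Lemma coef_compN g i : (g \Po (- 'X))`_i = (-1) ^+ i * g`_i.
Proof.
rewrite comp_polyE coef_sum.
have XN j : (- 'X) ^+ j = ((-1) ^+ j)%:P * 'X ^+ j :> {poly C}.
  by rewrite (exprNn 'X) polyC_exp polyCN.
under eq_bigr => j _ do rewrite coefZ XN coefCM coefXn.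
have [ig|gi] := ltnP i (size g); last first.
  rewrite nth_default // mulr0 big1 // => j _.
  by rewrite gtn_eqF ?mulr0 // (leq_trans (ltn_ord j)).
rewrite (bigD1 (Ordinal ig)) //= eqxx big1 ?addr0 => [|j ji]; first by rewrite mulr1 mulrC.
by rewrite eq_sym (negPf (_ : val j != i)) ?mulr0.
Qed.

(** Parity in R is the sign under R |-> - R. *)
Lemma graded_comp t k g : graded t k g -> g \Po (- 'X) = ((-1) ^+ (t + k))%:P * g.
Proof.
move=> hg; apply/polyP=> i; rewrite coefCM coef_compN.
have [->|/hg /andP[_ h]] := eqVneq g`_i 0; first by rewrite !mulr0.
by rewrite -[in LHS]signr_odd -[in RHS]signr_odd; congr ((-1) ^+ _ * _); move: h; lia.
Qed.

Lemma graded_of_comp t k g : g \Po (- 'X) = ((-1) ^+ (t + k))%:P * g ->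
  (forall c, g`_c != 0 -> (t + 3 * c <= k)%N) -> graded t k g.
Proof.
move=> hg hk c gc; rewrite hk //=; apply/negP => oc.
have := congr1 (fun q : {poly C} => q`_c) hg; rewrite coefCM coef_compN => /(mulIf gc).
rewrite -signr_odd -[in RHS]signr_odd => /signr_inj.
by have -> : odd c = ~~ odd (t + k) by [move: oc; lia]; case: (odd _).
Qed.

Lemma graded_th t k g (l : int) : l = k%:Z - t%:Z -> graded t k g -> graded t k.+1 (th l g).
Proof.
move=> hl hg [|c].
  have -> : (th l g)`_0 = 12%:R * g`_1.
    have -> : th l g = 12%:R * g^`() - 3%:R * ('X ^+ 2 * g^`()) + l%:~R * ('X * g).
      by rewrite /th; ring.
    have cn n (q : {poly C}) i : (n%:R * q)`_i = n%:R * q`_i.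
      by rewrite -(rmorph_nat (@polyC C)) coefCM.
    rewrite coefD coefB !cn -(rmorph_int (@polyC C)) coefCM coefXM coefXnM /= coef_deriv.
    by rewrite !mulr0 subr0 addr0.
  by rewrite mulf_eq0 negb_or => /andP[_ /hg]; lia.
rewrite coef_th; have [->|/hg h _] := eqVneq g`_c.+2 0; last by lia.
rewrite mulr0 add0r mulf_eq0 negb_or intr_eq0 => /andP[hc /hg h].
by move: hc h; rewrite hl; lia.
Qed.

Section Coprimality.
Variables (N : nat) (f : {poly C}).
Hypothesis f_gr : graded 0 N f.
Hypothesis f_eq : th (N%:Z + 1) (th N f) = (4 * N * N.+1)%:R * f.
Hypothesis f_cusp : f.[2%:R] != 0.
Hypothesis f_cusp' : f.[- 2%:R] != 0.

Lemma solution_neq0 : f != 0.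
Proof. by apply: contraNneq f_cusp => ->; rewrite horner0. Qed.

Lemma th_XsubC k m a g : th k (g * ('X - a%:P) ^+ m.+1) =
  (m.+1%:R * (3%:R * disc * g) + ('X - a%:P) * th k g) * ('X - a%:P) ^+ m.
Proof.
rewrite /th derivM deriv_exp derivXsubC mul1r -/disc /= -mulr_natl exprS; ring.
Qed.

(** Off the cusp th lowers the order of a zero by exactly one, while applying it
   twice multiplies the solution by a constant: the zeros are simple. *)
Lemma solution_coprime : coprimep f (th N f).
Proof.
apply/Pdiv.ClosedField.root_coprimep => a fa; apply/negP => ta.
have da : disc.[a] != 0.
  apply/negP => /eqP da; have : (a - 2%:R) * (a + 2%:R) = 0.
    by move: da; rewrite /disc !hornerE /= => da; rewrite -[RHS]oppr0 -da; ring.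
  move/eqP; rewrite mulf_eq0 subr_eq0 addr_eq0 => /orP[]/eqP ea.
    by move: fa; rewrite /root ea (negPf f_cusp).
  by move: fa; rewrite /root ea (negPf f_cusp').
have [m [g]] := multiplicity_XsubC f a; rewrite solution_neq0 /= /root => ga fE.
have XN0 : 'X - a%:P != 0 by rewrite polyXsubC_eq0.
(* The discriminant is abstracted, so that only its value at a matters. *)
have [d {}da thE] : exists2 d : {poly C}, d.[a] != 0 & forall k m g, exists r,
    th k (g * ('X - a%:P) ^+ m.+1) =
    (m.+1%:R * (3%:R * d * g) + ('X - a%:P) * r) * ('X - a%:P) ^+ m.
  by exists disc => // k n q; exists (th k q); rewrite th_XsubC.
have nat_ev n : (n%:R : {poly C}).[a] = n%:R.
  by rewrite -(rmorph_nat (@polyC C)) hornerC.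
have uev : ('X - a%:P).[a] = 0 by rewrite !hornerE subrr.
have ev0 n (q r : {poly C}) :
    (n%:R * (3%:R * d * q) + ('X - a%:P) * r).[a] = n%:R * (3%:R * d.[a] * q.[a]).
  by rewrite hornerD (hornerM ('X - _)) uev mul0r addr0 !hornerM !nat_ev.
case: m fE => [|[|m]] fE.
- by move: fa; rewrite fE expr0 mulr1 /root (negPf ga).
- have [r rE] := thE N 0%N g; move: ta; rewrite fE rE expr0 mulr1 /root.
  by rewrite ev0 !mulf_eq0 (negPf ga) (negPf da) !pnatr_eq0.
have [r rE] := thE N m.+1 g; have := f_eq; rewrite fE rE.
set A := (_ + _ * r); have [r' ->] := thE (N%:Z + 1) m A.
have -> : (4 * N * N.+1)%:R * (g * ('X - a%:P) ^+ m.+2) =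
    ((4 * N * N.+1)%:R * g * ('X - a%:P) ^+ 2) * ('X - a%:P) ^+ m by rewrite !exprS; ring.
move/(mulIf (expf_neq0 _ XN0)) => /(congr1 (horner_eval a)); rewrite /horner_eval.
rewrite ev0 ev0 hornerM horner_exp uev expr0n mulr0 => /eqP.
by rewrite !mulf_eq0 (negPf ga) (negPf da) !pnatr_eq0.
Qed.

(** The solution has at most a simple zero at Q = 0, where DD acts as a
   nonvanishing vector field. *)
Lemma solution_degree : let c := (size f).-1 in
  N = (3 * c)%N \/ N = (3 * c + 2)%N /\ size (th N f) = c.+2.
Proof.
move=> c; have f0 := solution_neq0.
have sf : size f = c.+1 by rewrite prednK // lt0n size_poly_eq0.
have lc : f`_c != 0 by rewrite -lead_coefE lead_coef_eq0.
have fz i : (c < i)%N -> f`_i = 0 by move=> ci; rewrite nth_default // sf.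
have [hc pc] := andP (f_gr lc).
have tz i : (c < i)%N -> (th N f)`_i.+1 = 0.
  by move=> ci; rewrite coef_th !fz ?mulr0 ?addr0 //; lia.
have tc : (th N f)`_c.+1 = (N%:Z - (3 * c)%N%:Z)%:~R * f`_c.
  by rewrite coef_th fz ?mulr0 ?add0r //; lia.
have [N3|N3] := eqVneq N (3 * c)%N; [by left | right].
have tc0 : (th N f)`_c.+1 != 0.
  by rewrite tc mulf_neq0 // intr_eq0; move: N3; lia.
have st : size (th N f) = c.+2.
  apply/eqP; rewrite eqn_leq; apply/andP; split.
    by apply/leq_sizeP => [[|i]] // ci; apply: tz; lia.
  by rewrite ltnNge; apply: contra tc0 => /leq_sizeP ->.
split=> //; apply/eqP; apply/negPn/negP => N2.
have: (th (N%:Z + 1) (th N f))`_c.+2 != 0.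
  rewrite coef_th tz ?mulr0 ?add0r; last by lia.
  by rewrite mulf_neq0 // intr_eq0; move: N2 N3 hc pc; lia.
by rewrite f_eq -(rmorph_nat (@polyC C)) coefCM fz ?mulr0 ?eqxx //; lia.
Qed.

(** The syzygies of the solution and its derivative are generated by the trivial
   one, with the bound on weights that makes this true before setting Q = 1. *)
Lemma syzygy k g1 g2 : graded N k g1 -> graded N.+1 k g2 ->
  g1 * f + g2 * th N f = 0 ->
  exists2 h, graded (2 * N + 1) k h & g1 = h * th N f /\ g2 = - (h * f).
Proof.
move=> h1 h2 e0; have f0 := solution_neq0.
have fd : f %| g2.
  rewrite -(Gauss_dvdpl _ solution_coprime).
  have -> : g2 * th N f = (- g1) * f by apply/eqP; rewrite -subr_eq0 mulNr opprK addrC e0.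
  by rewrite dvdp_mull.
have [h hE] : exists h, g2 = - (h * f).
  by exists (- (g2 %/ f)); rewrite mulNr opprK divpK.
have g1E : g1 = h * th N f.
  apply: (mulIf f0); apply/eqP; rewrite -subr_eq0 -e0 hE; apply/eqP; ring.
exists h => //; apply: graded_of_comp.
  apply: (mulIf f0).
  have := graded_comp h2; rewrite hE rmorphN rmorphM /= (graded_comp f_gr) => e.
  have s1 n : ((-1) ^+ n)%:P * ((-1) ^+ n)%:P = 1 :> {poly C}.
    by rewrite -polyCM -expr2 sqrr_sign.
  have e' : (h \Po - 'X) * (((-1) ^+ (0 + N))%:P * f) = ((-1) ^+ (N.+1 + k))%:P * h * f.
    by apply: oppr_inj; rewrite e; ring.
  have -> : ((-1) ^+ (2 * N + 1 + k) : C) = (-1) ^+ N * (-1) ^+ (N.+1 + k).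
    by rewrite -exprD; congr (_ ^+ _); lia.
  move: e' (s1 N); rewrite add0n polyCM; move: (h \Po _) ((-1) ^+ N)%:P => hc s e' ss.
  transitivity (s * s * (hc * f)); first by rewrite ss mul1r.
  by transitivity (s * (hc * (s * f))); [ring | rewrite e'; ring].
move=> c hc; have h0 : h != 0 by apply: contraNneq hc => ->; rewrite coef0.
have top q : q != 0 -> (h * q)`_(((size h).-1 + (size q).-1)) != 0.
  move=> q0; have := lead_coef_eq0 (h * q); rewrite mulf_eq0 (negPf h0) (negPf q0) lead_coefE.
  rewrite size_mul //.
  move: (size_poly_eq0 h) (size_poly_eq0 q); rewrite (negPf h0) (negPf q0).
  by case: (size h) (size q) => [//|a] [//|b] _ _ /=; rewrite addnS /= => ->.
have cd : (c <= (size h).-1)%N.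
  by rewrite -ltnS prednK ?lt0n ?size_poly_eq0 // ltnNge; apply: contra hc => /leq_sizeP ->.
(* The weight bound on h is read off its top coefficient, through g2 or g1 according
   to which of f and th N f fills its weight. *)
have [N3|[N3 st]] := solution_degree.
  have := h2 _ (_ : g2`_((size h).-1 + (size f).-1) != 0).
  by rewrite hE coefN oppr_eq0 => /(_ (top f f0)); lia.
have t0 : th N f != 0 by rewrite -size_poly_eq0 st.
have := h1 _ (_ : g1`_((size h).-1 + (size (th N f)).-1) != 0).
by rewrite g1E => /(_ (top _ t0)); rewrite st; lia.
Qed.

End Coprimality.
End Univariate.

(** * Symmetric polynomials and the ideal of matrix elements *)

Section Homogenization.
Variables (C : numClosedFieldType) (K : polynomials3 C).
Implicit Types (g h : {poly C}) (F : K).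
Local Notation QQ := (QQ K).
Local Notation RR := (RR K).
Local Notation e1 := (e1 K).
Local Notation e2 := (e2 K).
Local Notation e3 := (e3 K).
Local Notation kc := (kc K).

Lemma kc_eq0 c : (kc c == 0) = (c == 0).
Proof. exact: fmorph_eq0. Qed.

Lemma natK_neq0 n : n.+1%:R != 0 :> K.
Proof. by rewrite -(rmorph_nat kc) kc_eq0 pnatr_eq0. Qed.

(** Inverse to setting Q = 1, on functions of weight k. *)
Definition hom (k : nat) g : K :=
  \sum_(c < size g) kc g`_c * (QQ ^+ ((k - 3 * c)./2) * RR ^+ c).

Lemma hom_wide n k g : (size g <= n)%N ->
  hom k g = \sum_(c < n) kc g`_c * (QQ ^+ ((k - 3 * c)./2) * RR ^+ c).
Proof.
move=> gn; rewrite /hom -!(big_mkord xpredT (fun c => kc g`_c * (QQ ^+ ((k - 3 * c)./2) * RR ^+ c))).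
rewrite [RHS](big_cat_nat _ gn) //= [X in _ = _ + X]big_nat_cond [X in _ = _ + X]big1 ?addr0 //.
by move=> c /andP[/andP[gc _] _]; rewrite nth_default // rmorph0 mul0r.
Qed.

Lemma homD k g h : hom k (g + h) = hom k g + hom k h.
Proof.
pose n := maxn (size g) (size h).
rewrite (@hom_wide n) ?size_polyD // (@hom_wide n k g) ?leq_maxl //.
rewrite (@hom_wide n k h) ?leq_maxr // -big_split /=.
by apply: eq_bigr => c _; rewrite coefD rmorphD mulrDl.
Qed.

Lemma homC k c g : hom k (c%:P * g) = kc c * hom k g.
Proof.
have sz : (size (c%:P * g)%R <= size g)%N by rewrite mul_polyC; exact: size_scale_leq.
rewrite (hom_wide k sz).
by rewrite {1}/hom mulr_sumr; apply: eq_bigr => i _; rewrite coefCM rmorphM -mulrA.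
Qed.

Lemma homXn k c : hom k 'X^c = QQ ^+ ((k - 3 * c)./2) * RR ^+ c.
Proof.
rewrite /hom size_polyXn big_ord_recr /= big1 ?add0r => [|i _].
  by rewrite coefXn eqxx rmorph1 mul1r.
by rewrite coefXn ltn_eqF // rmorph0 mul0r.
Qed.

Lemma hom0 k : hom k 0 = 0.
Proof. by rewrite /hom size_poly0 big_ord0. Qed.

Lemma hom_sum k I (r : seq I) (P : pred I) (u : I -> {poly C}) :
  hom k (\sum_(i <- r | P i) u i) = \sum_(i <- r | P i) hom k (u i).
Proof. by elim/big_rec2: _ => [|i x y _ <-]; rewrite ?hom0 // homD. Qed.

Lemma poly_expand g : g = \sum_(c < size g) (g`_c)%:P * 'X^c.
Proof.
rewrite -{1}[g]coefK poly_def; apply: eq_bigr => c _; exact/esym/mul_polyC.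
Qed.

(** Additive identities between homogenizations can be checked on monomials. *)
Lemma hom_ind (k : nat) (P : {poly C} -> Prop) g : graded 0 k g ->
  P 0 -> (forall u v, P u -> P v -> P (u + v)) ->
  (forall a c, (3 * c <= k)%N -> ~~ odd (c + k) -> P (a%:P * 'X^c)) -> P g.
Proof.
move=> hg P0 PD PX; rewrite [g](poly_expand).
elim/big_ind: _ => //= c _; have [->|gc] := eqVneq g`_c 0; first by rewrite polyC0 mul0r.
by case/andP: (hg _ gc) => h1 h2; apply: PX.
Qed.

Lemma EE0_hom k g : EE 0 (hom k g) = 0.
Proof.
rewrite /hom EE_sum big1 // => c _.
by rewrite EEZ EEM !EEX EE0Q EE0R; ring.
Qed.

Lemma EE1_hom k g : graded 0 k g -> EE 1 (hom k g) = k%:R * hom k g.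
Proof.
move=> hg; pattern g; apply: (hom_ind hg) => [|u v hu hv|a c ck ok].
- by rewrite hom0 mulr0 (der0 (EE_der K 1)).
- by rewrite homD EED hu hv mulrDr.
rewrite homC EEZ mulrCA homXn EEM !EEX EE1Q EE1R; congr (_ * _).
have -> : k%:R = 2%:R * ((k - 3 * c)./2)%:R + 3%:R * c%:R :> K.
  by rewrite -!natrM -natrD; congr (_%:R); lia.
move: ((k - 3 * c)./2) => b {ck ok}.
by case: b => [|b]; case: c => [|c] /=; rewrite ?expr0 ?exprS; ring.
Qed.

(** The vector field DD corresponds to th / 2: D Q = R and D R = 6 Q^2 become
   (3 / 2) (4 - R^2) d/dR with a weight term once Q is normalized to 1. *)
Lemma DD_hom k g : graded 0 k g -> 2%:R * DD (hom k g) = hom k.+1 (th k g).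
Proof.
move=> hg; pattern g; apply: (hom_ind hg) => [|u v hu hv|a c ck ok].
- by rewrite /th raddf0 !mulr0 addr0 !hom0 (der0 (DD_der K)) mulr0.
- by rewrite thD (homD k u v) (homD k.+1 (th k u)) (DD_der K).1 mulrDr hu hv.
rewrite homC thC homC (DD_der K).2.
have -> : DD (kc a) = 0 by rewrite /DD !EEkc !mulr0 subr0.
rewrite mul0r add0r mulrCA homXn (DD_der K).2 !(derX (DD_der K)) DDQ DDR; congr (_ * _).
have -> : th k 'X^c = (12%:R * c%:R)%:P * 'X^(c.-1) + (k%:R - 3%:R * c%:R)%:P * 'X^(c.+1) :> {poly C}.
  rewrite /th derivXn !(polyCM, polyCB) !(rmorph_nat (@polyC C)) -[k%:~R]/(k%:R) -mulr_natl.
  by case: c {ck ok} => [|c] /=; rewrite ?expr0 ?exprS; ring.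
rewrite homD !homC !homXn rmorphM rmorphB rmorphM !rmorph_nat.
have -> : k%:R - 3%:R * c%:R = 2%:R * ((k - 3 * c)./2)%:R :> K.
  have -> : k%:R = 2%:R * ((k - 3 * c)./2)%:R + 3%:R * c%:R :> K.
    by rewrite -!natrM -natrD; congr (_%:R); lia.
  by ring.
have -> : ((k.+1 - 3 * c.+1)./2 = ((k - 3 * c)./2).-1)%N by lia.
case: c ck ok => [|c] ck ok.
  by move: (_./2) => b {ck ok}; case: b => [|b] /=; rewrite ?expr0 ?expr1 ?exprS; ring.
have -> : ((k.+1 - 3 * c.+1.-1)./2 = ((k - 3 * c.+1)./2).+2)%N by lia.
by move: (_./2) => b {ck ok}; case: b => [|b] /=; rewrite ?expr0 ?expr1 ?exprS; ring.
Qed.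

Lemma homQ k g : graded 0 k g -> QQ * hom k g = hom k.+2 g.
Proof.
move=> hg; pattern g; apply: (hom_ind hg) => [|u v hu hv|a c ck ok].
- by rewrite !hom0 mulr0.
- by rewrite !homD mulrDr hu hv.
rewrite !homC !homXn (_ : (k.+2 - 3 * c)./2 = ((k - 3 * c)./2).+1); last by lia.
by rewrite exprS; ring.
Qed.

Lemma homM k l g h : graded 0 k g -> graded 0 l h ->
  hom (k + l) (g * h) = hom k g * hom l h.
Proof.
move=> hg hh; pattern g; apply: (hom_ind hg) => [|u v hu hv|a c ck ok].
- by rewrite mul0r !hom0 mul0r.
- by rewrite mulrDl !homD mulrDl hu hv.
pattern h; apply: (hom_ind hh) => [|u v hu hv|b d dl ol].
- by rewrite mulr0 !hom0 mulr0.
- by rewrite mulrDr !homD mulrDr hu hv.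
have -> : a%:P * 'X^c * (b%:P * 'X^d) = (a * b)%:P * 'X^(c + d) :> {poly C}.
  by rewrite polyCM exprD; ring.
rewrite !homC !homXn rmorphM.
have -> : ((k + l - 3 * (c + d))./2 = (k - 3 * c)./2 + (l - 3 * d)./2)%N by lia.
by rewrite !exprD; ring.
Qed.

(** Symmetric polynomials, built up from the generators e1, Q and R. *)
Inductive sympoly : K -> Prop :=
| sym_kc c : sympoly (kc c)
| symD F F' : sympoly F -> sympoly F' -> sympoly (F + F')
| sym_e1 F : sympoly F -> sympoly (e1 * F)
| sym_Q F : sympoly F -> sympoly (QQ * F)
| sym_R F : sympoly F -> sympoly (RR * F).

Lemma symM F F' : sympoly F -> sympoly F' -> sympoly (F * F').
Proof.
move=> + hF'; elim=> [c|G G' _ h _ h'|G _ h|G _ h|G _ h].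
- elim: {F} hF' => [d|G G' _ h _ h'|G _ h|G _ h|G _ h].
  + by rewrite -rmorphM; constructor.
  + by rewrite mulrDr; constructor.
  + by rewrite mulrCA; constructor.
  + by rewrite mulrCA; constructor.
  + by rewrite mulrCA; constructor.
- by rewrite mulrDl; constructor.
- by rewrite -mulrA; constructor.
- by rewrite -mulrA; constructor.
- by rewrite -mulrA; constructor.
Qed.

Lemma sym_nat n : sympoly n%:R.
Proof. by rewrite -(rmorph_nat kc); constructor. Qed.
Lemma sym1 : sympoly 1. Proof. exact: sym_nat 1. Qed.
Lemma symN F : sympoly F -> sympoly (- F).
Proof. by move=> h; rewrite -mulN1r -(rmorphN1 kc); apply: symM => //; constructor. Qed.
Lemma symB F F' : sympoly F -> sympoly F' -> sympoly (F - F').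
Proof. by move=> h h'; constructor=> //; exact: symN. Qed.
Lemma symX F n : sympoly F -> sympoly (F ^+ n).
Proof. by move=> h; elim: n => [|n IH]; rewrite ?expr0 ?exprS; [exact: sym1|exact: symM]. Qed.
Lemma sym_e1' : sympoly e1. Proof. by rewrite -[e1]mulr1; constructor; exact: sym1. Qed.
Lemma sym_Q' : sympoly QQ. Proof. by rewrite -[QQ]mulr1; constructor; exact: sym1. Qed.
Lemma sym_R' : sympoly RR. Proof. by rewrite -[RR]mulr1; constructor; exact: sym1. Qed.

Lemma sym_divn n F : sympoly (n.+1%:R * F) -> sympoly F.
Proof.
move=> h; have -> : F = kc n.+1%:R^-1 * (n.+1%:R * F).
  by rewrite mulrA -(rmorph_nat kc) -rmorphM mulVf ?pnatr_eq0 // rmorph1 mul1r.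
by apply: symM => //; constructor.
Qed.

Lemma sym_e2 : sympoly e2.
Proof.
apply: (@sym_divn 2); have -> : 3%:R * e2 = e1 ^+ 2 - QQ by rewrite /QQ; ring.
by apply: symB; [exact/symX/sym_e1'|exact: sym_Q'].
Qed.

Lemma sym_e3 : sympoly e3.
Proof.
apply: (@sym_divn 26).
have -> : 27%:R * e3 = RR + 9%:R * (e1 * e2) - 2%:R * e1 ^+ 3 by rewrite /RR; ring.
apply: symB; last by apply: symM; [exact: sym_nat|exact/symX/sym_e1'].
by constructor; [exact: sym_R'|apply: symM; [exact: sym_nat|constructor; exact: sym_e2]].
Qed.

Lemma sym_pp n : sympoly (pp K n).
Proof.
suff [] : [/\ sympoly (pp K n), sympoly (pp K n.+1) & sympoly (pp K n.+2)] by [].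
elim: n => [|n [h0 h1 h2]].
  split.
  - have -> : pp K 0 = 3%:R by rewrite /pp !expr0; ring.
    exact: sym_nat.
  - have -> : pp K 1 = e1 by rewrite /pp !expr1.
    exact: sym_e1'.
  - have -> : pp K 2 = e1 ^+ 2 - 2%:R * e2 by rewrite /pp /e1 /e2; ring.
    apply: symB; [exact/symX/sym_e1'|apply: symM; [exact: sym_nat|exact: sym_e2]].
split=> //; rewrite pp_rec; constructor.
  by apply: symB; apply: symM => //; [exact: sym_e1'|exact: sym_e2].
by apply: symM => //; exact: sym_e3.
Qed.

(** Sets closed under E_0, E_1 and E_2 and under multiplication are closed under
   all the E_m, by the recursion. *)
Lemma EE_closed (P : K -> Prop) :
  (forall F F', P F -> P F' -> P (F + F')) ->
  (forall F F', sympoly F -> P F' -> P (F * F')) ->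
  (forall F m, (m <= 2)%N -> P F -> P (EE m F)) ->
  forall F m, P F -> P (EE m F).
Proof.
move=> PD PM P2 F m hF.
suff [] : [/\ P (EE m F), P (EE m.+1 F) & P (EE m.+2 F)] by [].
elim: m => [|m [h0 h1 h2]]; first by split; apply: (P2).
split=> //; rewrite EE_rec; apply: (PD); last by apply: (PM) => //; exact: sym_e3.
apply: (PD); first by apply: (PM) => //; exact: sym_e1'.
by rewrite -mulNr; apply: (PM) => //; exact/symN/sym_e2.
Qed.

Lemma sym_EE F m : sympoly F -> sympoly (EE m F).
Proof.
apply: (EE_closed symD symM) => {F m} F m hm.
have h1 : sympoly (EE m e1).
  have -> : EE m e1 = pp K m by rewrite /e1 !EEE.
  exact: sym_pp.
have DE (A B : K) n : EE 1 A = n%:R * A -> DD A = B -> 3%:R * EE 2 A = B + 2%:R * n%:R * e1 * A.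
  by rewrite /DD => -> <-; ring.
have hQ : sympoly (EE m QQ).
  case: m hm {h1} => [|[|[|//]]] _; rewrite ?EE0Q ?EE1Q; first exact: sym_nat 0.
    by apply: symM; [exact: sym_nat|exact: sym_Q'].
  apply: (@sym_divn 2); rewrite (DE QQ RR 2 (EE1Q K) (DDQ K)); constructor; first exact: sym_R'.
  by apply: symM; [apply: symM; [rewrite -natrM; exact: sym_nat|exact: sym_e1']|exact: sym_Q'].
have hR : sympoly (EE m RR).
  case: m hm {h1 hQ} => [|[|[|//]]] _; rewrite ?EE0R ?EE1R; first exact: sym_nat 0.
    by apply: symM; [exact: sym_nat|exact: sym_R'].
  apply: (@sym_divn 2); rewrite (DE RR _ 3 (EE1R K) (DDR K)); constructor.
    by apply: symM; [exact: sym_nat|exact/symX/sym_Q'].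
  by apply: symM; [apply: symM; [rewrite -natrM; exact: sym_nat|exact: sym_e1']|exact: sym_R'].
elim=> [c|G G' _ IH _ IH'|G hG IH|G hG IH|G hG IH].
- by rewrite EEkc; exact: sym_nat 0.
- by rewrite EED; constructor.
- by rewrite EEM; constructor; [exact: symM|constructor].
- by rewrite EEM; constructor; [exact: symM|constructor].
- by rewrite EEM; constructor; [exact: symM|constructor].
Qed.

Lemma sym_hom k g : sympoly (hom k g).
Proof.
rewrite /hom; elim/big_ind: _ => [|*|c _]; [exact: sym_nat 0|exact: symD|].
by apply: symM; [constructor|apply: symM; [exact/symX/sym_Q'|exact/symX/sym_R']].
Qed.

Lemma cf0 i j k : cf (0 : K) i j k = 0.
Proof. by rewrite -[0](mul0r (1 : K)) -(rmorph0 kc) cfZ mul0r. Qed.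

Lemma cf_sum I (r : seq I) (P : pred I) (u : I -> K) i j k :
  cf (\sum_(l <- r | P l) u l) i j k = \sum_(l <- r | P l) cf (u l) i j k.
Proof. by elim/big_rec2: _ => [|l x y _ <-]; rewrite ?cf0 // cfD. Qed.

Lemma cfN F i j k : cf (- F) i j k = - cf F i j k.
Proof. by rewrite -mulN1r -(rmorphN1 kc) cfZ mulN1r. Qed.

Lemma cfB F F' i j k : cf (F - F') i j k = cf F i j k - cf F' i j k.
Proof. by rewrite cfD cfN. Qed.

Lemma cf_nat n F i j k : cf (n%:R * F) i j k = n%:R * cf F i j k.
Proof. by rewrite -(rmorph_nat kc) cfZ. Qed.

Lemma cf_xxn n F i j k : cf (xx K ^+ n * F) i j k = cf F (i - n%:Z) j k.
Proof.
elim: n i => [|n IH] i; first by rewrite expr0 mul1r subr0.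
by rewrite exprS -mulrA cf_xx IH; congr (cf _ _ _ _); lia.
Qed.

Lemma cf_yyn n F i j k : cf (yy K ^+ n * F) i j k = cf F i (j - n%:Z) k.
Proof.
elim: n j => [|n IH] j; first by rewrite expr0 mul1r subr0.
by rewrite exprS -mulrA cf_yy IH; congr (cf _ _ _ _); lia.
Qed.

Lemma cf_zzn n F i j k : cf (zz K ^+ n * F) i j k = cf F i j (k - n%:Z).
Proof.
elim: n k => [|n IH] k; first by rewrite expr0 mul1r subr0.
by rewrite exprS -mulrA cf_zz IH; congr (cf _ _ _ _); lia.
Qed.

Lemma cf_pp n F i j k : cf (pp K n * F) i j k =
  cf F (i - n%:Z) j k + cf F i (j - n%:Z) k + cf F i j (k - n%:Z).
Proof. by rewrite /pp !mulrDl !cfD cf_xxn cf_yyn cf_zzn. Qed.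

Lemma cf_EE m F i j k : cf (EE m F) i j k =
  (i - m%:Z + 1)%:~R * cf F (i - m%:Z + 1) j k
  + (j - m%:Z + 1)%:~R * cf F i (j - m%:Z + 1) k
  + (k - m%:Z + 1)%:~R * cf F i j (k - m%:Z + 1).
Proof. by rewrite /EE !cfD cf_xxn cf_yyn cf_zzn cf_dX cf_dY cf_dZ. Qed.

(** E_1 is the Euler operator. *)
Lemma cf_homogeneous n F i j k : EE 1 F = n%:R * F -> cf F i j k != 0 ->
  i + j + k = n%:Z.
Proof.
move=> h f0; have := cf_EE 1 F i j k; rewrite h cf_nat !subrK -!mulrDl -!rmorphD /=.
by move/(mulIf f0)/eqP; rewrite -[n%:R]/((n%:Z)%:~R) eqr_int eq_sym => /eqP.
Qed.

Definition cf_symm F := forall i j k, cf F i j k = cf F j i k /\ cf F i j k = cf F i k j.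

Lemma sym_cf F : sympoly F -> cf_symm F.
Proof.
have he1 G : cf_symm G -> cf_symm (e1 * G).
  move=> h i j k; rewrite /e1 !mulrDl !cfD !cf_xx !cf_yy !cf_zz.
  have [a1 a2] := h (i - 1) j k; have [b1 b2] := h i (j - 1) k.
  have [c1 c2] := h i j (k - 1).
  by split; [rewrite a1 b1 c1; ring|rewrite a2 b2 c2; ring].
have he2 G : cf_symm G -> cf_symm (e2 * G).
  move=> h i j k; rewrite /e2 !mulrDl !cfD -!mulrA !cf_xx !cf_yy !cf_zz !cf_xx.
  have [a1 a2] := h (i - 1) (j - 1) k; have [b1 b2] := h i (j - 1) (k - 1).
  have [c1 c2] := h (i - 1) j (k - 1).
  split.
    by rewrite a1 b1 c1; ring.
  by rewrite a2 b2 c2; ring.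
have he3 G : cf_symm G -> cf_symm (e3 * G).
  move=> h i j k; rewrite /e3 -!mulrA !cf_xx !cf_yy !cf_zz.
  by have [a1 a2] := h (i - 1) (j - 1) (k - 1); split.
have hD G G' : cf_symm G -> cf_symm G' -> cf_symm (G + G').
  by move=> h h' i j k; rewrite !cfD; have [a b] := h i j k; have [a' b'] := h' i j k; split; congr (_ + _).
have hZ c G : cf_symm G -> cf_symm (kc c * G).
  by move=> h i j k; rewrite !cfZ; have [a b] := h i j k; split; congr (_ * _).
have hn n G : cf_symm G -> cf_symm (n%:R * G).
  by move=> h; rewrite -(rmorph_nat kc); exact: hZ.
have hN G : cf_symm G -> cf_symm (- G).
  by move=> h; rewrite -mulN1r -(rmorphN1 kc); exact: hZ.
elim=> [c|G G' _ h _ h'|G _ h|G _ h|G _ h].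
- by move=> i j k; rewrite -[kc c]mulr1 !cfZ !cf1; split; congr (_ * _%:R);
    case: (i == 0) (j == 0) (k == 0) => [] [] [].
- exact: hD.
- exact: he1.
- have -> : QQ * G = e1 * (e1 * G) + (- (3%:R * (e2 * G))) by rewrite /QQ; ring.
  by apply: hD; [exact/he1/he1|exact/hN/hn/he2].
- have -> : RR * G = 2%:R * (e1 * (e1 * (e1 * G))) + (- (9%:R * (e1 * (e2 * G)))) + 27%:R * (e3 * G).
    by rewrite /RR; ring.
  by apply: (hD); [apply: (hD); [exact/hn/he1/he1/he1|exact/hN/hn/he1/he2]|exact/hn/he3].
Qed.

(** The leading coefficient in x is the value at R = 2 (and Q = 1). *)
Lemma cf_hom k g : graded 0 k g -> cf (hom k g) k%:Z 0 0 = g.[2%:R].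
Proof.
have y0 F i : cf (yy K * F) i 0 0 = 0.
  by rewrite cf_yy; apply/eqP/negPn/negP => /cf_neg /and3P[_ + _]; lia.
have z0 F i : cf (zz K * F) i 0 0 = 0.
  by rewrite cf_zz; apply/eqP/negPn/negP => /cf_neg /and3P[_ _]; lia.
have cQ F i : cf (QQ * F) i 0 0 = cf F (i - 2) 0 0.
  have -> : QQ * F = xx K ^+ 2 * F + yy K * ((yy K - xx K - zz K) * F) + zz K * ((zz K - xx K) * F).
    by rewrite /QQ /e1 /e2; ring.
  by rewrite !cfD y0 z0 cf_xxn !addr0.
have cR F i : cf (RR * F) i 0 0 = 2%:R * cf F (i - 3) 0 0.
  have -> : RR * F = 2%:R * (xx K ^+ 3 * F) +
     yy K * ((2%:R * yy K ^+ 2 - 3%:R * xx K ^+ 2 - 3%:R * xx K * yy K - 3%:R * yy K * zz K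
              - 3%:R * zz K ^+ 2 + 12%:R * xx K * zz K) * F) +
     zz K * ((2%:R * zz K ^+ 2 - 3%:R * xx K ^+ 2 - 3%:R * xx K * zz K) * F).
    rewrite /RR /e1 /e2 /e3; ring.
  by rewrite !cfD y0 z0 cf_nat cf_xxn !addr0.
have cc b c : cf (QQ ^+ b * RR ^+ c) (2 * b + 3 * c)%N%:Z 0 0 = 2%:R ^+ c.
  elim: b => [|b IH]; last first.
    by rewrite exprS -mulrA cQ (_ : _ - 2 = (2 * b + 3 * c)%N%:Z) ?IH //; lia.
  rewrite expr0 mul1r; elim: c => [|c IH]; first by rewrite expr0 cf1.
  by rewrite exprS cR (_ : _ - 3 = (2 * 0 + 3 * c)%N%:Z) ?IH ?exprS //; lia.
move=> hg; pattern g; apply: (hom_ind hg) => [|u v hu hv|a c ck ok].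
- by rewrite hom0 cf0 horner0.
- by rewrite homD cfD hornerD hu hv.
rewrite homC homXn cfZ hornerM hornerC hornerXn; congr (_ * _).
by rewrite -(cc ((k - 3 * c)./2) c); congr (cf _ _ _ _); lia.
Qed.

Section Ideal.
Variables (N : nat) (f : {poly C}).
Hypothesis f_gr : graded 0 N f.
Hypothesis f_eq : th (N%:Z + 1) (th N f) = (4 * N * N.+1)%:R * f.

Definition sol : K := hom N f.
Definition dsol : K := hom N.+1 (th N f).

Let th_gr : graded 0 N.+1 (th N f).
Proof. by apply: (graded_th _ f_gr); lia. Qed.

Lemma EE0_sol : EE 0 sol = 0. Proof. exact: EE0_hom. Qed.
Lemma EE1_sol : EE 1 sol = N%:R * sol. Proof. exact: EE1_hom. Qed.
Lemma EE0_dsol : EE 0 dsol = 0. Proof. exact: EE0_hom. Qed.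
Lemma EE1_dsol : EE 1 dsol = N.+1%:R * dsol. Proof. exact: EE1_hom. Qed.
Lemma DD_sol : 2%:R * DD sol = dsol. Proof. exact: DD_hom. Qed.

Lemma DD_dsol : DD dsol = 2%:R * (N%:R * N.+1%:R) * QQ * sol.
Proof.
apply: (mulfI (natK_neq0 1)); rewrite /dsol (DD_hom th_gr).
rewrite (_ : N.+1%:Z = N%:Z + 1); last by lia.
rewrite f_eq -(rmorph_nat (@polyC C)) homC -(homQ f_gr) rmorph_nat !natrM /sol.
by ring.
Qed.

Lemma sol_null :
  3%:R * (4%:R * EE 2 (EE 2 sol) - 2%:R * EE 2 (N%:R * pp K 1 * sol)
          - 2%:R * N%:R * pp K 1 * EE 2 sol + N%:R ^+ 2 * pp K 1 ^+ 2 * sol)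
  = N.+2%:R * (4%:R * EE 3 sol - N%:R * pp K 1 ^+ 2 * sol).
Proof.
have D2 F : DD (2%:R * F) = 2%:R * DD F.
  by rewrite (DD_der K).2 (der_nat (DD_der K)) mul0r add0r.
apply: null_equation; [exact: EE0_sol|exact: EE1_sol| |].
  apply: (mulfI (natK_neq0 1)).
  by rewrite mulrCA DD_sol -EE1_dsol -DD_sol EEM EEn mul0r add0r.
apply: (mulfI (natK_neq0 1)).
by rewrite -D2 DD_sol DD_dsol !mulrA.
Qed.

(** The ideal generated by the solution and its derivative. It is the space of the
   matrix elements of products of three currents between the vacuum and functionals. *)
Definition in_ideal (F : K) :=
  exists A B, [/\ sympoly A, sympoly B & F = A * sol + B * dsol].

Lemma ideal_sol : in_ideal sol.
Proof. by exists 1, 0; split; [exact: sym1|exact: sym_nat 0|ring]. Qed.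

Lemma ideal_dsol : in_ideal dsol.
Proof. by exists 0, 1; split; [exact: sym_nat 0|exact: sym1|ring]. Qed.

Lemma idealD F F' : in_ideal F -> in_ideal F' -> in_ideal (F + F').
Proof.
move=> [A [B [hA hB ->]]] [A' [B' [hA' hB' ->]]].
by exists (A + A'), (B + B'); split; [exact: symD|exact: symD|ring].
Qed.

Lemma idealM F F' : sympoly F -> in_ideal F' -> in_ideal (F * F').
Proof.
move=> hF [A [B [hA hB ->]]].
by exists (F * A), (F * B); split; [exact: symM|exact: symM|ring].
Qed.

Lemma ideal_divn n F : in_ideal (n.+1%:R * F) -> in_ideal F.
Proof.
move=> h; have -> : F = kc n.+1%:R^-1 * (n.+1%:R * F).
  by rewrite mulrA -(rmorph_nat kc) -rmorphM mulVf ?pnatr_eq0 // rmorph1 mul1r.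
by apply: idealM => //; constructor.
Qed.

(** The second order equation keeps EE 2 dsol in the ideal; the other fields act
   through the recursion. *)
Lemma ideal_EE F m : in_ideal F -> in_ideal (EE m F).
Proof.
apply: (EE_closed idealD idealM) => {F m} F m hm.
have DE (A B : K) n : EE 1 A = n%:R * A -> DD A = B -> 3%:R * EE 2 A = B + 2%:R * n%:R * e1 * A.
  by rewrite /DD => -> <-; ring.
have c1 n : sympoly (2%:R * n%:R * e1).
  by apply: symM; [rewrite -natrM; exact: sym_nat|exact: sym_e1'].
have hs : in_ideal (EE m sol).
  case: m hm => [|[|[|//]]] _; rewrite ?EE0_sol ?EE1_sol.
  - by rewrite -(mul0r sol); apply: idealM; [exact: sym_nat 0|exact: ideal_sol].
  - by apply: idealM; [exact: sym_nat|exact: ideal_sol].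
  apply: (@ideal_divn 2); rewrite (DE _ _ _ EE1_sol erefl); apply: idealD.
    by apply: (@ideal_divn 1); rewrite DD_sol; exact: ideal_dsol.
  by apply: idealM => //; exact: ideal_sol.
have hd : in_ideal (EE m dsol).
  case: m hm {hs} => [|[|[|//]]] _; rewrite ?EE0_dsol ?EE1_dsol.
  - by rewrite -(mul0r sol); apply: idealM; [exact: sym_nat 0|exact: ideal_sol].
  - by apply: idealM; [exact: sym_nat|exact: ideal_dsol].
  apply: (@ideal_divn 2); rewrite (DE _ _ _ EE1_dsol DD_dsol); apply: idealD.
    apply: idealM; last exact: ideal_sol.
    by apply: symM; [rewrite -!natrM; exact: sym_nat|exact: sym_Q'].
  by apply: idealM => //; exact: ideal_dsol.
move=> [A [B [hA hB ->]]]; rewrite EED !EEM.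
apply: idealD; apply: idealD.
- by apply: idealM; [exact: sym_EE|exact: ideal_sol].
- exact: idealM.
- by apply: idealM; [exact: sym_EE|exact: ideal_dsol].
- exact: idealM.
Qed.

Lemma ideal_sym F : in_ideal F -> sympoly F.
Proof.
by move=> [A [B [hA hB ->]]]; apply: symD; apply: symM => //; exact: sym_hom.
Qed.

(** Linear forms on the ideal are tested on monomials in e1, Q, R times the two
   generators. *)
Lemma ideal_span (l : K -> C) :
  (forall F F', l (F + F') = l F + l F') -> (forall c F, l (kc c * F) = c * l F) ->
  (forall a b c, l (e1 ^+ a * (QQ ^+ b * RR ^+ c) * sol) = 0) ->
  (forall a b c, l (e1 ^+ a * (QQ ^+ b * RR ^+ c) * dsol) = 0) ->
  forall F, in_ideal F -> l F = 0.
Proof.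
move=> lD lZ l1 l2 F [A [B [hA hB ->]]].
suff hl S : (forall a b c, l (e1 ^+ a * (QQ ^+ b * RR ^+ c) * S) = 0) ->
    forall A, sympoly A -> l (A * S) = 0 by rewrite lD !hl ?addr0.
move=> {A B hA hB} lS A hA.
suff: forall a b c, l (A * (e1 ^+ a * (QQ ^+ b * RR ^+ c) * S)) = 0.
  by move/(_ 0%N 0%N 0%N); rewrite !expr0 !mul1r.
elim: {F} hA => [d|A1 A2 _ h1 _ h2|A1 _ h|A1 _ h|A1 _ h] a b c.
- by rewrite lZ lS mulr0.
- by rewrite mulrDl lD h1 h2 addr0.
- by rewrite -(h a.+1 b c) exprS; congr (l _); ring.
- by rewrite -(h a b.+1 c) exprS; congr (l _); ring.
- by rewrite -(h a b c.+1) exprS; congr (l _); ring.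
Qed.

End Ideal.

End Homogenization.

(** * The annihilator of the ideal and its dimension *)

Section LinearAlgebra.
Variable C : fieldType.

(** The rows of Z are a basis of the syzygies of M. *)
Lemma rank_of_syzygies r s k (M : 'M[C]_(r, s)) (Z : 'M[C]_(k, r)) :
  row_free Z -> Z *m M = 0 -> (forall y : 'rV_r, y *m M = 0 -> (y <= Z)%MS) ->
  (\rank M + k = r)%N.
Proof.
move=> /eqP Zf ZM hZ.
have : \rank (kermx M) = k.
  rewrite -Zf; apply/eqP; rewrite eqn_leq; apply/andP; split; apply: mxrankS.
    apply/row_subP => i; apply: hZ; apply/eqP; rewrite -sub_kermx; exact: row_sub.
  by rewrite sub_kermx ZM.
by rewrite mxrank_ker => <-; rewrite subnKC // rank_leq_row.
Qed.

Lemma annihilator_basis r s (M : 'M[C]_(r, s)) :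
  exists B : 'M[C]_((s - \rank M)%N, s), row_free B /\
    forall w : 'rV_s, (w <= B)%MS <-> M *m w^T = 0.
Proof.
have rk : \rank (kermx M^T) = (s - \rank M)%N by rewrite mxrank_ker mxrank_tr.
rewrite -rk; exists (row_base (kermx M^T)); split; first exact: row_base_free.
move=> w; rewrite eq_row_base sub_kermx -(inj_eq (@trmx_inj _ _ _)) trmx_mul trmxK trmx0.
by split=> [/eqP|->].
Qed.

Variable T : eqType.
Variable x0 : T.
Implicit Types (u : seq T) (U : T -> C).

Definition rowf u U : 'rV[C]_(size u) := \row_i U (nth x0 u i).
Definition frow u (y : 'rV[C]_(size u)) (p : T) : C :=
  if insub (index p u) is Some i then y 0 i else 0.

Lemma frowK u (y : 'rV[C]_(size u)) : uniq u -> rowf u (frow y) = y.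
Proof.
move=> uu; apply/rowP => i; rewrite mxE /frow index_uniq //.
by rewrite insubT //= => ?; congr (y 0 _); apply: val_inj.
Qed.

Lemma rowfK u U p : p \in u -> frow (rowf u U) p = U p.
Proof.
move=> pu; rewrite /frow insubT ?index_mem // => h.
by rewrite mxE /= nth_index.
Qed.

Definition mxf u v (A : T -> T -> C) : 'M[C]_(size u, size v) :=
  \matrix_(i, j) A (nth x0 u i) (nth x0 v j).

Lemma rowf_mul u v U A :
  rowf u U *m mxf u v A = rowf v (fun q => \sum_(p <- u) U p * A p q).
Proof.
apply/rowP => j; rewrite !mxE (big_nth x0) big_mkord.
by apply: eq_bigr => i _; rewrite !mxE.
Qed.

Lemma mxf_tr u v A : (mxf u v A)^T = mxf v u (fun p q => A q p).
Proof. by apply/matrixP => i j; rewrite !mxE. Qed.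

Lemma rowf_eq0 u U : rowf u U = 0 <-> forall p, p \in u -> U p = 0.
Proof.
split=> [h p pu|h]; last by apply/rowP => i; rewrite !mxE h // mem_nth.
by rewrite -(rowfK U pu) h /frow; case: insub => // i; rewrite mxE.
Qed.

End LinearAlgebra.

(** Exponents (a, c) of e1 and R in a monomial of degree n - t; that of Q is then
   determined. *)
Definition idx (t n : nat) : seq (nat * nat) :=
  [seq p <- allpairs pair (iota 0 n.+1) (iota 0 n.+1) |
     (t + p.1 + 3 * p.2 <= n)%N && ~~ odd (t + p.1 + p.2 + n)].

Lemma mem_idx t n a c :
  ((a, c) \in idx t n) = (t + a + 3 * c <= n)%N && ~~ odd (t + a + c + n).
Proof.
rewrite mem_filter; case: (boolP ((t + a + 3 * c <= n)%N && ~~ odd (t + a + c + n))).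
  by move=> h; apply/andP; split=> //; apply/allpairsP; exists (a, c); rewrite !mem_iota /=; split=> //; lia.
by move=> h; apply/negbTE; apply: contra h => /andP[].
Qed.

Lemma idx_uniq t n : uniq (idx t n).
Proof.
by apply: filter_uniq; apply: allpairs_uniq; rewrite ?iota_uniq // => -[? ?] [? ?] _ _ [-> ->].
Qed.

Section Annihilator.
Variables (C : numClosedFieldType) (K : polynomials3 C) (N : nat) (f : {poly C}).
Hypothesis f_gr : graded 0 N f.
Hypothesis f_eq : th (N%:Z + 1) (th N f) = (4 * N * N.+1)%:R * f.
Hypothesis f_cusp : f.[2%:R] != 0.
Hypothesis f_cusp' : f.[- 2%:R] != 0.
Local Notation QQ := (QQ K).
Local Notation RR := (RR K).
Local Notation e1 := (e1 K).
Local Notation kc := (kc K).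
Local Notation sol := (sol K N f).
Local Notation dsol := (dsol K N f).
Local Notation p0 := (0%N, 0%N).

Lemma poly_vanish (q : {poly C}) : (forall x, q.[x] = 0) -> q = 0.
Proof.
move=> h; apply/eqP/negPn/negP => q0.
pose rs : seq C := [seq i%:R | i <- iota 0 (size q)].
have al : all (root q) rs by apply/allP => x _; rewrite /root h.
have ur : uniq rs.
  by rewrite map_inj_uniq ?iota_uniq // => i j /eqP; rewrite eqr_nat => /eqP.
by have := max_poly_roots q0 al ur; rewrite size_map size_iota ltnn.
Qed.

Lemma ev_QQ (e : {rmorphism K -> C}) : let x := e (xx K) in let y := e (yy K) in
  let z := e (zz K) in e QQ = x ^+ 2 + y ^+ 2 + z ^+ 2 - x * y - y * z - z * x.
Proof. by rewrite /QQ /e1 /e2; ring. Qed.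

Lemma ev_RR (e : {rmorphism K -> C}) : let x := e (xx K) in let y := e (yy K) in
  let z := e (zz K) in e RR = (x + x - (y + z)) * (y + y - (z + x)) * (z + z - (x + y)).
Proof. by rewrite /RR /e1 /e2 /e3; ring. Qed.

(** By Lagrange's resolvents every pair of values of e1 and R is taken on Q = 1. *)
Lemma ev_exists (xi rho : C) : exists e : {rmorphism K -> C},
  [/\ e e1 = xi, e QQ = 1, e RR = rho & forall t, e (kc t) = t].
Proof.
have n2 : 2%:R != 0 :> C by rewrite pnatr_eq0.
have n3 : 3%:R != 0 :> C by rewrite pnatr_eq0.
have n4 : 4%:R != 0 :> C by rewrite pnatr_eq0.
have [s s2] : exists s : C, s ^+ 2 = - 3%:R by exists (sqrtC (- 3%:R)); rewrite sqrtCK.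
have [T T2] : exists T : C, T ^+ 2 = rho * T - 1.
  have [r r2] : exists r : C, r ^+ 2 = rho ^+ 2 - 4%:R.
    by exists (sqrtC (rho ^+ 2 - 4%:R)); rewrite sqrtCK.
  exists ((rho + r) / 2%:R); apply: (mulfI n4).
  have -> : 4%:R * ((rho + r) / 2%:R) ^+ 2 = rho ^+ 2 + 2%:R * rho * r + r ^+ 2 by field.
  by rewrite r2; field.
have T0 : T != 0.
  by apply/eqP => e; move: T2; rewrite e expr0n mulr0 sub0r => /esym/eqP; rewrite oppr_eq0 oner_eq0.
have [A A3] : exists A : C, A ^+ 3 = T by exists (3.-root T); rewrite rootCK.
have A0 : A != 0 by apply: contraNneq T0 => e; rewrite -A3 e expr0n.
have [B AB] : exists B : C, A * B = 1 by exists A^-1; rewrite mulfV.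
have B3 : A ^+ 3 + B ^+ 3 = rho.
  apply: (mulIf T0); rewrite mulrDl -{2}A3 -exprMn [B * A]mulrC AB A3 expr1n -expr2 T2; ring.
pose x := (xi + A + B) / 3%:R.
pose y := (xi - (A + B) / 2%:R + s * (A - B) / 2%:R) / 3%:R.
pose z := (xi - (A + B) / 2%:R - s * (A - B) / 2%:R) / 3%:R.
have [ex ey ez ek] := ev3E K x y z; exists (ev3 K x y z).
have e1E : ev3 K x y z e1 = xi by rewrite !rmorphD /= ex ey ez /x /y /z; field.
have pE : x + x - (y + z) = A + B by rewrite /x /y /z; field.
have qE : (y - z) ^+ 2 = - (A - B) ^+ 2 / 3%:R.
  have -> : (y - z) ^+ 2 = s ^+ 2 * (A - B) ^+ 2 / 9%:R by rewrite /y /z; field.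
  by rewrite s2; field.
have QE : ev3 K x y z QQ = x ^+ 2 + y ^+ 2 + z ^+ 2 - x * y - y * z - z * x.
  by rewrite ev_QQ ex ey ez.
have RE : ev3 K x y z RR = (x + x - (y + z)) * ((x + x - (y + z)) ^+ 2 - 9%:R * (y - z) ^+ 2) / 4%:R.
  by rewrite ev_RR ex ey ez; field.
split=> //.
  apply: (mulfI n4); rewrite QE.
  have -> : 4%:R * (x ^+ 2 + y ^+ 2 + z ^+ 2 - x * y - y * z - z * x) =
     (x + x - (y + z)) ^+ 2 + 3%:R * (y - z) ^+ 2 by ring.
  by rewrite pE qE; transitivity (4%:R * (A * B)); [field | rewrite AB].
by rewrite RE pE qE -B3; field.
Qed.

Definition gen (p : nat * nat) t n : K := e1 ^+ p.1 * hom K (n - t - p.1) 'X^(p.2).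

Lemma ev_hom (e : {rmorphism K -> C}) rho k g : e QQ = 1 -> e RR = rho ->
  (forall t, e (kc t) = t) -> e (hom K k g) = g.[rho].
Proof.
move=> eQ eR ek; rewrite /hom rmorph_sum horner_coef; apply: eq_bigr => c _.
by rewrite !rmorphM !rmorphXn /= eQ eR ek expr1n mul1r.
Qed.

(** The coefficient polynomial of e1^a. *)
Definition slice (u : seq (nat * nat)) (U : nat * nat -> C) a : {poly C} :=
  \sum_(p <- u | p.1 == a) (U p)%:P * 'X^(p.2).

Lemma coef_slice t n U a c :
  (slice (idx t n) U a)`_c = if (a, c) \in idx t n then U (a, c) else 0.
Proof.
rewrite /slice coef_sum big_mkcond /=.
have cE p : (if p.1 == a then ((U p)%:P * 'X^(p.2))`_c else 0) =
    if p == (a, c) then U (a, c) else 0.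
  rewrite coefCM coefXn; case: p => a' c' /=; rewrite xpair_eqE [c == c']eq_sym.
  by case: eqP => [->|] //=; case: eqP => [->|]; rewrite ?mulr1 ?mulr0.
under eq_bigr do rewrite cE.
case: ifP => h; last first.
  rewrite big_seq big1 // => p pu; case: eqP => // e; by rewrite e h in pu.
rewrite (bigD1_seq (a, c)) ?idx_uniq //= eqxx big1 ?addr0 // => p /negPf -> //.
Qed.

Lemma graded_slice t n U a : (a <= n)%N -> graded t (n - a) (slice (idx t n) U a).
Proof.
move=> an c; rewrite coef_slice; case: ifP => [|_]; last by rewrite eqxx.
by rewrite mem_idx; lia.
Qed.

Lemma graded_shift t k (g : {poly C}) : graded t k g -> graded 0 (k - t) g.
Proof. by move=> h c /h; lia. Qed.

Lemma sum_gen t n U a : \sum_(p <- idx t n | p.1 == a) kc (U p) * gen p t n =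
  e1 ^+ a * hom K (n - t - a) (slice (idx t n) U a).
Proof.
rewrite /slice hom_sum mulr_sumr; apply: eq_bigr => p /eqP pa.
by rewrite homC /gen pa mulrCA.
Qed.

Lemma sum_slices t n (F : nat * nat -> K) :
  \sum_(p <- idx t n) F p = \sum_(a < n.+1) \sum_(p <- idx t n | p.1 == a) F p.
Proof.
rewrite (exchange_big_dep xpredT) //= big_seq [RHS]big_seq; apply: eq_bigr => -[a c] h.
have an : (a < n.+1)%N by move: h; rewrite mem_idx; lia.
rewrite (big_pred1 (Ordinal an)) // => i; by rewrite eq_sym /= -val_eqE.
Qed.

(** A combination of the generators of the ideal vanishes only through a
   componentwise syzygy. *)
Lemma combination_eq0 n U V :
  \sum_(p <- idx N n) kc (U p) * (gen p N n * sol)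
  + \sum_(p <- idx N.+1 n) kc (V p) * (gen p N.+1 n * dsol) = 0 ->
  forall a, (a <= n)%N ->
    slice (idx N n) U a * f + slice (idx N.+1 n) V a * th N f = 0.
Proof.
move=> h a an.
pose P (rho : C) : {poly C} := \poly_(b < n.+1)
  (slice (idx N n) U b * f + slice (idx N.+1 n) V b * th N f).[rho].
have P0 rho : P rho = 0.
  apply: poly_vanish => xi; have [e [ee eQ eR ek]] := ev_exists xi rho.
  have := congr1 e h; rewrite rmorphD !rmorph_sum rmorph0 => <-.
  have part t (W : nat * nat -> C) g k : \sum_(p <- idx t n) e (kc (W p) * (gen p t n * hom K k g))
     = \sum_(b < n.+1) (slice (idx t n) W b * g).[rho] * xi ^+ b.
    under eq_bigr do rewrite mulrA rmorphM.
    rewrite -mulr_suml -rmorph_sum /= sum_slices rmorph_sum mulr_suml.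
    apply: eq_bigr => b _; rewrite sum_gen rmorphM rmorphXn /= ee.
    by rewrite !(ev_hom _ _ eQ eR ek) hornerM; ring.
  rewrite /sol /dsol !part -big_split /P horner_poly; apply: eq_bigr => b _ /=.
  by rewrite hornerD mulrDl.
apply: poly_vanish => rho; have := congr1 (fun q : {poly C} => q`_a) (P0 rho).
by rewrite /P coef_poly ltnS an coef0.
Qed.

Lemma graded_Xn t k c : (t + 3 * c <= k)%N -> ~~ odd (t + c + k) -> graded t k ('X^c : {poly C}).
Proof.
by move=> h1 h2 i; rewrite coefXn; case: (i =P c) => [->|_]; rewrite ?h1 ?h2 ?eqxx.
Qed.

Lemma slice_graded t n (g : {poly C}) a : (a <= n)%N -> graded t (n - a) g ->
  slice (idx t n) (fun p => g`_p.2) a = g.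
Proof.
move=> an hg; apply/polyP => c; rewrite coef_slice; case: ifP => // h.
apply/esym/eqP/negPn/negP => /hg; move: h; rewrite mem_idx; lia.
Qed.

Lemma gradedM s l k (g h : {poly C}) : graded s k g -> graded 0 l h -> (l <= s)%N ->
  graded (s - l) k (g * h).
Proof.
move=> hg hh ls c; have [//|hc] := boolP ((s - l + 3 * c <= k)%N && ~~ odd (s - l + c + k)).
rewrite coefM big1 ?eqxx // => -[j jc] _ /=.
have [->|/hg gj] := eqVneq g`_j 0; first by rewrite mul0r.
have [->|/hh hj] := eqVneq h`_(c - j) 0; first by rewrite mulr0.
by move: hc gj hj jc ls; lia.
Qed.

Lemma coef_slice_mul t n U (g : {poly C}) p :
  \sum_(q <- idx t n) U q * ((p.1 == q.1)%:R * ('X^(q.2) * g)`_p.2) =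
  (slice (idx t n) U p.1 * g)`_p.2.
Proof.
rewrite /slice mulr_suml coef_sum [RHS]big_mkcond /=; apply: eq_bigr => q _.
rewrite eq_sym; case: eqP => _; last by rewrite mul0r mulr0.
by rewrite mul1r -mulrA coefCM.
Qed.

(** The pairing with the monomial whose exponents are the partition of n with
   part differences p.1 and (n - p.1 - 3 p.2) / 2. *)
Definition pairing n (F : K) (p : nat * nat) : C :=
  let b := ((n - p.1 - 3 * p.2)./2)%N in
  cf F p.2%:Z (p.2 + b)%N%:Z (p.2 + b + p.1)%N%:Z.

Lemma pairingD n F G p : pairing n (F + G) p = pairing n F p + pairing n G p.
Proof. exact: cfD. Qed.

Lemma pairingZ n c F p : pairing n (kc c * F) p = c * pairing n F p.
Proof. exact: cfZ. Qed.

Lemma pairing_sum n I (r : seq I) (P : pred I) (u : I -> K) p :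
  pairing n (\sum_(l <- r | P l) u l) p = \sum_(l <- r | P l) pairing n (u l) p.
Proof. exact: cf_sum. Qed.

(** A symmetric homogeneous polynomial is determined by its coefficients at
   ordered exponents. *)
Lemma pairing_eq0 n F : sympoly F ->
  (forall i j k, cf F i j k != 0 -> i + j + k = n%:Z) ->
  (forall p, p \in idx 0 n -> pairing n F p = 0) -> F = 0.
Proof.
move=> hF hn h; have sF := sym_cf hF.
have hs i j k : i <= j -> j <= k -> cf F i j k = 0.
  move=> ij jk; apply/eqP/negPn/negP => c0.
  have s := hn _ _ _ c0; have /and3P[i0 j0 k0] := cf_neg c0.
  case: i j k i0 j0 k0 ij jk s c0 => [i|//] [j|//] [k|//] _ _ _ ij jk s.
  have := h ((k - j)%N, i); rewrite mem_idx /pairing /=.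
  rewrite (_ : (n - (k - j) - 3 * i)./2 = (j - i)%N); last by lia.
  rewrite (_ : (i + (j - i))%N = j); last by lia.
  rewrite (_ : (j + (k - j))%N = k); last by lia.
  by move=> ->; rewrite ?eqxx //; lia.
apply: cf_inj => i j k.
have [ij|/ltW ij] := leP i j; have [jk|/ltW jk] := leP j k; have [ik|/ltW ik] := leP i k.
- exact: hs.
- exact: hs.
- by rewrite (sF i j k).2; exact: hs.
- by rewrite (sF i j k).2 (sF i k j).1; exact: hs.
- by rewrite (sF i j k).1; exact: hs.
- by rewrite (sF i j k).1 (sF j i k).2; exact: hs.
- by rewrite (sF i j k).1 (sF j i k).2 (sF j k i).1; exact: hs.
- by rewrite (sF i j k).1 (sF j i k).2 (sF j k i).1; exact: hs.
Qed.

Lemma sym_gen p t n : sympoly (gen p t n).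
Proof. by apply: symM; [exact/symX/sym_e1'|exact: sym_hom]. Qed.

Lemma EE1_gen p t n : p \in idx t n -> EE 1 (gen p t n) = (n - t)%:R * gen p t n.
Proof.
case: p => a c; rewrite mem_idx /gen /= => h.
rewrite EEM EEX EE1e1 EE1_hom; last first.
  by apply: graded_Xn; lia.
have -> : (n - t)%:R = a%:R + (n - t - a)%:R :> K by rewrite -natrD; congr (_%:R); lia.
by case: a h => [|a] h /=; rewrite ?expr0 ?exprS; ring.
Qed.

Lemma pairing_degree t k n (S : K) p i j l : p \in idx t n -> (t = k)%N ->
  EE 1 S = k%:R * S -> cf (gen p t n * S) i j l != 0 -> i + j + l = n%:Z.
Proof.
move=> pi tk hS c0; apply: (cf_homogeneous _ c0).
rewrite EEM EE1_gen // hS; have -> : n%:R = (n - t)%:R + k%:R :> K.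
  by rewrite -natrD; congr (_%:R); case: p pi {c0} => a c; rewrite mem_idx; lia.
by ring.
Qed.

Lemma pairing_other n m F p : EE 1 F = m%:R * F -> m != n -> p \in idx 0 n ->
  pairing n F p = 0.
Proof.
move=> hF mn; case: p => a c; rewrite mem_idx /pairing /= => hp.
apply/eqP/negPn/negP => /(cf_homogeneous hF); move: mn hp; lia.
Qed.

Let sol0 : f != 0 := solution_neq0 f_cusp.
Let th_gr : graded 0 N.+1 (th N f).
Proof. by apply: (graded_th _ f_gr); lia. Qed.

(* The rows of M1 and M2 are the generators of degree n of the ideal, through sol and
   through dsol; the rows of Z1 and Z2 are the trivial syzygies
   e1^a R^c (dsol, - sol). *)
Let M1 n := mxf p0 (idx N n) (idx 0 n) (fun p q => pairing n (gen p N n * sol) q).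
Let M2 n := mxf p0 (idx N.+1 n) (idx 0 n) (fun p q => pairing n (gen p N.+1 n * dsol) q).
Let Z1 n := mxf p0 (idx (2 * N + 1) n) (idx N n)
  (fun q p => (p.1 == q.1)%:R * ('X^(q.2) * th N f)`_p.2).
Let Z2 n := mxf p0 (idx (2 * N + 1) n) (idx N.+1 n)
  (fun q p => (p.1 == q.1)%:R * ('X^(q.2) * - f)`_p.2).

Lemma mxf_mul (T : eqType) (x0 : T) u v w (A B : T -> T -> C) :
  mxf x0 u v A *m mxf x0 v w B = mxf x0 u w (fun p r => \sum_(q <- v) A p q * B q r).
Proof.
apply/matrixP => i j; rewrite !mxE (big_nth x0) big_mkord.
by apply: eq_bigr => l _; rewrite !mxE.
Qed.

Lemma sum_gen_slice t n (q : nat * nat) (S : K) (h : {poly C}) : (q.1 <= n)%N -> graded t (n - q.1) h ->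
  \sum_(p <- idx t n) kc ((p.1 == q.1)%:R * h`_p.2) * (gen p t n * S) =
  e1 ^+ q.1 * hom K (n - t - q.1) h * S.
Proof.
move=> qn hg; rewrite -{2}(slice_graded qn hg) -sum_gen mulr_suml [RHS]big_mkcond /=.
apply: eq_bigr => p _; case: eqP => _; first by rewrite mul1r mulrA.
by rewrite mul0r rmorph0 mul0r.
Qed.

Lemma Z_M n : row_mx (Z1 n) (Z2 n) *m col_mx (M1 n) (M2 n) = 0.
Proof.
rewrite mul_row_col !mxf_mul; apply/matrixP => i j; rewrite !mxE.
set q := nth p0 (idx (2 * N + 1) n) i; set r := nth p0 (idx 0 n) j.
have : q \in idx (2 * N + 1) n by exact: mem_nth.
case: q => a c; rewrite mem_idx => hq.
have an : (a <= n)%N by lia.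
have Xg : graded (2 * N + 1) (n - a) ('X^c : {poly C}).
  by apply: graded_Xn; lia.
have h1 := gradedM Xg th_gr (_ : N.+1 <= 2 * N + 1)%N.
have h2 := gradedM Xg f_gr (_ : N <= 2 * N + 1)%N.
have -> : \sum_(p <- idx N n) (p.1 == a)%:R * ('X^c * th N f)`_p.2 * pairing n (gen p N n * sol) r
   = pairing n (e1 ^+ a * hom K (n - N - a) ('X^c * th N f) * sol) r.
  rewrite -(@sum_gen_slice _ _ (a, c)) //=; last by move: (h1); rewrite (_ : 2 * N + 1 - N.+1 = N)%N; [apply|]; lia.
  by rewrite pairing_sum; apply: eq_bigr => p _; rewrite pairingZ.
have -> : \sum_(p <- idx N.+1 n) (p.1 == a)%:R * ('X^c * - f)`_p.2 * pairing n (gen p N.+1 n * dsol) r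
   = pairing n (e1 ^+ a * hom K (n - N.+1 - a) ('X^c * - f) * dsol) r.
  rewrite -(@sum_gen_slice _ _ (a, c)) //=.
    by rewrite pairing_sum; apply: eq_bigr => p _; rewrite pairingZ.
  have -> : 'X^c * - f = (-1)%:P * ('X^c * f) by rewrite polyCN polyC1; ring.
  by apply: gradedC; move: (h2); rewrite (_ : 2 * N + 1 - N = N.+1)%N; [apply|]; lia.
rewrite -pairingD; suff -> : e1 ^+ a * hom K (n - N - a) ('X^c * th N f) * sol +
   e1 ^+ a * hom K (n - N.+1 - a) ('X^c * - f) * dsol = 0 by exact: cf0.
have X0 : graded 0 (n - a - (2 * N + 1)) ('X^c : {poly C}) by exact: graded_shift.
have -> : (n - N - a = n - a - (2 * N + 1) + N.+1)%N by lia.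
have -> : (n - N.+1 - a = n - a - (2 * N + 1) + N)%N by lia.
have -> : 'X^c * - f = (-1)%:P * ('X^c * f) by rewrite polyCN polyC1; ring.
by rewrite homC !homM // -/sol -/dsol rmorphN1; ring.
Qed.

Lemma Z_free n : row_free (row_mx (Z1 n) (Z2 n)).
Proof.
rewrite -kermx_eq0; apply/eqP/row_matrixP => i; rewrite row0.
have : row i (kermx (row_mx (Z1 n) (Z2 n))) *m row_mx (Z1 n) (Z2 n) = 0.
  by rewrite -row_mul mulmx_ker row0.
move: (row i _) => y; rewrite mul_mx_row -[0]row_mx0 => /eq_row_mx[_].
rewrite -[y](frowK p0 y (idx_uniq _ _)) rowf_mul => /rowf_eq0 h.
apply/rowf_eq0 => -[a c] hac.
have an : (a <= n)%N by move: hac; rewrite mem_idx; lia.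
have s0 : slice (idx (2 * N + 1) n) (frow y) a = 0.
  apply/eqP; have : slice (idx (2 * N + 1) n) (frow y) a * - f == 0.
    apply/eqP/polyP => l; rewrite coef0.
    have [hl|hl] := boolP ((a, l) \in idx N.+1 n).
      by have := h _ hl; rewrite (coef_slice_mul _ _ _ (- f) (a, l)).
    have g := gradedM (@graded_slice (2 * N + 1)%N n (frow y) a an) f_gr (_ : N <= 2 * N + 1)%N.
    rewrite mulrN coefN; apply/eqP; rewrite oppr_eq0; apply/negPn/negP => /g.
    by move: hl; rewrite mem_idx; lia.
  by rewrite mulf_eq0 oppr_eq0 (negPf sol0) orbF.
by have := congr1 (fun q : {poly C} => q`_c) s0; rewrite coef_slice hac coef0.
Qed.

Lemma Z_complete n (y : 'rV_(size (idx N n) + size (idx N.+1 n))) :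
  y *m col_mx (M1 n) (M2 n) = 0 -> (y <= row_mx (Z1 n) (Z2 n))%MS.
Proof.
rewrite -[y]hsubmxK; move: (lsubmx y) (rsubmx y) => u v {y}.
rewrite -[u](frowK p0 u (idx_uniq _ _)) -[v](frowK p0 v (idx_uniq _ _)).
move: (frow u) (frow v) => U V {u v}.
rewrite mul_row_col !rowf_mul => e.
have {e} e p : p \in idx 0 n ->
   pairing n (\sum_(p <- idx N n) kc (U p) * (gen p N n * sol)
    + \sum_(p <- idx N.+1 n) kc (V p) * (gen p N.+1 n * dsol)) p = 0.
  move=> hp; rewrite pairingD !pairing_sum.
  under eq_bigr do rewrite pairingZ; under [X in _ + X]eq_bigr do rewrite pairingZ.
  pose W r := \sum_(q <- idx N n) U q * pairing n (gen q N n * sol) r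
    + \sum_(q <- idx N.+1 n) V q * pairing n (gen q N.+1 n * dsol) r.
  have : rowf p0 (idx 0 n) W = 0 by rewrite -e; apply/rowP => i; rewrite !mxE.
  by move/rowf_eq0 => /(_ _ hp).
have F0 := pairing_eq0 _ _ e.
have {}F0 : \sum_(p <- idx N n) kc (U p) * (gen p N n * sol)
    + \sum_(p <- idx N.+1 n) kc (V p) * (gen p N.+1 n * dsol) = 0.
  apply: F0.
    apply: symD; elim/big_ind: _ => [|*|p _]; try exact: (sym_nat K 0); try exact: symD.
      by apply: symM; [constructor|apply: symM; [exact: sym_gen|exact: sym_hom]].
    by apply: symM; [constructor|apply: symM; [exact: sym_gen|exact: sym_hom]].
  move=> i j k; apply: contraTeq => ijk; rewrite negbK cfD !cf_sum.
  rewrite !big_seq big1 ?add0r ?big1 // => p hp; rewrite cfZ.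
    have [->|/(pairing_degree hp erefl (EE1_dsol K f_gr)) s] := eqVneq (cf (gen p N.+1 n * dsol) i j k) 0.
      by rewrite mulr0.
    by rewrite s eqxx in ijk.
  have [->|/(pairing_degree hp erefl (EE1_sol K f_gr)) s] := eqVneq (cf (gen p N n * sol) i j k) 0.
    by rewrite mulr0.
  by rewrite s eqxx in ijk.
have hsyz := combination_eq0 F0.
pose h a := - (slice (idx N.+1 n) V a %/ f).
have hh a : (a <= n)%N -> [/\ graded (2 * N + 1) (n - a) (h a),
    slice (idx N n) U a = h a * th N f & slice (idx N.+1 n) V a = h a * - f].
  move=> an; have [g gg [g1 g2]] := syzygy f_gr f_eq f_cusp f_cusp'
    (@graded_slice N n U a an) (@graded_slice N.+1 n V a an) (hsyz a an).
  have -> : h a = g by rewrite /h g2 -mulNr mulpK // opprK.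
  by split=> //; rewrite mulrN.
have -> : row_mx (rowf p0 (idx N n) U) (rowf p0 (idx N.+1 n) V) =
    rowf p0 (idx (2 * N + 1) n) (fun q => (h q.1)`_q.2) *m row_mx (Z1 n) (Z2 n); last first.
  exact: submxMl.
have sl a : (a <= n)%N -> slice (idx (2 * N + 1) n) (fun q => (h q.1)`_q.2) a = h a.
  move=> an; have [hg _ _] := hh a an; rewrite -[RHS](slice_graded an hg).
  by rewrite /slice; apply: eq_bigr => p /eqP ->.
rewrite mul_mx_row !rowf_mul; congr row_mx; apply/rowP => i; rewrite !mxE.
  set p := nth _ _ _; have : p \in idx N n by exact: mem_nth.
  case: p => a c hp; have an : (a <= n)%N by move: hp; rewrite mem_idx; lia.
  rewrite (coef_slice_mul _ _ _ _ (a, c)) /= sl //.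
  by have [_ <- _] := hh a an; rewrite coef_slice hp.
set p := nth _ _ _; have : p \in idx N.+1 n by exact: mem_nth.
case: p => a c hp; have an : (a <= n)%N by move: hp; rewrite mem_idx; lia.
rewrite (coef_slice_mul _ _ _ _ (a, c)) /= sl //.
by have [_ _ <-] := hh a an; rewrite coef_slice hp.
Qed.

(** The matrix elements of degree n are the row space of the generators, whose rank is
   their number minus the number of syzygies; the syzygies are the multiples of the
   trivial one, and the annihilator has the complementary dimension. *)
Theorem annihilator_dim n : exists r (B : 'M[C]_(r, size (idx 0 n))),
  [/\ row_free B,
      forall w, (w <= B)%MS <-> (forall F, in_ideal N f F ->
         \sum_(p <- idx 0 n) frow w p * pairing n F p = 0)
    & (r + size (idx N n) + size (idx N.+1 n) = size (idx 0 n) + size (idx (2 * N + 1) n))%N].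
Proof.
have rk := rank_of_syzygies (Z_free n) (Z_M n) (@Z_complete n).
have [B [Bf hB]] := annihilator_basis (col_mx (M1 n) (M2 n)).
exists _, B; split=> //; last first.
  have arith (m a b c d : nat) : (m + a = b + c -> m <= d -> d - m + b + c = d + a)%N by lia.
  exact: arith rk (rank_leq_col _).
move=> w; rewrite hB mul_col_mx.
have MT u A : mxf p0 u (idx 0 n) A *m w^T = 0 <-> forall p, p \in u ->
   \sum_(q <- idx 0 n) frow w q * A p q = 0.
  rewrite -[w in _ *m w^T](frowK p0 w (idx_uniq _ _)) -[mxf _ _ _ _]trmxK -trmx_mul mxf_tr rowf_mul.
  split=> [/(congr1 trmx)|h]; first by rewrite trmxK trmx0 => /rowf_eq0.
  by rewrite (iffRL (rowf_eq0 p0 u _)) ?trmx0.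
have eM : col_mx (M1 n *m w^T) (M2 n *m w^T) = 0 <->
    (M1 n *m w^T = 0 /\ M2 n *m w^T = 0).
  split=> [|[-> ->]]; last by rewrite col_mx0.
  by rewrite -[X in _ = X]col_mx0 => /eq_col_mx.
apply: (iff_trans eM); split=> [[/MT hM1 /MT hM2] F hF|h].
  pose l F := \sum_(q <- idx 0 n) frow w q * pairing n F q.
  have gn a b c t S : EE 1 S = t%:R * S ->
      (forall p, p \in idx t n -> l (gen p t n * S) = 0) ->
      l (e1 ^+ a * (QQ ^+ b * RR ^+ c) * S) = 0.
    move=> hS hz; have [en|en] := eqVneq (a + 2 * b + 3 * c + t)%N n.
      have := hz (a, c); rewrite mem_idx /gen /= homXn.
      have -> : ((n - t - a - 3 * c)./2 = b)%N by lia.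
      by apply; lia.
    rewrite /l big_seq big1 // => q hq; rewrite (@pairing_other _ (a + 2 * b + 3 * c + t)%N) ?mulr0 //.
    have -> : (a + 2 * b + 3 * c + t)%:R = a%:R + 2%:R * b%:R + 3%:R * c%:R + t%:R :> K.
      by rewrite -!natrM -!natrD.
    rewrite !EEM !EEX EE1e1 EE1Q EE1R hS.
    by case: a {en} => [|a]; case: b => [|b]; case: c => [|c] /=; rewrite ?expr0 ?exprS; ring.
  apply: (ideal_span (l := l) _ _ _ _ hF) => [G G'|c G|a b c|a b c].
  - by rewrite /l -big_split; apply: eq_bigr => q _; rewrite pairingD mulrDr.
  - by rewrite /l mulr_sumr; apply: eq_bigr => q _; rewrite pairingZ mulrCA.
  - by apply: gn (EE1_sol K f_gr) _.
  - by apply: gn (EE1_dsol K f_gr) _.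
by split; apply/MT => p hp; apply: h; apply: idealM;
  do ?[exact: sym_gen]; [exact: ideal_sol|exact: ideal_dsol].
Qed.

End Annihilator.

(** * Counting *)

Definition conv (p : {poly int}) (u : nat -> int) (d : nat) : int :=
  \sum_(i < d.+1) p`_i * u (d - i)%N.

Lemma conv_coef p u d m : (d <= m)%N -> conv p u d = (p * \poly_(i < m.+1) u i)`_d.
Proof.
move=> dm; rewrite coefM; apply: eq_bigr => i _; rewrite coef_poly.
by rewrite (_ : d - i < m.+1)%N //; lia.
Qed.

Lemma conv_mul p q u d : conv (p * q) u d = conv p (conv q u) d.
Proof.
rewrite (conv_coef _ _ (leqnn d)) -mulrA coefM; apply: eq_bigr => i _.
by rewrite (conv_coef _ _ (leq_subr i d)).
Qed.

Lemma conv_1X k u d : conv (1 - 'X^k) u d = u d - (if (k <= d)%N then u (d - k)%N else 0).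
Proof.
rewrite (conv_coef _ _ (leqnn d)) mulrBl mul1r coefB coefXnM !coef_poly ltnSn.
by rewrite (_ : d - k < d.+1)%N ?ltnNge; [case: (k <= d)%N|lia].
Qed.

Lemma eq_conv p u w d : u =1 w -> conv p u d = conv p w d.
Proof. by move=> uw; apply: eq_bigr => i _; rewrite uw. Qed.

Definition idx2 (t n : nat) : seq nat :=
  [seq a <- iota 0 n.+1 | (t + a <= n)%N && ~~ odd (t + a + n)].

(** Splitting off one factor R. *)
Lemma size_idx t n : size (idx t n) =
  (size (idx2 t n) + (if 3 <= n then size (idx t (n - 3)) else 0))%N.
Proof.
pose r := if (3 <= n)%N then idx t (n - 3) else [::].
have -> : (if 3 <= n then size (idx t (n - 3)) else 0)%N = size r by rewrite /r; case: ifP.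
suff /perm_size -> : perm_eq (idx t n) ([seq (a, 0%N) | a <- idx2 t n] ++ [seq (q.1, q.2.+1) | q <- r]).
  by rewrite size_cat !size_map.
apply: uniq_perm; first exact: idx_uniq.
  rewrite cat_uniq; apply/and3P; split.
  - by rewrite map_inj_uniq ?filter_uniq ?iota_uniq // => i j [].
  - by apply/hasPn => q /mapP[[a c] _ ->]; apply/mapP => -[].
  - rewrite map_inj_uniq; last by move=> [? ?] [? ?] [-> ->].
    by rewrite /r; case: ifP => // _; exact: idx_uniq.
move=> [a c]; rewrite mem_cat mem_idx; apply/idP/orP => [h|[/mapP[a']|/mapP[[a' c']]]].
- case: c h => [|c] h; [left|right].
    by apply/mapP; exists a => //; rewrite mem_filter mem_iota; lia.
  apply/mapP; exists (a, c) => //; rewrite /r (_ : 3 <= n)%N; last by lia.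
  by rewrite mem_idx; lia.
- by rewrite mem_filter => /andP[h _] [-> ->]; lia.
rewrite /r; case: ifP => // n3; rewrite mem_idx => h [-> ->]; lia.
Qed.

Lemma size_idx2 t n : size (idx2 t n) =
  ((t <= n) + (if 2 <= n then size (idx2 t (n - 2)) else 0))%N.
Proof.
pose r := if (2 <= n)%N then idx2 t (n - 2) else [::].
have -> : (if 2 <= n then size (idx2 t (n - 2)) else 0)%N = size r by rewrite /r; case: ifP.
suff /perm_size -> : perm_eq (idx2 t n) (nseq (t <= n)%N (n - t)%N ++ r).
  by rewrite size_cat size_nseq.
have mr a : (a \in r) = (2 <= n)%N && ((t + a <= n - 2)%N && ~~ odd (t + a + n)).
  rewrite /r; case: ifP => // n2; rewrite mem_filter mem_iota; lia.
apply: uniq_perm; first by rewrite filter_uniq ?iota_uniq.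
  rewrite cat_uniq; apply/and3P; split.
  - by case: (t <= n)%N.
  - by apply/hasPn => a; rewrite mr mem_nseq; lia.
  - by rewrite /r; case: ifP => // _; rewrite filter_uniq ?iota_uniq.
by move=> a; rewrite mem_cat mem_nseq mr mem_filter mem_iota; lia.
Qed.

(** The generating function of the exponents (a, b, c) with a + 2 b + 3 c = n - t. *)
Lemma conv_idx t d : conv ((1 - 'X) * (1 - 'X^2) * (1 - 'X^3)) (fun n => (size (idx t n))%:Z) d
  = (d == t)%:R.
Proof.
rewrite conv_mul.
rewrite (@eq_conv _ _ (fun n => (size (idx2 t n))%:Z)) => [|n]; last first.
  rewrite conv_1X size_idx; case: ifP => _; lia.
rewrite conv_mul (@eq_conv _ _ (fun n => (t <= n)%N%:Z)) => [|n]; last first.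
  by rewrite conv_1X size_idx2; case: ifP => _; lia.
rewrite -['X]expr1 conv_1X; case: d => [|d] /=; first by rewrite subr0; lia.
by rewrite subn1 /=; lia.
Qed.

(** * Irreducible highest weight modules *)

Section HighestWeight.
Variables (C : numClosedFieldType) (c h : C) (M : lmodType C).
Variables (L : int -> {linear M -> M}) (v : M).
Implicit Types (x y w : M) (n m : int).

Inductive neg_span w : M -> Prop :=
| ns_gen : neg_span w w
| ns_lin a x y : neg_span w x -> neg_span w y -> neg_span w (a *: x + y)
| ns_L n x : 0 < n -> neg_span w x -> neg_span w (L (- n) x).

Lemma ns_0 w : neg_span w 0.
Proof. by rewrite -(addNr w) -scaleN1r; apply: ns_lin; exact: ns_gen. Qed.

Lemma ns_Z w a x : neg_span w x -> neg_span w (a *: x).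
Proof. by move=> hx; rewrite -[_ *: _]addr0; apply: ns_lin => //; exact: ns_0. Qed.

Lemma ns_D w x y : neg_span w x -> neg_span w y -> neg_span w (x + y).
Proof. by move=> hx hy; rewrite -[x]scale1r; apply: ns_lin. Qed.

Hypothesis vir : virasoro_rel c L.

Lemma vir_comm m n x : exists a b : C,
  L m (L n x) = L n (L m x) + a *: L (m + n) x + b *: x.
Proof.
exists (m - n)%:~R, (if m + n == 0 then c / 12%:R * (m ^+ 3 - m)%:~R else 0).
by rewrite -addrA -vir addrCA subrr addr0.
Qed.

Lemma vir_comm0 m n x : m + n != 0 ->
  L m (L n x) = L n (L m x) + (m - n)%:~R *: L (m + n) x.
Proof.
move=> mn; apply/eqP; rewrite addrC -subr_eq; apply/eqP.
by rewrite vir (negPf mn) scale0r addr0.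
Qed.

(** The negative modes applied to a singular vector already span a submodule. *)
Lemma neg_span_stable w mu x m : (forall n, 0 < n -> L n w = 0) -> L 0 w = mu *: w ->
  neg_span w x -> neg_span w (L m x).
Proof.
move=> w1 w0 hx; elim: hx m => {x} [m|a x y _ hx _ hy m|n x n0 hx IH m].
- case: (ltrgtP m 0) => [m0|m0|->].
  + by rewrite -[m]opprK; apply: ns_L; [rewrite oppr_gt0|exact: ns_gen].
  + by rewrite w1 //; exact: ns_0.
  + by rewrite w0; apply/ns_Z/ns_gen.
- by rewrite linearP; apply: ns_lin.
have [a [b ->]] := vir_comm m (- n) x.
by apply: ns_D; [apply: ns_D; [apply: ns_L|exact: ns_Z]|exact: ns_Z].
Qed.

Definition kill (s : seq C) x := foldr (fun a y => L 0 y - a *: y) x s.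

Lemma killP s a x y : kill s (a *: x + y) = a *: kill s x + kill s y.
Proof.
elim: s => //= b s IH; rewrite IH linearP scalerDr !scalerBr opprD !scalerA mulrC.
by rewrite addrACA.
Qed.

Lemma kill_L0 s x : kill s (L 0 x) = L 0 (kill s x).
Proof. by elim: s => //= b s ->; rewrite linearB linearZ_LR. Qed.

Lemma kill0 s : kill s 0 = 0.
Proof. by elim: s => //= b s ->; rewrite linear0 scaler0 subr0. Qed.

Lemma kill_cat s t x : kill (s ++ t) x = kill t (kill s x).
Proof.
elim: s x => //= b s IH x; rewrite IH.
have := killP t (- b) (kill s x) (L 0 (kill s x)).
by rewrite kill_L0 scaleNr addrC => ->; rewrite scaleNr addrC.
Qed.

Lemma kill_eigen s mu x : L 0 x = mu *: x -> kill s x = (\prod_(a <- s) (mu - a)) *: x.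
Proof.
move=> hx; elim: s => [|b s IH]; first by rewrite big_nil scale1r.
by rewrite big_cons /= IH linearZ /= hx !scalerA -scalerBl; congr (_ *: _); ring.
Qed.

(** The sum of the generalized L_0-eigenspaces of weights h + k, k >= k0, phrased without a
   direct sum decomposition. *)
Definition low (k0 : nat) x := exists s : seq nat,
  all (leq k0) s /\ kill [seq h + k%:R | k <- s] x = 0.

Lemma kill_catC s t x : kill (s ++ t) x = kill (t ++ s) x.
Proof.
rewrite !kill_cat; elim: s => //= b s IH.
have := killP t (- b) (kill s x) (L 0 (kill s x)).
by rewrite kill_L0 scaleNr addrC => ->; rewrite scaleNr IH addrC.
Qed.

Lemma lowP k0 a x y : low k0 x -> low k0 y -> low k0 (a *: x + y).
Proof.
move=> [s [hs ks]] [t [ht kt]]; exists (s ++ t); split; first by rewrite all_cat hs.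
rewrite killP; rewrite {1}map_cat kill_cat ks kill0 scaler0 add0r.
by rewrite map_cat kill_catC kill_cat kt kill0.
Qed.

Lemma low_L k0 n x : 0 < n -> low k0 x -> low k0.+1 (L (- n) x).
Proof.
case: n => [[|n]|] // _ [s [hs ks]]; exists [seq (k + n.+1)%N | k <- s]; split.
  by rewrite all_map; apply: sub_all hs => k /=; lia.
rewrite -map_comp -[RHS](linear0 (L (- n.+1%:Z))) -ks.
elim: s {hs ks} => //= k s ->.
have := vir_comm0 (m := 0) (n := - n.+1%:Z) (kill [seq h + k%:R | k <- s] x).
rewrite !add0r => -> //; rewrite linearB linearZ_LR /= -addrA; congr (_ + _).
rewrite opprK -scalerBl -scaleNr; congr (_ *: _).
by rewrite natrD -[_%:~R]/(n.+1%:R); ring.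
Qed.

Lemma low_weaken k0 k1 x : (k0 <= k1)%N -> low k1 x -> low k0 x.
Proof.
by move=> k01 [s [hs ks]]; exists s; split=> //; apply: sub_all hs => k; exact: leq_trans.
Qed.

Lemma low_neg_span k0 w x : L 0 w = (h + k0%:R) *: w -> neg_span w x -> low k0 x.
Proof.
move=> hw; elim=> {x} [|a x y _ hx _ hy|n x n0 _ hx]; last first.
- by apply: (@low_weaken _ k0.+1) => //; exact: low_L.
- exact: lowP.
by exists [:: k0]; split; rewrite /= ?leqnn // hw subrr.
Qed.

Lemma low_eigen k0 mu x : L 0 x = mu *: x -> (forall k, (k0 <= k)%N -> mu != h + k%:R) ->
  low k0 x -> x = 0.
Proof.
move=> hx hmu [s [hs]]; rewrite (kill_eigen _ hx) => /eqP; rewrite scaler_eq0.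
case/orP=> [|/eqP //]; rewrite big_map prodf_seq_eq0 => /hasP[k ks].
by rewrite subr_eq0 (negPf (hmu k _)) //; exact: (allP hs).
Qed.

Hypothesis hwv : highest_weight_vector h L v.
Hypothesis irr : forall S : set M, L_submodule L S -> S = [set 0] \/ S = [set: M].

Lemma irreducible_span w mu x : (forall n, 0 < n -> L n w = 0) -> L 0 w = mu *: w ->
  w != 0 -> neg_span w x.
Proof.
move=> w1 w0 wn; have : L_submodule L [set y | neg_span w y].
  split=> [|a y z hy hz|n y hy]; [exact: ns_0|exact: ns_lin|exact: neg_span_stable w1 w0 hy].
case/irr => /seteqP[h1 h2]; last by apply: (h2 x).
by have := h1 w (ns_gen w); rewrite /= => e; rewrite e eqxx in wn.
Qed.

Lemma hw_span x : neg_span v x.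
Proof. by have [v0 vL vp] := hwv; apply: irreducible_span vL v0. Qed.

(** A singular vector above the highest weight generates a submodule that misses
   the highest weight vector. *)
Lemma singular_eq0 k w : (forall n, 0 < n -> L n w = 0) ->
  L 0 w = (h + k.+1%:R) *: w -> w = 0.
Proof.
move=> w1 w0; apply/eqP/negPn/negP => wn.
have [v0 vL vp] := hwv; have := low_neg_span w0 (irreducible_span v w1 w0 wn).
move/(low_eigen vL) => e; move: v0; rewrite e ?eqxx // => i ki.
rewrite -subr_eq0 opprD addrA subrr sub0r oppr_eq0 pnatr_eq0; lia.
Qed.

Lemma low_all x : low 0 x.
Proof.
have [_ vL _] := hwv; apply: (low_neg_span (w := v)); last exact: hw_span.
by rewrite addr0.
Qed.

Lemma low_L1 n x : 0 < n -> low 1 (L (- n) x).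
Proof. by move=> n0; apply: low_L => //; exact: low_all. Qed.

Lemma hw_ind (P : M -> Prop) : P v -> (forall a x y, P x -> P y -> P (a *: x + y)) ->
  (forall n x, 0 < n -> P x -> P (L (- n) x)) -> forall x, P x.
Proof. by move=> Pv Pl PL x; elim: (hw_span x) => {x} [|a x y _ + _|n x n0 _]; auto. Qed.

(** The coefficient of the highest weight vector is well defined: a nonzero multiple of
   v is not a sum of vectors of higher weight. *)
Lemma vacuum_functional : exists phi : M -> C,
  [/\ forall a x y, phi (a *: x + y) = a * phi x + phi y, phi v = 1
     & forall n x, 0 < n -> phi (L (- n) x) = 0].
Proof.
have dec x : exists a y, x = a *: v + y /\ low 1 y.
  elim/hw_ind: x => [|b x y [a [z [-> hz]]] [a' [z' [-> hz']]]|n x n0 _].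
  - by exists 1, 0; rewrite scale1r addr0; split=> //; exists [::].
  - exists (b * a + a'), (b *: z + z'); split; last exact: lowP.
    by rewrite scalerDr scalerDl scalerA addrACA.
  - by exists 0, (L (- n) x); rewrite scale0r add0r; split=> //; exact: low_L1.
have uniq a a' y y' : a *: v + y = a' *: v + y' -> low 1 y -> low 1 y' -> a = a'.
  move=> e hy hy'; have [v0 vL _] := hwv; apply/eqP; rewrite -subr_eq0; apply/negPn/negP => aa.
  have : low 1 ((a - a') *: v).
    have -> : (a - a') *: v = (- 1) *: y + y'.
      have <- : a *: v - a' *: v + y = y' by rewrite addrAC e addrAC subrr add0r.
      by rewrite scalerBl scaleN1r [RHS]addrC addrK.
    exact: lowP.
  move/(low_eigen (mu := h)) => /(_ _ _) e0.
  have : (a - a') *: v = 0.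
    apply: e0 => [|k k1]; first by rewrite linearZ_LR /= vL !scalerA mulrC.
    by rewrite -subr_eq0 opprD addrA subrr sub0r oppr_eq0 pnatr_eq0; lia.
  by move/eqP; rewrite scaler_eq0 (negPf aa) (negPf v0).
pose phi x := sval (cid (dec x)).
have phiP x : exists y, x = phi x *: v + y /\ low 1 y by rewrite /phi; case: cid.
have phiE x a y : x = a *: v + y -> low 1 y -> phi x = a.
  by move=> e hy; have [z [e' hz]] := phiP x; apply: uniq hz hy; rewrite -e -e'.
exists phi; split.
- move=> a x y; have [x' [ex hx]] := phiP x; have [y' [ey hy]] := phiP y.
  apply: (phiE _ _ (a *: x' + y')); last exact: lowP.
  by rewrite {1}ex {1}ey scalerDr scalerDl scalerA addrACA.
- by apply: (phiE _ _ 0); [rewrite scale1r addr0|exists [::]].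
- by move=> n x n0; apply: (phiE _ _ (L (- n) x)); [rewrite scale0r add0r|exact: low_L1].
Qed.

Variable phi : M -> C.
Hypothesis phiP : forall a x y, phi (a *: x + y) = a * phi x + phi y.
Hypothesis phiv : phi v = 1.
Hypothesis phi_neg : forall n x, 0 < n -> phi (L (- n) x) = 0.

Lemma phi0 : phi 0 = 0.
Proof. by have := phiP (-1) 0 0; rewrite scaler0 addr0 mulN1r addNr. Qed.
Lemma phiD x y : phi (x + y) = phi x + phi y.
Proof. by have := phiP 1 x y; rewrite scale1r mul1r. Qed.
Lemma phiZ a x : phi (a *: x) = a * phi x.
Proof. by have := phiP a x 0; rewrite !addr0 phi0 addr0. Qed.

Lemma phi_L0 x : phi (L 0 x) = h * phi x.
Proof.
have [_ vL _] := hwv.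
elim/hw_ind: x => [|a x y hx hy|n x n0 _]; first by rewrite vL phiZ.
  by rewrite linearP !phiP hx hy; ring.
rewrite vir_comm0; last by rewrite add0r oppr_eq0 gt_eqF.
by rewrite phiD phiZ !add0r !phi_neg // !mulr0 ?addr0.
Qed.

(** The functionals obtained from the vacuum functional by positive modes separate
   points: their common kernel is a proper submodule. *)
Inductive words : (M -> C) -> Prop :=
| words_phi : words phi
| words_L t n : 0 < n -> words t -> words (fun x => t (L n x)).

Lemma words_lin t : words t -> forall a x y, t (a *: x + y) = a * t x + t y.
Proof. by elim=> {t} [|t n _ _ IH] a x y; [exact: phiP|rewrite linearP IH]. Qed.

Lemma words_separate x : (forall t, words t -> t x = 0) -> x = 0.
Proof.
pose S := [set x | forall t, words t -> t x = 0].
suff SL : L_submodule L S.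
  have [SE|SE] := irr SL; first by move=> hx; have : S x by []; rewrite SE.
  move=> _; have : S v by rewrite SE.
  by move/(_ _ words_phi)/eqP; rewrite phiv oner_eq0.
have lin0 t : words t -> t 0 = 0.
  by move=> /words_lin ht; have := ht (-1) 0 0; rewrite scaler0 addr0 mulN1r addNr.
split=> [t ht|a y z hy hz t ht|m y hy t ht]; first exact: lin0.
  by rewrite words_lin // hy // hz // mulr0 addr0.
have linD t' u w : words t' -> t' (u + w) = t' u + t' w.
  by move=> /words_lin ht'; have := ht' 1 u w; rewrite scale1r mul1r.
have linZ t' a u : words t' -> t' (a *: u) = a * t' u.
  by move=> ht'; have := words_lin ht' a u 0; rewrite !addr0 lin0 // addr0.
elim: ht m y hy => {t} [|t k k0 ht IH] m y hy.
  case: (ltrgtP m 0) => [m0|m0|->].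
  - by rewrite -[m]opprK phi_neg // oppr_gt0.
  - exact: hy (words_L m0 words_phi).
  - by rewrite phi_L0 hy ?mulr0 //; exact: words_phi.
have [a [b ->]] := vir_comm k m y.
have h1 : t (L m (L k y)) = 0 by apply: IH => t' ht'; exact: hy (words_L k0 ht').
have h2 : t (L (k + m) y) = 0 by exact: IH.
by rewrite !linD // !linZ // h1 h2 (hy _ ht) !mulr0 !addr0.
Qed.

End HighestWeight.

Section SpecialVectors.
Variables (C : numClosedFieldType) (c h : C) (M : lmodType C).
Variables (L : int -> {linear M -> M}) (v : M).
Hypothesis irr : irreducible_hw_module c h L v.

Let vir : virasoro_rel c L. Proof. by case: irr. Qed.
Let hw : highest_weight_vector h L v. Proof. by case: irr. Qed.
Let irr3 : forall S : set M, L_submodule L S -> S = [set 0] \/ S = [set: M].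
Proof. by case: irr. Qed.

Lemma vacuum_L_neg1 : h = 0 -> L (- 1) v = 0.
Proof.
move=> h0; have [v0 vL vp] := hw.
apply: (singular_eq0 vir hw irr3 (k := 0)) => [n n0|].
  have := vir n (- 1) v; rewrite (vp n n0) linear0 subr0 => ->.
  have [->|n1] := eqVneq n 1.
    by rewrite (_ : 1 + - 1 = 0 :> int) // eqxx vL h0
      !(scale0r, scaler0, mulr0, addr0).
  have n2 : 0 < n - 1 by lia.
  have n3 : n + - 1 != 0 by lia.
  by rewrite (vp _ n2) (negPf n3) scale0r scaler0 addr0.
rewrite (vir_comm0 vir) // vL linearZ_LR /= !add0r -scalerDl opprK.
by rewrite h0 add0r.
Qed.

Variable phi : M -> C.
Hypothesis phiP : forall a x y, phi (a *: x + y) = a * phi x + phi y.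
Hypothesis phi_neg : forall n x, 0 < n -> phi (L (- n) x) = 0.

(** The level two singular vector, dually: phi (L_2 - k L_1^2) is killed by L_(-1)
   and L_(-2) on the right, and vanishes on v. *)
Lemma null_functional k : 3%:R = k * (4%:R * h + 2%:R) ->
  4%:R * h + c / 2%:R = k * (6%:R * h) ->
  forall x, phi (L 2 x) = k * phi (L 1 (L 1 x)).
Proof.
move=> k1 k2; have [v0 vL vp] := hw.
have pD x y : phi (x + y) = phi x + phi y by exact: phiD phiP x y.
have pZ a x : phi (a *: x) = a * phi x by exact: phiZ phiP a x.
have p0 : phi 0 = 0 by exact: phi0 phiP.
have pL0 x : phi (L 0 x) = h * phi x by exact: (phi_L0 vir hw irr3 phiP phi_neg).
have cm m n x : m + n != 0 -> L m (L n x) = L n (L m x) + (m - n)%:~R *: L (m + n) x.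
  exact: (vir_comm0 vir).
have c10 x : L 1 (L 0 x) = L 0 (L 1 x) + 1%:R *: L 1 x by rewrite cm.
have c11 x : L 1 (L (- 1) x) = L (- 1) (L 1 x) + 2%:R *: L 0 x.
  have := vir 1 (- 1) x.
  rewrite (_ : 1 + - 1 = 0 :> int) // eqxx mulr0 scale0r addr0.
  by move/eqP; rewrite subr_eq addrC => /eqP.
apply: (hw_ind vir hw irr3) => [|a x y hx hy|n x n0 _].
- by rewrite !vp // linear0 p0 mulr0.
- by rewrite !linearP !phiP hx hy; ring.
have [n1|n1] := eqVneq n 1; last have [n2|n2] := eqVneq n 2.
- rewrite n1 c11 cm // pD pZ phi_neg // add0r linearD c11 linearZ_LR /= c10.
  by rewrite !pD !pZ phi_neg // pD pZ !pL0 -[(2 - -1)%:~R]/(3%:R) k1; ring.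
- have -> : L 2 (L (- n) x) = L (- n) (L 2 x) + 4%:R *: L 0 x + (c / 2%:R) *: x.
    have := vir 2 (- 2) x; rewrite n2 subrr eqxx => /eqP; rewrite subr_eq addrC addrA => /eqP ->.
    by congr (_ + _ *: _); rewrite -[(2 ^+ 3 - 2)%:~R]/(6%:R); field.
  have c12 y : L 1 (L (- 2) y) = L (- 2) (L 1 y) + 3%:R *: L (- 1) y by rewrite cm.
  have q1 y : phi (L (- 1) y) = 0 by exact: phi_neg.
  have q2 y : phi (L (- 2) y) = 0 by exact: phi_neg.
  rewrite n2 c12 linearD linearZ_LR /= c12 c11 !(pD, pZ, q1, q2, pL0).
  by transitivity ((4%:R * h + c / 2%:R) * phi x); [ring | rewrite k2; ring].
have np y (m : int) : m < 0 -> phi (L m y) = 0.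
  by move=> m0; rewrite -[m]opprK phi_neg // oppr_gt0.
have n3 : 3 <= n by lia.
have l1 y m : m - n != 0 -> L m (L (- n) y) = L (- n) (L m y) + (m + n)%:~R *: L (m - n) y.
  by move=> mn; rewrite cm // opprK.
have l2 y : L 1 (L (1 - n) y) = L (1 - n) (L 1 y) + (1 - (1 - n))%:~R *: L (1 + (1 - n)) y.
  by rewrite cm //; lia.
have l3 y : phi (L (- n) y) = 0 by apply: np; lia.
have l4 y : phi (L (1 - n) y) = 0 by apply: np; lia.
have l5 y : phi (L (2 - n) y) = 0 by apply: np; lia.
have l6 y : phi (L (1 + (1 - n)) y) = 0 by apply: np; lia.
have m1 : 1 - n != 0 by lia.
have m2 : 2 - n != 0 by lia.
rewrite (l1 _ _ m1) (l1 _ _ m2) linearD linearZ_LR /= (l1 _ _ m1) l2.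
by rewrite !(pD, pZ, l3, l4, l5, l6); ring.
Qed.

End SpecialVectors.

Section PrimaryFields.
Variables (C : numClosedFieldType) (c hM hN Delta s : C) (M N : lmodType C).
Variables (LM : int -> {linear M -> M}) (LN : int -> {linear N -> N}).
Variables (vM : M) (vN : N) (psi : int -> {linear M -> N}).
Hypothesis irrM : irreducible_hw_module c hM LM vM.
Hypothesis irrN : irreducible_hw_module c hN LN vN.
Hypothesis prim : primary_field Delta s LM LN psi.
Hypothesis shift : hM - s + Delta = hN.

(** The image would have weight below the highest one. *)
Lemma primary_vacuum n : 0 < n -> psi n vM = 0.
Proof.
move=> n0; have [virM [v0 vL vp] irrM3] := irrM; have [virN hwN irrN3] := irrN.
have e : LN 0 (psi n vM) = (hN - n%:~R) *: psi n vM.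
  have := prim 0 n vM; rewrite vL linearZ_LR /= => /eqP; rewrite subr_eq addr0 -scalerDl => /eqP ->.
  by congr (_ *: _); rewrite -shift add0r mul1r; ring.
apply: (low_eigen e (k0 := 0)) (low_all virN hwN irrN3 _) => k _.
rewrite -subr_eq0 (_ : _ - _ = - ((n + k%:Z)%:~R)); last first.
  by rewrite rmorphD /=; ring.
by rewrite oppr_eq0 intr_eq0; lia.
Qed.

Lemma primary_truncated x : exists B : int, forall n, B < n -> psi n x = 0.
Proof.
have [virM hwM irrM3] := irrM.
elim/(hw_ind virM hwM irrM3): x => [|a x y [B hB] [B' hB']|m x m0 [B hB]].
- by exists 0; exact: primary_vacuum.
- by exists (Num.max B B') => n; rewrite gt_max => /andP[h h']; rewrite linearP hB // hB' // scaler0 addr0.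
exists (B + m) => n hn; have := prim (- m) n x.
rewrite hB; last by lia.
rewrite linear0 (hB (n - m)); last by lia.
by rewrite scaler0 sub0r => /eqP; rewrite oppr_eq0 => /eqP.
Qed.

End PrimaryFields.

(** * Exponentials of commuting operators *)

Section OperatorSeries.
Variables (C : numClosedFieldType) (U : lmodType C) (X : nat -> U -> U).
Implicit Types (u : U) (i j k l : nat).
Hypothesis Xlin : forall i a u w, X i (a *: u + w) = a *: X i u + X i w.
Hypothesis X0 : forall u, X 0 u = 0.
Hypothesis Xcomm : forall i j u, X i (X j u) = X j (X i u).

Lemma linfun0 (Y : U -> U) : (forall a u w, Y (a *: u + w) = a *: Y u + Y w) -> Y 0 = 0.
Proof. by move=> Yl; have := Yl (-1) 0 0; rewrite scaler0 addr0 scaleN1r addNr. Qed.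

Lemma linfunZ (Y : U -> U) : (forall a u w, Y (a *: u + w) = a *: Y u + Y w) ->
  forall a u, Y (a *: u) = a *: Y u.
Proof. by move=> Yl a u; rewrite -[a *: u]addr0 Yl (linfun0 Yl) addr0. Qed.

Lemma linfunD (Y : U -> U) : (forall a u w, Y (a *: u + w) = a *: Y u + Y w) ->
  forall u w, Y (u + w) = Y u + Y w.
Proof. by move=> Yl u w; rewrite -[u in LHS]scale1r Yl scale1r. Qed.

Lemma linfun_sum (Y : U -> U) : (forall a u w, Y (a *: u + w) = a *: Y u + Y w) ->
  forall (I : Type) (r : seq I) (P : pred I) (F : I -> U),
  Y (\sum_(i <- r | P i) F i) = \sum_(i <- r | P i) Y (F i).
Proof. by move=> Yl I r P F; apply: (big_morph Y (linfunD Yl) (linfun0 Yl)). Qed.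

(** Cauchy products may be summed in either order. *)
Lemma triangle_exchange n (F : nat -> nat -> U) :
  \sum_(i < n.+1) \sum_(j < (n - i).+1) F i j = \sum_(j < n.+1) \sum_(i < (n - j).+1) F i j.
Proof.
have wide (G : nat -> nat -> U) : \sum_(i < n.+1) \sum_(j < (n - i).+1) G i j =
    \sum_(i < n.+1) \sum_(j < n.+1 | (i + j <= n)%N) G i j.
  apply: eq_bigr => i _; rewrite (big_ord_widen_cond n.+1 xpredT (G i)); last by lia.
  by apply: eq_bigl => j /=; have := ltn_ord i; lia.
rewrite wide (wide (fun j i => F i j)) (exchange_big_dep xpredT) //=.
by apply: eq_bigr => j _; apply: eq_bigl => i; rewrite addnC.
Qed.

Local Notation pow := (opser_pow X).

Lemma powP k i a u w : pow k i (a *: u + w) = a *: pow k i u + pow k i w.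
Proof.
elim: k i => [|k IH] i /=; first by case: ifP => _; rewrite ?scaler0 ?addr0.
by rewrite scaler_sumr -big_split; apply: eq_bigr => j _; rewrite IH Xlin.
Qed.

Lemma pow_small k i u : (i < k)%N -> pow k i u = 0.
Proof.
elim: k i => // k IH i ik /=; rewrite big1 // => -[[|j] ji] _ /=; first exact: X0.
rewrite IH; last by lia.
exact: linfun0 (Xlin j.+1).
Qed.

(** Euler's operator t d/dt applied to X(t)^(k + 1). *)
Lemma pow_derivative k i u :
  i%:R *: pow k.+1 i u = k.+1%:R *: \sum_(j < i.+1) j%:R *: X j (pow k (i - j) u).
Proof.
elim: k i => [|k IH] i.
  rewrite scale1r scaler_sumr; apply: eq_bigr => j _ /=.
  have [ij|ij] := eqVneq (i - j)%N 0%N; last by rewrite (linfun0 (Xlin j)) !scaler0.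
  by congr (_ *: _); congr (_%:R); have := ltn_ord j; lia.
have -> : i%:R *: pow k.+2 i u = \sum_(j < i.+1) j%:R *: X j (pow k.+1 (i - j) u)
    + \sum_(j < i.+1) X j ((i - j)%:R *: pow k.+1 (i - j) u).
  rewrite -big_split scaler_sumr; apply: eq_bigr => j _ /=.
  rewrite (linfunZ (Xlin j)) -scalerDl -natrD /=.
  by congr (_%:R *: _); have := ltn_ord j; lia.
have -> : \sum_(j < i.+1) X j ((i - j)%:R *: pow k.+1 (i - j) u) = k.+1%:R *:
    \sum_(j < i.+1) \sum_(l < (i - j).+1) l%:R *: X l (X j (pow k (i - j - l) u)).
  rewrite scaler_sumr; apply: eq_bigr => j _.
  rewrite IH (linfunZ (Xlin j)) (linfun_sum (Xlin j)); congr (_ *: _).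
  by apply: eq_bigr => l _; rewrite (linfunZ (Xlin j)) Xcomm.
rewrite (triangle_exchange i (fun j l => l%:R *: X l (X j (pow k (i - j - l) u)))).
have -> : \sum_(j < i.+1) \sum_(l < (i - j).+1) j%:R *: X j (X l (pow k (i - l - j) u)) =
   \sum_(j < i.+1) j%:R *: X j (pow k.+1 (i - j) u).
  apply: eq_bigr => j _; rewrite -scaler_sumr -(linfun_sum (Xlin j)).
  by congr (_ *: X j _); apply: eq_bigr => l _; rewrite subnAC.
by rewrite -[k.+2%:R]natr1 addrC scalerDl scale1r.
Qed.

Local Notation E := (opser_exp X).

Lemma exp_wide n i u : (i < n)%N -> E i u = \sum_(k < n) (k`!%:R)^-1 *: pow k i u.
Proof.
move=> ni; rewrite /opser_exp -!(big_mkord xpredT (fun k => (k`!%:R)^-1 *: pow k i u)).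
rewrite [RHS](big_cat_nat _ ni) //= [X in _ = _ + X]big_nat_cond [X in _ = _ + X]big1 ?addr0 //.
by move=> k /andP[/andP[gk _] _]; rewrite pow_small ?scaler0.
Qed.

Lemma expP i a u w : E i (a *: u + w) = a *: E i u + E i w.
Proof.
rewrite /opser_exp scaler_sumr -big_split; apply: eq_bigr => k _ /=.
by rewrite powP scalerDr !scalerA mulrC.
Qed.

Lemma exp0 u : E 0 u = u.
Proof. by rewrite /opser_exp big_ord1 fact0 invr1 scale1r. Qed.

(** Coefficientwise, t d/dt exp X = (t dX/dt) exp X. *)
Lemma exp_derivative i u : i%:R *: E i u = \sum_(j < i.+1) j%:R *: X j (E (i - j) u).
Proof.
rewrite /opser_exp big_ord_recl scalerDr /=.
have -> : i%:R *: ((0`!%:R)^-1 *: (if i == 0%N then u else 0)) = 0.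
  by case: eqP => [->|]; rewrite ?scale0r ?scaler0.
rewrite add0r scaler_sumr.
have -> : \sum_(k < i) i%:R *: ((k.+1`!%:R)^-1 *: pow k.+1 i u) =
    \sum_(k < i) \sum_(j < i.+1) j%:R *: X j ((k`!%:R)^-1 *: pow k (i - j) u).
  apply: eq_bigr => k _; rewrite scalerA mulrC -scalerA pow_derivative scalerA.
  have -> : (k.+1`!%:R)^-1 * k.+1%:R = (k`!%:R)^-1 :> C.
    by rewrite factS natrM invfM mulrAC mulVf ?mul1r // pnatr_eq0.
  rewrite scaler_sumr; apply: eq_bigr => j _.
  by rewrite (linfunZ (Xlin j)) !scalerA mulrC.
rewrite exchange_big /=; apply: eq_bigr => -[[|j] ji] _ /=.
  by rewrite scale0r big1 // => k _; rewrite scale0r.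
rewrite -scaler_sumr -(linfun_sum (Xlin j.+1)).
by congr (_ *: X j.+1 _); rewrite -exp_wide //; lia.
Qed.

(** An operator whose commutators with the X_j are scalars acts on the exponential
   by a shift. *)
Lemma exp_commutator (Y : U -> U) n (a : C) : (0 < n)%N ->
  (forall a u w, Y (a *: u + w) = a *: Y u + Y w) ->
  (forall j u, Y (X j u) = X j (Y u) + (if j == n then a else 0) *: u) ->
  forall i u, Y (E i u) = E i (Y u) + a *: (if (n <= i)%N then E (i - n) u else 0).
Proof.
move=> n0 Yl YX i u; elim/ltn_ind: i => i IH.
have [->|i0] := posnP i.
  by rewrite !exp0 leqNgt n0 scaler0 addr0.
have iN : i%:R != 0 :> C by rewrite pnatr_eq0 -lt0n.
pose sh l := if (n <= l)%N then E (l - n) u else 0.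
apply: (scalerI iN); rewrite -(linfunZ Yl) exp_derivative (linfun_sum Yl) scalerDr exp_derivative.
rewrite -/(sh i); transitivity (\sum_(j < i.+1) (j%:R *: X j (E (i - j) (Y u)) +
    (j%:R *: X j (a *: sh (i - j)%N) + (j%:R * (if j == n :> nat then a else 0)) *: E (i - j) u))).
  apply: eq_bigr => -[[|j] ji] _ /=.
    by rewrite (linfunZ Yl) mul0r !scale0r !addr0.
  rewrite (linfunZ Yl) YX IH; last by lia.
  by rewrite -/(sh _) (linfunD (Xlin j.+1)) !scalerDr scalerA addrA.
rewrite big_split /=; congr (_ + _); rewrite big_split /=.
have -> : \sum_(j < i.+1) j%:R *: X j (a *: sh (i - j)%N) =
    a *: \sum_(j < i.+1) j%:R *: X j (sh (i - j)%N).
  rewrite scaler_sumr; apply: eq_bigr => j _.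
  by rewrite (linfunZ (Xlin j)) !scalerA mulrC.
have [ni|ni] := leqP n i; last first.
  rewrite [sh i]/sh leqNgt ni /= !scaler0 big1 ?scaler0 ?add0r; last first.
    by move=> j _; rewrite /sh leqNgt (_ : i - j < n)%N ?(linfun0 (Xlin j)) ?scaler0 //; lia.
  rewrite big1 // => j _; rewrite ltn_eqF ?mulr0 ?scale0r //.
  by have := ltn_ord j; lia.
have -> : \sum_(j < i.+1) j%:R *: X j (sh (i - j)%N) = (i - n)%:R *: sh i.
  rewrite [sh i]/sh ni exp_derivative -(big_mkord xpredT (fun j => j%:R *: X j (sh (i - j)%N))).
  rewrite -(big_mkord xpredT (fun j => j%:R *: X j (E (i - n - j)%N u))).
  rewrite (@big_cat_nat _ _ _ (i - n).+1) //=; last by lia.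
  rewrite [X in _ + X]big_nat_cond [X in _ + X]big1 ?addr0.
    rewrite big_nat_cond [RHS]big_nat_cond; apply: eq_bigr => j /andP[/andP[_ ji] _].
    rewrite /sh (_ : n <= i - j)%N; last by lia.
    by rewrite subnAC.
  move=> j /andP[/andP[ji _] _]; rewrite /sh leqNgt (_ : i - j < n)%N; last by lia.
  by rewrite (linfun0 (Xlin j)) scaler0.
have ni1 : (n < i.+1)%N by [].
rewrite (bigD1 (Ordinal ni1)) //= eqxx big1 ?addr0; last first.
  by move=> j; rewrite -val_eqE /= => /negPf ->; rewrite mulr0 scale0r.
rewrite [sh i]/sh ni !scalerA -scalerDl; congr (_ *: _).
have -> : i%:R = (i - n)%:R + n%:R :> C by rewrite -natrD subnK.
by rewrite mulrDl mulrC.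
Qed.

End OperatorSeries.

(** * Fock spaces *)

Section FockSpace.
Variable C : numClosedFieldType.
Implicit Types (f g : cpoly C) (m : {cmonom nat}) (i j : nat).

Lemma divcmK m i : (0 < m i)%N -> mulcm (divcm m (ucm i)) (ucm i) = m.
Proof.
move=> mi; apply/eqP/cmP => j; rewrite mulcmE divcmE ucmE.
by case: eqP => [<-|] /=; rewrite ?subn0 ?addn0 ?subnK.
Qed.

Lemma mulcmK m i : divcm (mulcm m (ucm i)) (ucm i) = m.
Proof. by apply/eqP/cmP => j; rewrite divcmE mulcmE addnK. Qed.

Lemma mulcm_ucm m i j : mulcm m (ucm i) j = (m j + (i == j))%N.
Proof. by rewrite mulcmE ucmE. Qed.

Lemma coef_lowering i f m :
  (lowering i f)@_m = (i.+1 * (m i).+1)%:R * f@_(mulcm m (ucm i)).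
Proof.
rewrite /lowering raddf_sum /=.
under eq_bigr do rewrite mcoeffU.
have mi : mulcm m (ucm i) i = (m i).+1 by rewrite mulcm_ucm eqxx addn1.
have F0 m' : m' != mulcm m (ucm i) ->
    ((i.+1 * m' i)%:R * f@_m') *+ (divcm m' (ucm i) == m) = 0.
  move=> ne; case: eqP => [e|]; last by rewrite mulr0n.
  have [->|m0] := posnP (m' i); first by rewrite muln0 mul0r mul0rn.
  by rewrite -e divcmK ?eqxx in ne.
have [h|h] := boolP (mulcm m (ucm i) \in msupp f).
  rewrite (bigD1_seq _ h) ?fset_uniq //= mulcmK eqxx mulr1n mi big1 ?addr0 //.
rewrite (mcoeff_outdom h) mulr0 big_seq big1 // => m' hm'; apply: F0.
by apply: contraNneq h => <-.
Qed.

Lemma coef_raising i f m :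
  (<< ucm i >> * f)@_m = if (0 < m i)%N then f@_(divcm m (ucm i)) else 0.
Proof.
rewrite malgM_def fgmulUg raddf_sum /=.
under eq_bigr do rewrite mcoeffU mul1r.
have F0 m' : m' != divcm m (ucm i) -> f@_m' *+ (mulcm (ucm i) m' == m) = 0.
  move=> ne; case: eqP => [e|]; last by rewrite mulr0n.
  by move: ne; rewrite -e mulcmC mulcmK eqxx.
case: ifP => mi; last first.
  rewrite big1 // => m' _; case: eqP => [e|]; last by rewrite mulr0n.
  by move: mi; rewrite -e cmM cmUU.
have [h|h] := boolP (divcm m (ucm i) \in msupp f).
  rewrite (bigD1_seq _ h) ?fset_uniq //= -[mmul _ _]/(mulcm _ _) mulcmC divcmK // eqxx mulr1n big1 ?addr0 //.
rewrite (mcoeff_outdom h) big_seq big1 // => m' hm'; apply: F0.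
by apply: contraNneq h => <-.
Qed.

Lemma coefP a f g m : (a *: f + g)@_m = a * f@_m + g@_m.
Proof. by rewrite mcoeffD mcoeffZ. Qed.

(** Polynomials as functions on monomials: identities between composed operators
   are checked there. *)
Definition cof f : {cmonom nat} -> C := fun m => f@_m.
Definition cof_low i (F : {cmonom nat} -> C) m := (i.+1 * (m i).+1)%:R * F (mulcm m (ucm i)).
Definition cof_rais i (F : {cmonom nat} -> C) m :=
  if (0 < m i)%N then F (divcm m (ucm i)) else 0.
Definition cof_lin a (F G : {cmonom nat} -> C) m := a * F m + G m.

Lemma cof_inj f g : cof f = cof g -> f = g.
Proof. by move=> e; apply/malgP => m; exact: (congr1 (fun F => F m) e). Qed.

Lemma cofL i f : cof (lowering i f) = cof_low i (cof f).
Proof. apply/funext => m; exact: coef_lowering. Qed.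
Lemma cofR i f : cof (<< ucm i >> * f) = cof_rais i (cof f).
Proof. apply/funext => m; exact: coef_raising. Qed.
Lemma cofP a f g : cof (a *: f + g) = cof_lin a (cof f) (cof g).
Proof. apply/funext => m; exact: coefP. Qed.

Lemma loweringP i a f g : lowering i (a *: f + g) = a *: lowering i f + lowering i g.
Proof.
apply: cof_inj; apply: etrans (cofL _ _) _; apply: etrans (congr1 _ (cofP _ _ _)) _.
apply/esym; apply: etrans (cofP _ _ _) _.
apply: etrans (congr2 _ (cofL _ _) (cofL _ _)) _.
by apply/funext => m; rewrite /cof_lin /cof_low; ring.
Qed.

Lemma lowering_comm i j f : lowering i (lowering j f) = lowering j (lowering i f).
Proof.
apply: cof_inj; apply: etrans (cofL _ _) _; apply: etrans (congr1 _ (cofL _ _)) _.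
apply/esym; apply: etrans (cofL _ _) _; apply: etrans (congr1 _ (cofL _ _)) _.
move: (cof f) => F; apply/funext => m; rewrite /cof_low !mulcm_ucm.
have -> : mulcm (mulcm m (ucm i)) (ucm j) = mulcm (mulcm m (ucm j)) (ucm i).
  by apply/eqP/cmP => l; rewrite !mulcm_ucm addnAC.
by rewrite [j == i]eq_sym; case: eqP => [->|_]; rewrite ?addn1 ?addn0 !natrM; ring.
Qed.

Lemma lowering_raising i j f : lowering i (<< ucm j >> * f) =
  (if i == j then i.+1%:R else 0) *: f + << ucm j >> * lowering i f.
Proof.
apply: cof_inj; apply: etrans (cofL _ _) _; apply: etrans (congr1 _ (cofR _ _)) _.
apply/esym; apply: etrans (cofP _ _ _) _.
apply: etrans (congr1 _ (etrans (cofR _ _) (congr1 _ (cofL _ _)))) _.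
move: (cof f) => F; apply/funext => m; rewrite /cof_low /cof_rais /cof_lin mulcm_ucm.
have [->|ij] := eqVneq i j.
  rewrite addn1 mulcmK; case: posnP => [m0|m0]; first by rewrite m0 muln1 addr0.
  rewrite divcmK // divcmE ucmE eqxx subn1 prednK //.
  by move: (m j) (F m) => k x; rewrite /= !natrM; ring.
rewrite addn0 mul0r add0r; case: ifP => // mj; rewrite ?mulr0 //.
rewrite divcmE ucmE eq_sym (negPf ij) subn0; congr (_ * F _).
apply/eqP/cmP => l; rewrite !(mulcmE, divcmE, ucmE).
have [jl|_] := eqVneq j l; last by rewrite !subn0.
by move: mj ij; rewrite -jl => mj /negPf ->; rewrite addn0 addn0.
Qed.

Lemma raising_comm i j f : << ucm i >> * (<< ucm j >> * f) = << ucm j >> * (<< ucm i >> * f).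
Proof. exact: mulrCA. Qed.

Lemma raisingP i a f g : << ucm i >> * (a *: f + g) = a *: (<< ucm i >> * f) + << ucm i >> * g.
Proof. by rewrite mulrDr scalerAr. Qed.


End FockSpace.

(** * Vertex operators on Heisenberg modules *)

Section Heisenberg.
Variables (C : numClosedFieldType) (U : lmodType C) (h : int -> U -> U).
Implicit Types (u w : U).
Hypothesis hP : forall n a u w, h n (a *: u + w) = a *: h n u + h n w.
Hypothesis h_zero : forall u, h 0 u = 0.
Hypothesis h_comm : forall m n u,
  h m (h n u) = h n (h m u) + (if m + n == 0 then m%:~R else 0) *: u.
(** W B: the vectors of weight less than B. *)
Variable W : nat -> U -> Prop.
Hypothesis W0 : forall u, W 0 u -> u = 0.
Hypothesis W_mono : forall B B' u, (B <= B')%N -> W B u -> W B' u.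
Hypothesis W_lin : forall B a u w, W B u -> W B w -> W B (a *: u + w).
Hypothesis W_h : forall B i u, W B u -> W (B - i.+1) (h i.+1%:Z u).
Variable dg : U -> nat.
Hypothesis dgP : forall u, W (dg u) u.

Hypothesis W_0 : W 0 0.

Lemma W_zero B : W B 0. Proof. exact: W_mono (leq0n B) W_0. Qed.

Lemma W_Z B a u : W B u -> W B (a *: u).
Proof. by move=> hu; rewrite -[_ *: _]addr0; apply: W_lin => //; exact: W_zero. Qed.

Lemma W_sum B (I : Type) (r : seq I) (P : pred I) (F : I -> U) :
  (forall i, P i -> W B (F i)) -> W B (\sum_(i <- r | P i) F i).
Proof.
move=> hF; elim/big_ind: _ => //; first exact: W_zero.
by move=> u w hu hw; rewrite -[u]scale1r; exact: W_lin.
Qed.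

Lemma h_small B i u : W B u -> (B <= i.+1)%N -> h i.+1%:Z u = 0.
Proof.
move=> hu Bi; apply: W0; have := W_h i hu.
by rewrite (_ : B - i.+1 = 0)%N //; lia.
Qed.

Variable alpha : C.

Definition Xcre (i : nat) u : U := if i == 0%N then 0 else (alpha / i%:R) *: h (- i%:Z) u.
Definition Xann (i : nat) u : U := if i == 0%N then 0 else - (alpha / i%:R) *: h i%:Z u.

Lemma XcreP i a u w : Xcre i (a *: u + w) = a *: Xcre i u + Xcre i w.
Proof.
rewrite /Xcre; case: eqP => _; first by rewrite scaler0 addr0.
by rewrite hP scalerDr !scalerA mulrC.
Qed.

Lemma XannP i a u w : Xann i (a *: u + w) = a *: Xann i u + Xann i w.
Proof.
rewrite /Xann; case: eqP => _; first by rewrite scaler0 addr0.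
by rewrite hP scalerDr !scalerA mulrC.
Qed.

Lemma Xcre_comm i j u : Xcre i (Xcre j u) = Xcre j (Xcre i u).
Proof.
rewrite /Xcre; case: eqP => [_|/eqP i0]; case: eqP => [_|/eqP j0] //.
- by rewrite (linfun0 (hP _)) scaler0.
- by rewrite (linfun0 (hP _)) scaler0.
rewrite !(linfunZ (hP _)) !scalerA mulrC; congr (_ *: _); rewrite h_comm.
by rewrite (negPf (_ : - i%:Z - j%:Z != 0)) ?scale0r ?addr0 //; lia.
Qed.

Lemma Xann_comm i j u : Xann i (Xann j u) = Xann j (Xann i u).
Proof.
rewrite /Xann; case: eqP => [_|/eqP i0]; case: eqP => [_|/eqP j0] //.
- by rewrite (linfun0 (hP _)) scaler0.
- by rewrite (linfun0 (hP _)) scaler0.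
rewrite !(linfunZ (hP _)) !scalerA mulrC; congr (_ *: _); rewrite h_comm.
by rewrite (negPf (_ : i%:Z + j%:Z != 0)) ?scale0r ?addr0 //; lia.
Qed.

Local Notation cre := (opser_exp Xcre).
Local Notation ann := (opser_exp Xann).

Lemma creP i a u w : cre i (a *: u + w) = a *: cre i u + cre i w.
Proof. exact: expP XcreP _ _ _ _. Qed.
Lemma annP i a u w : ann i (a *: u + w) = a *: ann i u + ann i w.
Proof. exact: expP XannP _ _ _ _. Qed.

Lemma h_cre n i u : (0 < n)%N ->
  h n%:Z (cre i u) = cre i (h n%:Z u) + alpha *: (if (n <= i)%N then cre (i - n) u else 0).
Proof.
move=> n0; apply: (exp_commutator XcreP _ Xcre_comm n0 (hP _)) => [w|j w]; first by [].
rewrite /Xcre; case: eqP => [->|/eqP j0].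
  by rewrite eq_sym (gtn_eqF n0) scale0r (linfun0 (hP _)) addr0.
rewrite (linfunZ (hP _)) h_comm scalerDr scalerA; congr (_ + _ *: _).
have -> : (n%:Z - j%:Z == 0) = (j == n) by lia.
by case: eqP => [->|_]; rewrite ?mulr0 // divfK // pnatr_eq0 -lt0n.
Qed.

Lemma h_cre_neg n i u : (0 < n)%N -> h (- n%:Z) (cre i u) = cre i (h (- n%:Z) u).
Proof.
move=> n0; have := exp_commutator (Y := h (- n%:Z)) (a := 0) XcreP _ Xcre_comm n0 (hP _).
move=> -> //; first by rewrite scale0r addr0.
move=> j w; rewrite if_same scale0r addr0 /Xcre; case: eqP => [_|/eqP j0].
  exact: linfun0.
rewrite (linfunZ (hP _)) h_comm (negPf (_ : - n%:Z - j%:Z != 0)) ?scale0r ?addr0 //; lia.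
Qed.

Lemma h_ann_neg n i u : (0 < n)%N ->
  h (- n%:Z) (ann i u) = ann i (h (- n%:Z) u) + alpha *: (if (n <= i)%N then ann (i - n) u else 0).
Proof.
move=> n0; apply: (exp_commutator XannP _ Xann_comm n0 (hP _)) => [w|j w]; first by [].
rewrite /Xann; case: eqP => [->|/eqP j0].
  by rewrite eq_sym (gtn_eqF n0) scale0r (linfun0 (hP _)) addr0.
rewrite (linfunZ (hP _)) h_comm scalerDr scalerA; congr (_ + _ *: _).
have -> : (- n%:Z + j%:Z == 0) = (j == n) by lia.
case: eqP => [->|_]; rewrite ?mulr0 // rmorphN /= mulrNN divfK // pnatr_eq0 -lt0n //.
Qed.

Lemma h_ann n i u : (0 < n)%N -> h n%:Z (ann i u) = ann i (h n%:Z u).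
Proof.
move=> n0; have := exp_commutator (Y := h n%:Z) (a := 0) XannP _ Xann_comm n0 (hP _).
move=> -> //; first by rewrite scale0r addr0.
move=> j w; rewrite if_same scale0r addr0 /Xann; case: eqP => [_|/eqP j0].
  exact: linfun0.
rewrite (linfunZ (hP _)) h_comm (negPf (_ : n%:Z + j%:Z != 0)) ?scale0r ?addr0 //; lia.
Qed.

Lemma cre_derivative i u : i%:R *: cre i u =
  alpha *: \sum_(l < i) h (- l.+1%:Z) (cre (i - l.+1) u).
Proof.
rewrite (exp_derivative XcreP) // ; last exact: Xcre_comm.
rewrite big_ord_recl scale0r add0r scaler_sumr; apply: eq_bigr => l _.
by rewrite /bump /= /Xcre /= scalerA mulrC divfK // pnatr_eq0.
Qed.

Lemma ann_derivative i u : i%:R *: ann i u =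
  - alpha *: \sum_(l < i) ann (i - l.+1) (h l.+1%:Z u).
Proof.
rewrite (exp_derivative XannP) // ; last exact: Xann_comm.
rewrite big_ord_recl scale0r add0r scaler_sumr; apply: eq_bigr => l _.
rewrite /bump /= /Xann /= scalerA mulrC mulNr divfK ?pnatr_eq0 //.
by rewrite h_ann.
Qed.

Lemma W_ann B i u : W B u -> W (B - i) (ann i u).
Proof.
elim/ltn_ind: i B u => i IH B u hu; have [->|i0] := posnP i; first by rewrite subn0 exp0.
have iN : i%:R != 0 :> C by rewrite pnatr_eq0 -lt0n.
have -> : ann i u = i%:R^-1 *: (i%:R *: ann i u) by rewrite scalerA mulVf // scale1r.
rewrite ann_derivative; do 2 apply: W_Z; apply: W_sum => l _.
have li := ltn_ord l; rewrite (_ : B - i = B - l.+1 - (i - l.+1))%N; last by lia.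
by apply: IH; [lia|exact: W_h].
Qed.

(** The creation coefficients extended by zero to negative indices. *)
Definition crez (t : int) u : U := if t is Posz i then cre i u else 0.

Lemma crezP t a u w : crez t (a *: u + w) = a *: crez t u + crez t w.
Proof. by case: t => i /=; [exact: creP|rewrite scaler0 addr0]. Qed.

Lemma crez_neg t u : t < 0 -> crez t u = 0. Proof. by case: t. Qed.

Lemma h_crez n t u : (0 < n)%N ->
  h n%:Z (crez t u) = crez t (h n%:Z u) + alpha *: crez (t - n%:Z) u.
Proof.
move=> n0; case: t => i /=; last first.
  by rewrite (linfun0 (hP _)) crez_neg ?scaler0 ?addr0 //; lia.
rewrite h_cre //; congr (_ + _ *: _); case: leqP => ni; last by rewrite crez_neg //; lia.
by rewrite (_ : i%:Z - n%:Z = (i - n)%N%:Z) //; lia.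
Qed.

Lemma h_crez_neg n t u : (0 < n)%N -> h (- n%:Z) (crez t u) = crez t (h (- n%:Z) u).
Proof. by move=> n0; case: t => i /=; [exact: h_cre_neg|exact: linfun0]. Qed.

Lemma crez_derivative t L u : t <= L%:Z -> t%:~R *: crez t u =
  alpha *: \sum_(l < L) h (- l.+1%:Z) (crez (t - l.+1%:Z) u).
Proof.
case: t => i tL; last first.
  rewrite scaler0 big1 ?scaler0 // => l _; rewrite crez_neg ?(linfun0 (hP _)) //; lia.
rewrite -[_%:~R]/(i%:R) [in LHS]/crez cre_derivative; congr (_ *: _).
have iL : (i <= L)%N by lia.
rewrite (big_ord_widen_cond L xpredT (fun l => h (- l.+1%:Z) (cre (i - l.+1) u)) iL) /=.
rewrite big_mkcond /=; apply: eq_bigr => l _; case: ifP => li.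
  by rewrite (_ : i%:Z - l.+1%:Z = (i - l.+1)%N%:Z) //; lia.
by rewrite crez_neg ?(linfun0 (hP _)) //; lia.
Qed.

(** The coefficient of z^(s + alpha gamma) of the vertex operator. *)
Definition vert (s : int) u : U := \sum_(j < dg u) crez (s + j%:Z) (ann j u).

Lemma vert_wide B s u : W B u -> vert s u = \sum_(j < B) crez (s + j%:Z) (ann j u).
Proof.
have wide B1 B2 : (B1 <= B2)%N -> W B1 u ->
    \sum_(j < B1) crez (s + j%:Z) (ann j u) = \sum_(j < B2) crez (s + j%:Z) (ann j u).
  move=> B12 h1.
  rewrite -!(big_mkord xpredT (fun j => crez (s + j%:Z) (ann j u))) [RHS](big_cat_nat _ B12) //=.
  rewrite [X in _ = _ + X]big_nat_cond [X in _ = _ + X]big1 ?addr0 // => j /andP[/andP[Bj _] _].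
  have /W0 -> : W 0 (ann j u) by have := W_ann j h1; rewrite (_ : B1 - j = 0)%N //; lia.
  exact: linfun0 (crezP _).
move=> hB; have [Bd|/ltnW dB] := leqP (dg u) B; first exact: wide.
by apply/esym/wide.
Qed.

Lemma vertP s a u w : vert s (a *: u + w) = a *: vert s u + vert s w.
Proof.
pose B := maxn (dg u) (dg w).
have hu : W B u by apply: W_mono (dgP u); exact: leq_maxl.
have hw : W B w by apply: W_mono (dgP w); exact: leq_maxr.
rewrite (vert_wide s hu) (vert_wide s hw) (vert_wide s (W_lin a hu hw)).
rewrite scaler_sumr -big_split; apply: eq_bigr => j _ /=.
by rewrite annP crezP.
Qed.

Lemma vert_small s u : s + (dg u)%:Z <= 0 -> vert s u = 0.
Proof.
move=> sd; rewrite /vert big1 // => j _; apply: crez_neg.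
by have := ltn_ord j; lia.
Qed.

(** A positive mode sees only the creation part, a negative mode only the
   annihilation part; both produce the same shift. *)
Lemma h_vert n s u : n != 0 -> h n (vert s u) = vert s (h n u) + alpha *: vert (s - n) u.
Proof.
case: n => [[|n]|n] // _.
  pose B := dg u; have hB : W B (h n.+1%:Z u) by apply: W_mono (W_h n (dgP u)); exact: leq_subr.
  rewrite (vert_wide s hB) /vert (linfun_sum (hP _)) scaler_sumr -big_split.
  apply: eq_bigr => j _ /=; rewrite h_crez // h_ann //; congr (_ + _ *: crez _ _); lia.
rewrite NegzE opprK; pose B := (maxn (dg u) (dg (h (- n.+1%:Z) u)) + n.+1)%N.
have hB : W B u by apply: W_mono (dgP u); rewrite /B; lia.
have hB' : W B (h (- n.+1%:Z) u) by apply: W_mono (dgP _); rewrite /B; lia.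
have hB2 : W (B - n.+1) u by apply: W_mono (dgP u); rewrite /B; lia.
rewrite (vert_wide s hB) (vert_wide s hB') (vert_wide _ hB2) (linfun_sum (hP _)).
under eq_bigr => j _ do rewrite h_crez_neg // h_ann_neg // (linfunD (crezP _)) (linfunZ (crezP _)).
rewrite big_split /= -scaler_sumr; congr (_ + _ *: _).
have nB : (n.+1 <= B)%N by rewrite /B; lia.
pose F j := crez (s + j%:Z) (if (n.+1 <= j)%N then ann (j - n.+1) u else 0).
rewrite -(big_mkord xpredT F) (big_cat_nat _ nB) //= big_nat_cond big1 ?add0r.
  rewrite -{1}[n.+1]add0n big_addn big_mkord; apply: eq_bigr => j _.
  by rewrite /F leq_addl addnK; congr (crez _ _); lia.
by move=> j /andP[/andP[_ jn] _]; rewrite /F leqNgt jn /= (linfun0 (crezP _)).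
Qed.

Lemma shifted_exchange B (F : nat -> nat -> U) :
  \sum_(j < B) \sum_(l < j) F (j - l.+1)%N l = \sum_(l < B) \sum_(j < B - l.+1) F j l.
Proof.
have -> : \sum_(j < B) \sum_(l < j) F (j - l.+1)%N l =
    \sum_(j < B) \sum_(l < B | (l < j)%N) F (j - l.+1)%N l.
  apply: eq_bigr => j _.
  by rewrite (big_ord_widen_cond B xpredT (fun l => F (j - l.+1)%N l) (ltnW (ltn_ord j))).
rewrite (exchange_big_dep xpredT) //=; apply: eq_bigr => l _.
have lB := ltn_ord l.
pose G j := F (j - l.+1)%N l.
rewrite -(big_mkord (fun j => (l < j)%N) G) (big_cat_nat _ lB) //= big_nat_cond big1 ?add0r; last first.
  by move=> j /andP[/andP[_ jl] lj]; lia.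
rewrite -{1}[l.+1]add0n big_addn big_mkord; apply: eq_big => j; first by lia.
by rewrite /G addnK.
Qed.

(** Coefficientwise, z d/dz phi = alpha (h_-(z) phi + phi h_+(z)). The sum over modes
   is finite on each vector, with any sufficiently large cut-off. *)
Lemma vert_derivative s u : exists L0, forall L, (L0 <= L)%N -> s%:~R *: vert s u =
  alpha *: (\sum_(l < L) h (- l.+1%:Z) (vert (s - l.+1%:Z) u)
            + \sum_(l < L) vert (s + l.+1%:Z) (h l.+1%:Z u)).
Proof.
pose B := dg u; exists (B + `|s|)%N => L L0.
have hB := dgP u.
have -> : s%:~R *: vert s u = \sum_(j < B) (s + j%:Z)%:~R *: crez (s + j%:Z) (ann j u)
   + \sum_(j < B) crez (s + j%:Z) (- j%:R *: ann j u).
  rewrite /vert -big_split scaler_sumr; apply: eq_bigr => j _ /=.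
  by rewrite (linfunZ (crezP _)) -scalerDl rmorphD /= addrK.
rewrite scalerDr; congr (_ + _).
  transitivity (\sum_(j < B) alpha *: \sum_(l < L)
      h (- l.+1%:Z) (crez (s + j%:Z - l.+1%:Z) (ann j u))).
    by apply: eq_bigr => j _; apply: crez_derivative; have := ltn_ord j; lia.
  rewrite -scaler_sumr exchange_big /=; congr (_ *: _); apply: eq_bigr => l _.
  rewrite /vert (linfun_sum (hP _)); apply: eq_bigr => j _; congr (h _ (crez _ _)); exact: addrAC.
have BL : (B <= L)%N by lia.
rewrite -(big_mkord xpredT (fun l => vert (s + l.+1%:Z) (h l.+1%:Z u))) (big_cat_nat _ BL) //=.
rewrite [X in _ + X]big_nat_cond [X in _ + X]big1 ?addr0; last first.
  move=> l /andP[/andP[Bl _] _]; rewrite (h_small hB) ?(linfun0 (vertP _)) //; lia.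
rewrite big_mkord.
under eq_bigr => j _ do rewrite scaleNr ann_derivative scaleNr opprK (linfunZ (crezP _)) (linfun_sum (crezP _)).
rewrite -scaler_sumr; congr (_ *: _).
transitivity (\sum_(j < B) \sum_(l < j) crez (s + l.+1%:Z + (j - l.+1)%N%:Z) (ann (j - l.+1) (h l.+1%:Z u))).
  apply: eq_bigr => j _; apply: eq_bigr => l _; congr (crez _ _).
  by have := ltn_ord l; lia.
rewrite (shifted_exchange B (fun j l => crez (s + l.+1%:Z + j%:Z) (ann j (h l.+1%:Z u)))).
by apply: eq_bigr => l _; rewrite (vert_wide _ (W_h l hB)).
Qed.

(** The modes on the Fock space of charge gamma. *)
Definition hg (gamma : C) (n : int) u : U := h n u + (if n == 0 then gamma else 0) *: u.

Lemma hgP gamma n a u w : hg gamma n (a *: u + w) = a *: hg gamma n u + hg gamma n w.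
Proof.
by rewrite /hg hP !scalerDr !scalerA [_ * a]mulrC addrACA.
Qed.

Lemma hg_vert gamma n s u :
  hg (gamma + alpha) n (vert s u) = vert s (hg gamma n u) + alpha *: vert (s - n) u.
Proof.
rewrite /hg; have [->|n0] := eqVneq n 0.
  by rewrite !h_zero !add0r subr0 (linfunZ (vertP _)) -scalerDl.
by rewrite !scale0r !addr0 h_vert.
Qed.

Lemma hg_neg_vert n s u : (0 < n)%N ->
  h (- n%:Z) (vert s u) = vert s (h (- n%:Z) u) + alpha *: vert (s + n%:Z) u.
Proof. by move=> n0; rewrite h_vert ?opprK //; lia. Qed.

(** The Sugawara operator of mode m - 1, cut off to a finite sum. *)
Definition sugawara_cut gamma m B u : U :=
  \sum_(l < B) h (- l.+1%:Z) (hg gamma (l + m)%N%:Z u)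
  + 2%:R^-1 *: \sum_(j < m) hg gamma j%:Z (hg gamma (m - j.+1)%N%:Z u).

Definition sugawara gamma m u := sugawara_cut gamma m (dg u) u.

Lemma hg_small gamma B k u : W B u -> (B <= k)%N -> (0 < k)%N -> hg gamma k%:Z u = 0.
Proof.
case: k => // k hB Bk _; rewrite /hg (h_small hB Bk) add0r.
by rewrite (negPf (_ : k.+1%:Z != 0)) ?scale0r.
Qed.

Lemma sugawara_wide gamma m B u : W B u -> sugawara gamma m u = sugawara_cut gamma m B u.
Proof.
have wide B1 B2 : (B1 <= B2)%N -> W B1 u -> sugawara_cut gamma m B1 u = sugawara_cut gamma m B2 u.
  move=> B12 h1; rewrite /sugawara_cut; congr (_ + _).
  pose F l := h (- l.+1%:Z) (hg gamma (l + m)%N%:Z u).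
  rewrite -!(big_mkord xpredT F) [RHS](big_cat_nat _ B12) //=.
  rewrite [X in _ = _ + X]big_nat_cond [X in _ = _ + X]big1 ?addr0 // => l /andP[/andP[Bl _] _].
  have [lm|lm] := posnP (l + m)%N.
    have u0 : u = 0 by apply: W0; apply: W_mono h1; lia.
    by rewrite /F u0 (linfun0 (hgP _ _)) (linfun0 (hP _)).
  by rewrite /F (hg_small _ h1) ?(linfun0 (hP _)) //; lia.
rewrite /sugawara => hB; have [Bd|/ltnW dB] := leqP (dg u) B; first exact: wide.
by apply/esym/wide.
Qed.

Lemma sugawara_cutP gamma m B a u w : sugawara_cut gamma m B (a *: u + w) =
  a *: sugawara_cut gamma m B u + sugawara_cut gamma m B w.
Proof.
rewrite /sugawara_cut scalerDr scalerA mulrC -scalerA addrACA -scalerDr.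
congr (_ + _ *: _); rewrite scaler_sumr -big_split; apply: eq_bigr => l _ /=.
  by rewrite hgP hP.
by rewrite !hgP.
Qed.

Lemma sugawaraP gamma m a u w :
  sugawara gamma m (a *: u + w) = a *: sugawara gamma m u + sugawara gamma m w.
Proof.
pose B := maxn (dg u) (dg w).
have hu : W B u by apply: W_mono (dgP u); exact: leq_maxl.
have hw : W B w by apply: W_mono (dgP w); exact: leq_maxr.
rewrite (sugawara_wide _ _ hu) (sugawara_wide _ _ hw) (sugawara_wide _ _ (W_lin a hu hw)).
exact: sugawara_cutP.
Qed.

(** The vertex operator is primary for the Sugawara Virasoro algebra; the two sums
   over modes differ by a finite part, which the normally ordered finite sum
   compensates. *)
Lemma sugawara_vert gamma m s u : let s' := s - m%:Z + 1 in
  sugawara (gamma + alpha) m (vert s u) = vert s (sugawara gamma m u)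
    + (s'%:~R + alpha * gamma + m%:R * alpha ^+ 2 / 2%:R) *: vert s' u.
Proof.
move=> s'; have [L0 hL0] := vert_derivative s' u.
have [B [hB hB' B0 L0B]] : exists B, [/\ W B u, W B (vert s u), (0 < B)%N & (L0 <= B)%N].
  exists (maxn (dg u) (dg (vert s u)) + L0).+1; split; try lia.
    by apply: W_mono (dgP u); lia.
  by apply: W_mono (dgP _); lia.
have {hL0} hL : s'%:~R *: vert s' u = _ := hL0 B L0B.
rewrite (sugawara_wide _ _ hB) (sugawara_wide _ _ hB') /sugawara_cut.
pose g (k : nat) := vert (s' + k%:Z) (hg gamma k%:Z u).
have g0 : g 0%N = gamma *: vert s' u.
  by rewrite /g addr0 /hg h_zero add0r eqxx (linfunZ (vertP _)).
have gbig k : (B <= k)%N -> g k = 0.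
  by move=> Bk; rewrite /g (hg_small _ hB Bk) ?(linfun0 (vertP _)) //; lia.
pose T := \sum_(l < B) h (- l.+1%:Z) (vert (s' - l.+1%:Z) u).
have e1 : \sum_(l < B) h (- l.+1%:Z) (hg (gamma + alpha) (l + m)%N%:Z (vert s u)) =
    vert s (\sum_(l < B) h (- l.+1%:Z) (hg gamma (l + m)%N%:Z u))
    + (alpha *: \sum_(l < B) g (l + m)%N + alpha *: T).
  rewrite (linfun_sum (vertP _)) !scaler_sumr -!big_split; apply: eq_bigr => l _ /=.
  rewrite hg_vert (linfunD (hP _)) (linfunZ (hP _)) hg_neg_vert // -addrA.
  congr (_ + (_ *: vert _ _ + _ *: h _ (vert _ _))); rewrite /s'; lia.
have e2 : \sum_(j < m) hg (gamma + alpha) j%:Z (hg (gamma + alpha) (m - j.+1)%N%:Z (vert s u)) =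
    vert s (\sum_(j < m) hg gamma j%:Z (hg gamma (m - j.+1)%N%:Z u))
    + (2%:R * alpha) *: \sum_(j < m) g j + (m%:R * alpha ^+ 2) *: vert s' u.
  have -> : (m%:R * alpha ^+ 2) *: vert s' u = \sum_(j < m) (alpha ^+ 2) *: vert s' u.
    by rewrite sumr_const card_ord -scaler_nat scalerA.
  have -> : (2%:R * alpha) *: \sum_(j < m) g j =
      \sum_(j < m) alpha *: g (m - j.+1)%N + \sum_(j < m) alpha *: g j.
    rewrite -!scaler_sumr -scalerDr [in RHS](reindex_inj rev_ord_inj) /=.
    rewrite mulrC -scalerA; congr (_ *: _); rewrite scaler_nat mulr2n; congr (_ + _).
    by apply: eq_bigr => j _; congr (g _); have := ltn_ord j; lia.
  rewrite (linfun_sum (vertP _)) -!big_split; apply: eq_bigr => j _ /=.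
  have jm := ltn_ord j.
  rewrite hg_vert (linfunD (hgP _ _)) (linfunZ (hgP _ _)) !hg_vert scalerDr scalerA -!addrA.
  congr (_ + (_ *: vert _ _ + (_ *: vert _ _ + _ *: vert _ _))); rewrite /s' ?expr2 //; lia.
have e3 : \sum_(l < B) g (l + m)%N = g 0%N + \sum_(l < B) g l.+1 - \sum_(j < m) g j.
  have z n : (B <= n)%N -> \sum_(l < n) g l = \sum_(l < B) g l.
    move=> Bn; rewrite -!(big_mkord xpredT g) (big_cat_nat _ Bn) //=.
    rewrite [X in _ + X]big_nat_cond [X in _ + X]big1 ?addr0 // => l /andP[/andP[Bl _] _].
    exact: gbig.
  have -> : g 0%N + \sum_(l < B) g l.+1 = \sum_(l < B) g l.
    by rewrite -[RHS](z B.+1 (leqnSn B)) -[RHS](big_mkord xpredT g) big_nat_recl // big_mkord.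
  rewrite -(z (m + B)%N (leq_addl _ _)) big_split_ord /= addrAC subrr add0r.
  by apply: eq_bigr => l _; rewrite addnC.
have hL' : alpha *: T + alpha *: \sum_(l < B) g l.+1 = s'%:~R *: vert s' u.
  rewrite hL -scalerDr; congr (_ *: (_ + _)); apply: eq_bigr => l _.
  by rewrite /g /hg (negPf (_ : l.+1%:Z != 0)) ?scale0r ?addr0.
have key : alpha *: \sum_(l < B) g (l + m)%N + alpha *: T =
    s'%:~R *: vert s' u + (alpha * gamma) *: vert s' u - alpha *: \sum_(j < m) g j.
  rewrite -hL' e3 !scalerBr !scalerDr g0 scalerA addrAC; congr (_ - _).
  by rewrite addrC -addrA; congr (_ + _); rewrite addrC.
have half : 2%:R^-1 * (2%:R * alpha) = alpha by rewrite mulrA mulVf ?mul1r // pnatr_eq0.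
have arrange (a b c d x y : U) : x + (a + b - y) + (c + y + d) = x + c + (a + b + d).
  rewrite -!(addrA x); congr (x + _).
  by rewrite (addrC c y) -(addrA y) (addrA (a + b - y)) addrNK addrCA.
rewrite e1 e2 key (linfunD (vertP _)) (linfunZ (vertP _)) !scalerDr scalerA half arrange.
by rewrite !scalerDl scalerA [_ / 2%:R]mulrC.
Qed.

End Heisenberg.

(** * The Fock space as a Heisenberg module *)

Section FockModule.
Variable C : numClosedFieldType.
Implicit Types (f g : cpoly C) (m : {cmonom nat}) (i j : nat).

Local Notation h := (@heis C 0).

Lemma fock_hP n a f g : h n (a *: f + g) = a *: h n f + h n g.
Proof.
case: n => [[|i]|i]; [|exact: loweringP|exact: raisingP].
by rewrite /= !scale0r scaler0 addr0.
Qed.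

Lemma fock_h0 f : h 0 f = 0. Proof. exact: scale0r. Qed.

Lemma fock_h_comm (m n : int) f :
  h m (h n f) = h n (h m f) + (if m + n == 0 then m%:~R else 0) *: f.
Proof.
have z k : h k 0 = 0 by exact: linfun0 (fock_hP k).
case: m n => [[|i]|i] [[|j]|j]; rewrite ?fock_h0 ?z ?add0r.
- by do ?[case: ifP => // _]; rewrite ?scale0r ?addr0.
- by do ?[case: ifP => // _]; rewrite ?scale0r ?addr0.
- by do ?[case: ifP => // _]; rewrite ?scale0r ?addr0.
- by do ?[case: ifP => // _]; rewrite ?scale0r ?addr0.
- by do ?[case: ifP => // _]; rewrite ?scale0r ?addr0; exact: lowering_comm.
- rewrite addrC; have -> : (i.+1%:Z + Negz j == 0) = (i == j) by rewrite NegzE; lia.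
  exact: lowering_raising.
- by do ?[case: ifP => // _]; rewrite ?scale0r ?addr0.
- have -> : (Negz i + j.+1%:Z == 0) = (j == i) by rewrite NegzE; lia.
  pose d : C := if j == i then j.+1%:R else 0.
  have swap (x y : cpoly C) (q : C) : x = q *: f + y -> y = x + (- q) *: f.
    by move=> ->; rewrite addrAC -scalerDl subrr scale0r add0r.
  have dE : - d = if j == i then (Negz i)%:~R else 0.
    by rewrite /d; case: eqP => [->|_]; rewrite ?oppr0 // NegzE rmorphN.
  have e : h j.+1%:Z (h (Negz i) f) = d *: f + h (Negz i) (h j.+1%:Z f) := lowering_raising j i f.
  apply: etrans (swap _ _ _ e) _.
  exact: (congr1 (fun q => h j.+1%:Z (h (Negz i) f) + q *: f) dE).
by do ?[case: ifP => // _]; rewrite ?scale0r ?addr0; exact: raising_comm.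
Qed.

(** The filtration by weight, which makes all the sums over modes finite. *)
Record wtlt (B : nat) f : Prop := Wtlt { wtltP : forall m, f@_m != 0 -> (weight m < B)%N }.

Lemma wtlt0 f : wtlt 0 f -> f = 0.
Proof. by move=> [hf]; apply/malgP => m; rewrite mcoeff0; apply/eqP/negPn/negP => /hf. Qed.

Lemma wtlt_mono B B' f : (B <= B')%N -> wtlt B f -> wtlt B' f.
Proof. by move=> BB [hf]; split=> m /hf h; exact: leq_trans BB. Qed.

Lemma wtlt_lin B a f g : wtlt B f -> wtlt B g -> wtlt B (a *: f + g).
Proof.
move=> [hf] [hg]; split=> m; rewrite coefP; have [->|/hf //] := eqVneq f@_m 0.
by rewrite mulr0 add0r => /hg.
Qed.

Lemma weight_wide (d : {fset nat}) m : (finsupp m `<=` d)%fset ->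
  weight m = (\sum_(i <- d) m i * i.+1)%N.
Proof.
move=> md; rewrite /weight (big_fset_incl _ md) // => i _.
by rewrite -cmE_eq0 => /eqP ->.
Qed.

Lemma weightM m i : weight (mulcm m (ucm i)) = (weight m + i.+1)%N.
Proof.
pose d := (finsupp m `|` finsupp (mulcm m (ucm i)) `|` finsupp (ucm i))%fset.
rewrite (@weight_wide d); last by apply/fsubsetP => j; rewrite !in_fsetU => ->; rewrite orbT.
rewrite (@weight_wide d m); last by apply/fsubsetP => j; rewrite !in_fsetU => ->.
under eq_bigr do rewrite mulcm_ucm mulnDl; rewrite big_split /=; congr (_ + _)%N.
have id : i \in d by rewrite !in_fsetU mdomU in_fset1 eqxx !orbT.
rewrite (bigD1_seq i) ?fset_uniq //= eqxx mul1n big1 ?addn0 // => j.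
by rewrite eq_sym => /negPf ->.
Qed.

Lemma weight1 : weight (@onecm nat) = 0%N.
Proof.
by rewrite /weight; have -> : finsupp (@onecm nat) = fset0 by [exact: mdom1]; rewrite big_seq_fset0.
Qed.

Lemma wtlt_h B i f : wtlt B f -> wtlt (B - i.+1) (h i.+1%:Z f).
Proof.
move=> [hf]; split=> m.
have e : (h i.+1%:Z f)@_m = (i.+1 * (m i).+1)%:R * f@_(mulcm m (ucm i)) := coef_lowering i f m.
move=> ne; have hm : f@_(mulcm m (ucm i)) != 0.
  by move: ne; rewrite -/(is_true _) (congr1 (fun x => x != 0) e) mulf_eq0 negb_or => /andP[].
by have := hf _ hm; rewrite weightM; lia.
Qed.

Definition wtbound f := (\max_(m <- msupp f) weight m).+1.

Lemma wtboundP f : wtlt (wtbound f) f.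
Proof. by split=> m; rewrite mcoeff_neq0 => hm; rewrite ltnS; exact: leq_bigmax_seq. Qed.

Lemma wtlt_zero : wtlt 0 0. Proof. by split=> m; rewrite mcoeff0 eqxx. Qed.

Lemma heisE gamma n f : heis gamma n f = hg h gamma n f.
Proof.
rewrite /hg; case: n => [[|i]|i]; first by rewrite fock_h0 add0r.
  by rewrite scale0r addr0.
by rewrite scale0r addr0.
Qed.

Section Vertex.
Variable alpha : C.

(* Stated over an arbitrary module, where the polynomial operations stay opaque. *)
Let creation_series (U : lmodType C) (H H0 : int -> U -> U) :
  (forall i u, H (- i.+1%:Z) u = H0 (- i.+1%:Z) u) ->
  (fun (i : nat) u => if i == 0%N then 0 else - (alpha / (- i%:Z)%:~R) *: H (- i%:Z) u)
  = Xcre H0 alpha.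
Proof.
move=> e; apply/funext => i; apply/funext => u; rewrite /Xcre; case: i => // i.
by rewrite [in LHS]/= e rmorphN /= invrN mulrN opprK.
Qed.

Let annihilation_series (U : lmodType C) (H H0 : int -> U -> U) :
  (forall i u, H i.+1%:Z u = H0 i.+1%:Z u) ->
  (fun (i : nat) u => if i == 0%N then 0 else - (alpha / i%:R) *: H i%:Z u)
  = Xann H0 alpha.
Proof. by move=> e; apply/funext => i; apply/funext => u; rewrite /Xann; case: i => // i; rewrite e. Qed.

Let heis_neg gamma i f : heis gamma (- i.+1%:Z) f = h (- i.+1%:Z) f.
Proof. exact: (erefl (<< ucm i >> * f)). Qed.
Let heis_pos gamma i f : heis gamma i.+1%:Z f = h i.+1%:Z f.
Proof. exact: (erefl (lowering i f)). Qed.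

Lemma exp_creationE gamma i f : exp_creation alpha gamma i f = opser_exp (Xcre h alpha) i f.
Proof.
have e := @creation_series _ (heis gamma) h (heis_neg gamma).
by rewrite -e /exp_creation; reflexivity.
Qed.

Lemma exp_annihilationE gamma i f :
  exp_annihilation alpha gamma i f = opser_exp (Xann h alpha) i f.
Proof.
have e := @annihilation_series _ (heis gamma) h (heis_pos gamma).
by rewrite -e /exp_annihilation; reflexivity.
Qed.

Definition fvert := vert h wtbound alpha.

Let difference_sum (U : lmodType C) (F : nat -> nat -> U) (B : nat) (s : int) :
  (forall i j, (B <= j)%N -> F i j = 0) ->
  \sum_(ij \in [set ij : nat * nat | ij.1%:Z - ij.2%:Z = s]) F ij.1 ij.2
  = \sum_(j < B) (if s + j%:Z is Posz i then F i j else 0).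
Proof.
move=> F0; pose r := [seq (absz (s + j%:Z), j) | j <- iota 0 B & (0 <= s + j%:Z)%R].
have ru : uniq r.
  rewrite map_inj_uniq; first by rewrite filter_uniq ?iota_uniq.
  by move=> j j' [].
rewrite (fsbigE r) //=.
- rewrite big_map big_filter_cond.
  rewrite -(big_mkord xpredT (fun j => if s + j%:Z is Posz i then F i j else 0)).
  rewrite /index_iota subn0 big_mkcond /=; apply: eq_bigr => j _.
  case E : (s + j%:Z) => [i|i] /=; rewrite ?mem_set //=; lia.
- move=> ij /= /mapP[j]; rewrite mem_filter => /andP[sj _] -> /=; lia.
move=> [i j] /= e; have [jB|/F0-> //] := ltnP j B.
case/negP; apply/mapP; exists j; first by rewrite mem_filter mem_iota; lia.
by congr (_, _); lia.
Qed.

Let annihilation_small j f : (wtbound f <= j)%N -> opser_exp (Xann h alpha) j f = 0.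
Proof.
move=> Bj.
pose proof (@W_ann C (cpoly C) h fock_hP fock_h_comm wtlt wtlt_mono) as e0.
pose proof (e0 wtlt_lin wtlt_h wtlt_zero alpha (wtbound f) j f (wtboundP f)) as e.
have z : (wtbound f - j = 0)%N by lia.
by rewrite z in e; exact (wtlt0 e).
Qed.

Let creation_of_zero (U : lmodType C) (H : int -> U -> U)
  (HP : forall n a u w, H n (a *: u + w) = a *: H n u + H n w)
  i j u :
  opser_exp (Xann H alpha) j u = 0 ->
  opser_exp (Xcre H alpha) i (opser_exp (Xann H alpha) j u) = 0.
Proof. move=> ->; exact: linfun0 (creP HP alpha i). Qed.

(** Pairs of exponents with difference s are indexed by the second one, which the
   weight of f bounds. *)
Lemma vertex_coefE gamma s f : vertex_coef alpha gamma s f = fvert s f.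
Proof.
pose F i j := exp_creation alpha (gamma + alpha) i (exp_annihilation alpha gamma j f).
have FE i j : F i j = opser_exp (Xcre h alpha) i (opser_exp (Xann h alpha) j f).
  by rewrite /F exp_creationE exp_annihilationE.
have F0 i j : (wtbound f <= j)%N -> F i j = 0.
  move=> Bj; rewrite FE.
  exact (@creation_of_zero (cpoly C) h fock_hP i j f (annihilation_small Bj)).
apply: etrans (difference_sum s F0) _; rewrite /fvert /vert; apply: eq_bigr => j _.
by case: (s + j%:Z) => [i|i] //; rewrite FE.
Qed.

End Vertex.

(** The modes h_n, the Sugawara operators and the vertex operator coefficients
   on C[x_0, x_1, ...] = F_gamma. *)
Definition fsug := sugawara h wtbound.
Definition fmode := hg h.

Lemma fmodeP gamma n a f g : fmode gamma n (a *: f + g) = a *: fmode gamma n f + fmode gamma n g.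
Proof. exact (@hgP C (cpoly C) h fock_hP gamma n a f g). Qed.

Lemma fvertP alpha s a f g : fvert alpha s (a *: f + g) = a *: fvert alpha s f + fvert alpha s g.
Proof.
exact (@vertP C (cpoly C) h fock_hP fock_h_comm wtlt wtlt0 wtlt_mono wtlt_lin wtlt_h wtbound
  wtboundP wtlt_zero alpha s a f g).
Qed.

Lemma fsugP gamma (m : nat) a f g : fsug gamma m (a *: f + g) = a *: fsug gamma m f + fsug gamma m g.
Proof.
exact (@sugawaraP C (cpoly C) h fock_hP wtlt wtlt0 wtlt_mono wtlt_lin wtlt_h wtbound
  wtboundP gamma m a f g).
Qed.

Lemma fmode_vert alpha gamma n s f :
  fmode (gamma + alpha) n (fvert alpha s f)
  = fvert alpha s (fmode gamma n f) + alpha *: fvert alpha (s - n) f.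
Proof.
exact (@hg_vert C (cpoly C) h fock_hP fock_h0 fock_h_comm wtlt wtlt0 wtlt_mono wtlt_lin wtlt_h wtbound
  wtboundP wtlt_zero alpha gamma n s f).
Qed.

Lemma fsug_vert alpha gamma (m : nat) s f : let s' := s - m%:Z + 1 in
  fsug (gamma + alpha) m (fvert alpha s f) = fvert alpha s (fsug gamma m f)
  + (s'%:~R + alpha * gamma + m%:R * alpha ^+ 2 / 2%:R) *: fvert alpha s' f.
Proof.
exact (@sugawara_vert C (cpoly C) h fock_hP fock_h0 fock_h_comm wtlt wtlt0 wtlt_mono wtlt_lin wtlt_h
  wtbound wtboundP wtlt_zero alpha gamma m s f).
Qed.

Lemma fvert_small alpha f : exists B : nat, forall s, s + B%:Z <= 0 -> fvert alpha s f = 0.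
Proof. exists (wtbound f) => s; exact: (@vert_small C (cpoly C) h wtbound alpha s f). Qed.

Definition vac f : C := f@_(@onecm nat).

Lemma vacP a f g : vac (a *: f + g) = a * vac f + vac g.
Proof. exact: coefP. Qed.

Lemma vac_raising i f : vac (h (- i.+1%:Z) f) = 0.
Proof. by apply: etrans (coef_raising i f _) _; rewrite cm1. Qed.

(** The vacuum functional followed by annihilation modes. *)
Inductive fwords : (cpoly C -> C) -> Prop :=
  | fwords_vac : fwords vac
  | fwords_lower chi n : fwords chi -> fwords (fun f => chi (lowering n f)).

Lemma fwords_lin chi : fwords chi -> forall a f g, chi (a *: f + g) = a * chi f + chi g.
Proof.
elim=> [|{}chi n _ IH] a f g; first exact: vacP.
by rewrite loweringP IH.
Qed.

(** Up to a factor, h_(i1) ... h_(ir) extracts the coefficient of the monomial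
   x_(i1 - 1) ... x_(ir - 1). *)
Lemma fwords_coef m : exists chi, exists2 c : C, c != 0 &
  fwords chi /\ forall f, chi f = c * f@_m.
Proof.
have [k] := ubnP (mdeg m); elim: k m => // k IH m mk.
have [->|m1] := eqVneq m (@onecm nat).
  exists vac, 1; rewrite ?oner_neq0 //; split=> [|f]; first exact: fwords_vac.
  by rewrite mul1r.
have [i mi] : exists i, (0 < m i)%N.
  have [//|h0] := pselect (exists i, (0 < m i)%N).
  case/eqP: m1; apply/eqP/cmP => i; rewrite cm1; apply/eqP; rewrite -leqn0 leqNgt.
  by apply/negP => hi; apply: h0; exists i.
have mE : m = mulcm (divcm m (ucm i)) (ucm i) by rewrite divcmK.
have [|chi [c c0 [hchi chiE]]] := IH (divcm m (ucm i)).
  by have := mdegM (divcm m (ucm i)) (ucm i); rewrite -[mmul _ _]/(mulcm _ _) -mE mdegU; lia.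
exists (fun f => chi (lowering i f)), (c * (i.+1 * (divcm m (ucm i) i).+1)%:R).
  by rewrite mulf_neq0 // pnatr_eq0.
split=> [|f]; first exact: fwords_lower.
rewrite chiE -mulrA; congr (_ * _).
apply: etrans (coef_lowering i f _) _; by rewrite -mE.
Qed.

(** The vacuum functional kills creation modes on the left, so only the finite part
   of the Sugawara operator contributes. *)
Lemma vac_sug gamma (m : nat) f : vac (fsug gamma m f) =
  2%:R^-1 * \sum_(j < m) vac (fmode gamma j%:Z (fmode gamma (m - j.+1)%N%:Z f)).
Proof.
have vacD (u w : cpoly C) : vac (u + w) = vac u + vac w by exact: mcoeffD.
have vac0 : vac 0 = 0 by exact: mcoeff0.
have vacZ a (u : cpoly C) : vac (a *: u) = a * vac u by exact: mcoeffZ.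
have vac_sum (n : nat) (F : 'I_n -> cpoly C) : vac (\sum_j F j) = \sum_j vac (F j).
  exact: (big_morph vac vacD vac0).
apply: etrans (vacD _ _) _; rewrite vac_sum big1 ?add0r => [|l _]; last exact: vac_raising.
by apply: etrans (vacZ _ _) _; rewrite vac_sum.
Qed.

Lemma fmode0 gamma f : fmode gamma 0 f = gamma *: f.
Proof. by rewrite /fmode /hg fock_h0 add0r. Qed.

Lemma fmodeS gamma n f : fmode gamma n.+1%:Z f = lowering n f.
Proof. exact: (esym (heisE gamma n.+1%:Z f)). Qed.

Lemma vac1 : vac 1 = 1.
Proof. by rewrite /vac mcoeff1 eqxx. Qed.

Lemma lowering1 n : lowering n 1 = 0 :> cpoly C.
Proof.
apply/malgP => m; rewrite mcoeff0; apply: etrans (coef_lowering _ _ _) _.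
rewrite mcoeff1; case: eqP => [e|_]; last by rewrite mulr0.
have n0 : mulcm m (ucm n) n = 0%N by apply: etrans (congr1 (fun q : {cmonom nat} => q n) e) (cm1 n).
by move: n0; rewrite mulcm_ucm eqxx addn1.
Qed.

Lemma fmode_vac n : fmode 0 n%:Z 1 = 0.
Proof.
case: n => [|n]; first by rewrite fmode0 scale0r.
by rewrite fmodeS lowering1.
Qed.

Let sugawara_of_vacuum (U : lmodType C) (H : int -> U -> U) (dg : U -> nat)
  (HP : forall n a u w, H n (a *: u + w) = a *: H n u + H n w) (m : nat) u :
  (forall n : nat, hg H 0 n%:Z u = 0) -> sugawara H dg 0 m u = 0.
Proof.
move=> u0; rewrite /sugawara /sugawara_cut !big1 ?scaler0 ?addr0 // => j _.
  by rewrite u0; exact: linfun0 (hgP HP 0 _).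
by rewrite u0; exact: linfun0 (HP _).
Qed.

Lemma fsug_vac (m : nat) : fsug 0 m 1 = 0.
Proof. exact (@sugawara_of_vacuum (cpoly C) h wtbound fock_hP m 1 fmode_vac). Qed.

Lemma wtlt_vac : wtlt 1 1.
Proof.
split=> m; rewrite mcoeff1; case: (m =P mone) => [->|_]; last by rewrite eqxx.
by rewrite -[mone]/(onecm _) weight1.
Qed.

Lemma fvert_vac alpha s : fvert alpha s 1 = crez h alpha s 1.
Proof.
have e := @vert_wide C (cpoly C) h fock_hP fock_h_comm wtlt wtlt0 wtlt_mono wtlt_lin wtlt_h
  wtbound wtboundP wtlt_zero alpha 1 s 1 wtlt_vac.
by apply: etrans e _; rewrite big_ord1 addr0 exp0.
Qed.

Lemma fvert_vac_neg alpha s : s < 0 -> fvert alpha s 1 = 0.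
Proof. by rewrite fvert_vac; exact: crez_neg. Qed.

Lemma fvert_vac0 alpha : fvert alpha 0 1 = 1.
Proof. by rewrite fvert_vac; exact: exp0. Qed.

End FockModule.

(** * Tensor products with the Fock space *)

Section Linear.
Variable C : numClosedFieldType.
Implicit Types U W : lmodType C.

Record islinear U W (F : U -> W) : Prop := IsLinear
  { islinearP : forall a u w, F (a *: u + w) = a *: F u + F w }.

Section Theory.
Variables (U W : lmodType C) (F : U -> W).
Hypothesis F_lin : islinear F.

Lemma lin0 : F 0 = 0.
Proof.
have := islinearP F_lin 1 0 0; rewrite !scale1r addr0 => e.
by apply: (addrI (F 0)); rewrite addr0 -e.
Qed.
Lemma linD u w : F (u + w) = F u + F w.
Proof. by have := islinearP F_lin 1 u w; rewrite !scale1r. Qed.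
Lemma linZ a u : F (a *: u) = a *: F u.
Proof. by have := islinearP F_lin a u 0; rewrite lin0 !addr0. Qed.
Lemma lin_sum I (r : seq I) P (G : I -> U) :
  F (\sum_(i <- r | P i) G i) = \sum_(i <- r | P i) F (G i).
Proof. exact: (big_morph F linD lin0). Qed.
End Theory.

Lemma lin_comp U W (Z : lmodType C) (F : U -> W) (G : W -> Z) :
  islinear F -> islinear G -> islinear (fun u => G (F u)).
Proof. by move=> hF hG; split=> a u w; rewrite (islinearP hF) (islinearP hG). Qed.

Lemma lin_comb U W (F G : U -> W) b : islinear F -> islinear G ->
  islinear (fun u => b *: F u + G u).
Proof.
move=> hF hG; split=> a u w; rewrite (islinearP hF) (islinearP hG) !scalerDr !scalerA.
by rewrite [b * a]mulrC addrACA.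
Qed.

Lemma lin_add U W (F G : U -> W) : islinear F -> islinear G -> islinear (fun u => F u + G u).
Proof. by move=> hF hG; split=> a u w; rewrite (islinearP hF) (islinearP hG) scalerDr addrACA. Qed.

Lemma lin_bigsum U W I (r : seq I) (F : I -> U -> W) : (forall i, islinear (F i)) ->
  islinear (fun u => \sum_(i <- r) F i u).
Proof.
move=> hF; split=> a u w; rewrite scaler_sumr -big_split; apply: eq_bigr => i _.
exact: (islinearP (hF i)).
Qed.

Lemma lin_zero U W : islinear (fun _ : U => 0 : W).
Proof. by split=> a u w; rewrite scaler0 addr0. Qed.

Lemma lin_linear U W (F : {linear U -> W}) : islinear F.
Proof. by split=> a u w; rewrite linearP. Qed.

End Linear.

Section TensorFock.
Variables (C : numClosedFieldType) (M : lmodType C).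
Implicit Types (g : tensF M) (k : int) (x y : M) (f : cpoly C) (m : {cmonom nat}).

(** The coefficient in M of the k-th copy of the monomial m. *)
Definition tcoef g k m : M := (g : {malg M[_]})@_(k, m).

Lemma tcoef_inj g g' : (forall k m, tcoef g k m = tcoef g' k m) -> g = g'.
Proof. by move=> e; apply/malgP => -[k m]; exact: e. Qed.

Lemma tcoefP k m : islinear (fun g => tcoef g k m).
Proof.
split=> a g g'; apply: etrans (mcoeffD _ _ _) _; congr (_ + _); exact: tens_scaleE.
Qed.

Lemma tcoef_in k x f k' m : tcoef (tensF_in k x f) k' m = if k == k' then f@_m *: x else 0.
Proof.
rewrite /tcoef /tensF_in raddf_sum /=.
under eq_bigr do rewrite mcoeffU.
have F0 m' : m' != m -> (f@_m' *: x) *+ ((k, m') == (k', m)) = 0.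
  by move=> ne; rewrite xpair_eqE (negPf ne) andbF.
have [h|h] := boolP (m \in msupp f).
  rewrite (bigD1_seq _ h) ?fset_uniq //= xpair_eqE eqxx andbT big1 ?addr0 //.
  by case: eqP.
rewrite (mcoeff_outdom h) scale0r if_same big_seq big1 // => m' hm'; apply: F0.
by apply: contraNneq h => <-.
Qed.

Lemma tensor_linl k f : islinear (fun x => tensF_in k x f).
Proof.
split=> a x y; apply: tcoef_inj => k' m.
apply: etrans (tcoef_in _ _ _ _ _) _; apply/esym; apply: etrans (islinearP (tcoefP k' m) _ _ _) _.
apply: etrans (congr2 (fun u w => a *: u + w) (tcoef_in _ _ _ _ _) (tcoef_in _ _ _ _ _)) _.
by case: (k == k'); rewrite ?scaler0 ?addr0 // scalerDr !scalerA mulrC.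
Qed.

Lemma tensor_linr k x : islinear (fun f => tensF_in k x f).
Proof.
split=> a f f'; apply: tcoef_inj => k' m.
apply: etrans (tcoef_in _ _ _ _ _) _; apply/esym; apply: etrans (islinearP (tcoefP k' m) _ _ _) _.
apply: etrans (congr2 (fun u w => a *: u + w) (tcoef_in _ _ _ _ _) (tcoef_in _ _ _ _ _)) _.
case: (k == k'); last by rewrite scaler0 addr0.
by rewrite scalerA -scalerDl; apply: (congr1 (fun c => c *: x)); apply/esym/coefP.
Qed.

Section Extension.
Variables (W : lmodType C) (T : int -> M -> cpoly C -> W).
Hypothesis T_linl : forall k f, islinear (fun x => T k x f).

Lemma tensF_ext_wide (d : {fset int * {cmonom nat}}) g :
  (msupp (g : {malg M[_]}) `<=` d)%fset ->
  tensF_ext T g = \sum_(km <- d) T km.1 (tcoef g km.1 km.2) << km.2 >>.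
Proof.
move=> gd; rewrite /tensF_ext (big_fset_incl _ gd) => [|km _ hkm].
  by apply: eq_bigr => -[k m] _.
by rewrite (mcoeff_outdom hkm) (lin0 (T_linl _ _)).
Qed.

Lemma tensF_extP : islinear (tensF_ext T).
Proof.
split=> a g g'.
pose d := (msupp (g : {malg M[_]}) `|` msupp (g' : {malg M[_]})
  `|` msupp (a *: g + g' : {malg M[_]}))%fset.
rewrite !(@tensF_ext_wide d); try by apply/fsubsetP => i; rewrite !in_fsetU => ->; rewrite ?orbT.
rewrite scaler_sumr -big_split; apply: eq_bigr => -[k m] _ /=.
by rewrite (islinearP (tcoefP k m)) (islinearP (T_linl _ _)).
Qed.

Hypothesis T_linr : forall k x, islinear (T k x).

Lemma tensF_ext_in k x f : tensF_ext T (tensF_in k x f) = T k x f.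
Proof.
pose d := [fset (k, m) | m in msupp f]%fset.
rewrite (@tensF_ext_wide d); last first.
  apply/fsubsetP => -[k' m]; rewrite -mcoeff_neq0.
  rewrite -[X in X != _]/(tcoef _ k' m) tcoef_in; have [<- h|_] := eqVneq k k'; last by rewrite eqxx.
  apply/imfsetP; exists m => //=; rewrite -mcoeff_neq0.
  by apply: contraNneq h => ->; rewrite scale0r.
rewrite big_imfset /=; last by move=> m m' _ _ [].
have fE : f = \sum_(m <- msupp f) f@_m *: << m >>.
  rewrite {1}[f]monalgE; apply: eq_bigr => m _; apply/malgP => m'.
  have e1 : (<< f@_m *g m >> : cpoly C)@_m' = f@_m *+ (m == m') := mcoeffU _ _ _.
  have e2 : (<< m >> : cpoly C)@_m' = 1 *+ (m == m') := mcoeffU _ _ _.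
  apply: etrans e1 _; apply/esym; apply: etrans (mcoeffZ _ _ _) _.
  by apply: etrans (congr1 (fun c => f@_m * c) e2) _; rewrite mulr_natr.
apply/esym; apply: etrans (congr1 (T k x) fE) _.
apply: etrans (lin_sum (T_linr k x) _ _ _) _; apply: eq_bigr => m _ /=.
apply: etrans (linZ (T_linr k x) _ _) _; apply/esym.
apply: etrans (congr1 (fun y => T k y << m >>) (tcoef_in _ _ _ _ _)) _.
by rewrite eqxx; exact: (linZ (T_linl k << m >>)).
Qed.

End Extension.

Lemma tensor_span g : g =
  \sum_(km <- msupp (g : {malg M[_]})) tensF_in km.1 (tcoef g km.1 km.2) << km.2 >>.
Proof.
apply: tcoef_inj => k m; rewrite (lin_sum (tcoefP k m)).
have F0 km : km != (k, m) -> tcoef (tensF_in km.1 (tcoef g km.1 km.2) << km.2 >>) k m = 0.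
  case: km => k' m' /=; rewrite tcoef_in xpair_eqE mcoeffU; case: eqP => //= _ /negPf ->.
  by rewrite scale0r.
have [h|h] := boolP ((k, m) \in msupp (g : {malg M[_]})).
  rewrite (bigD1_seq _ h) ?fset_uniq //= big1 => [|km]; last exact: F0.
  by rewrite tcoef_in eqxx mcoeffU eqxx scale1r addr0.
rewrite /tcoef (mcoeff_outdom h) big_seq big1 // => km hkm; apply: F0.
by apply: contraNneq h => <-.
Qed.

(** Linear maps are compared on pure tensors. *)
Lemma tensor_ext_eq (W : lmodType C) (F G : tensF M -> W) : islinear F -> islinear G ->
  (forall k x f, F (tensF_in k x f) = G (tensF_in k x f)) -> F =1 G.
Proof.
move=> hF hG e g; rewrite [g]tensor_span (lin_sum hF) (lin_sum hG).
by apply: eq_bigr => km _; exact: e.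
Qed.

End TensorFock.

(** * The modes of the current *)

Section SupportSums.
Variables (C : numClosedFieldType) (U : lmodType C).

(** Finite support makes the choice of a summation range immaterial. *)
Lemma support_sum (I : eqType) (r1 r2 : seq I) (F : I -> U) : uniq r1 -> uniq r2 ->
  (forall i, i \notin r1 -> F i = 0) -> (forall i, i \notin r2 -> F i = 0) ->
  \sum_(i <- r1) F i = \sum_(i <- r2) F i.
Proof.
move=> u1 u2 h1 h2.
have half (r r' : seq I) : (forall i, i \notin r' -> F i = 0) ->
    \sum_(i <- r) F i = \sum_(i <- [seq i <- r | i \in r']) F i.
  move=> hr; rewrite big_filter [LHS](bigID (mem r')) /=.
  by rewrite [X in _ + X]big1 ?addr0 // => i hi; rewrite hr.
rewrite (half r1 r2) // (half r2 r1) //; apply: perm_big; apply: uniq_perm; rewrite ?filter_uniq //.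
by move=> i; rewrite !mem_filter andbC.
Qed.

(** A window of integers, to which all sums over Z with finite support reduce. *)
Definition win (B : nat) : seq int := [seq i%:Z - B%:Z | i <- iota 0 (B + B)].

Lemma mem_win B j : (j \in win B) = (- B%:Z <= j < B%:Z).
Proof.
apply/mapP/idP => [[x hi ->]|hj]; first by move: hi; rewrite mem_iota; lia.
exists (absz (j + B%:Z)); rewrite ?mem_iota; lia.
Qed.

Lemma win_uniq B : uniq (win B).
Proof. by rewrite map_inj_uniq ?iota_uniq // => i j; lia. Qed.

(** The sum of two weighted series, one of them shifted by n, where the weights of the
   shifted series and of the other one add up to the constant b. *)
Lemma recombine_sum (r : seq int) (n : int) (a1 a2 : int -> C) (b : C) (X Y Z : int -> U) :
  uniq r -> (forall i, i \notin r -> Z i = 0) ->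
  (forall i, i \notin [seq i + n | i <- r] -> Z i = 0) -> (forall i, a1 i + a2 i = b) ->
  \sum_(i <- r) ((X i + a1 (i + n) *: Z (i + n)) + (Y i + a2 i *: Z i))
  = b *: (\sum_(i <- r) Z i) + (\sum_(i <- r) X i + \sum_(i <- r) Y i).
Proof.
move=> ru h4 h5 ab.
have shift : \sum_(i <- r) a1 (i + n) *: Z (i + n) = \sum_(i <- r) a1 i *: Z i.
  rewrite -(big_map (fun i => i + n) xpredT (fun i => a1 i *: Z i)).
  apply: support_sum => // [|i hi|i hi].
  - by rewrite map_inj_uniq // => i i'; exact: addIr.
  - by rewrite h5 ?scaler0.
  - by rewrite h4 ?scaler0.
rewrite !big_split /= shift addrACA addrC; congr (_ + _).
rewrite -big_split /= scaler_sumr; apply: eq_bigr => i _.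
by rewrite -scalerDl ab.
Qed.

Lemma graph_sum (P : set (int * int)) (c : int) (F : int -> int -> U) (r : seq int) :
  (forall j t, P (j, t) <-> t = j - c) -> uniq r -> (forall j, j \notin r -> F j (j - c) = 0) ->
  \sum_(rt \in P) F rt.1 rt.2 = \sum_(j <- r) F j (j - c).
Proof.
move=> eqn ru hr; pose q := [seq (j, j - c) | j <- r].
rewrite (fsbigE q) /=.
- rewrite /q big_map big_mkcond /=; apply: eq_bigr => j _.
  by rewrite mem_set //; exact/eqn.
- by rewrite map_inj_uniq // => j j' [].
- by move=> _ /mapP[j _ ->] /=; exact/eqn.
move=> [j t] /= /eqn -> hj; apply: hr.
by apply: contra hj => jr; apply/mapP; exists j.
Qed.

End SupportSums.

Section Operators.
Variables (C : numClosedFieldType) (M : lmodType C).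
Implicit Types (k : int) (x : M) (f : cpoly C).

Section Generic.
Variables (A : M -> M) (B : int -> cpoly C -> cpoly C).
Hypotheses (A_lin : islinear A) (B_lin : forall k, islinear (B k)).

Definition tens_op : tensF M -> tensF M := tensF_ext (fun k x f => tensF_in k (A x) (B k f)).

Let T_linl k f : islinear (fun x => tensF_in k (A x) (B k f)).
Proof. exact (lin_comp A_lin (tensor_linl _ k (B k f))). Qed.

Let T_linr k x : islinear (fun f => tensF_in k (A x) (B k f)).
Proof. exact (lin_comp (B_lin k) (tensor_linr k (A x))). Qed.

Lemma tens_op_lin : islinear tens_op.
Proof. exact: tensF_extP. Qed.

Lemma tens_op_in k x f : tens_op (tensF_in k x f) = tensF_in k (A x) (B k f).
Proof. exact: (tensF_ext_in T_linl T_linr). Qed.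
End Generic.

Lemma id_lin (U : lmodType C) : islinear (fun u : U => u).
Proof. by []. Qed.

Variables (L : int -> {linear M -> M}) (gam : int -> C).

Definition hop n := tens_op (fun x => x) (fun k => fmode (gam k) n).
Definition lop n := tens_op (L n) (fun _ f => f).
Definition sop m := tens_op (fun x => x) (fun k => fsug (gam k) m).
(** The total Virasoro operator of mode m - 1. *)
Definition top (m : nat) (u : tensF M) : tensF M := lop (m%:Z - 1) u + sop m u.

Lemma fmode_lin gamma n : islinear (@fmode C gamma n).
Proof. by split=> a f g; exact: fmodeP. Qed.
Lemma fsug_lin gamma m : islinear (@fsug C gamma m).
Proof. by split=> a f g; exact: fsugP. Qed.

Lemma hop_lin n : islinear (hop n).
Proof. exact (tens_op_lin (fun k => fmode (gam k) n) (id_lin M)). Qed.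
Lemma lop_lin n : islinear (lop n).
Proof. exact (tens_op_lin (fun _ f => f) (lin_linear (L n))). Qed.
Lemma sop_lin m : islinear (sop m).
Proof. exact (tens_op_lin (fun k => fsug (gam k) m) (id_lin M)). Qed.
Lemma top_lin m : islinear (top m).
Proof. exact (lin_add (lop_lin (m%:Z - 1)) (sop_lin m)). Qed.

Lemma hop_in n k x f : hop n (tensF_in k x f) = tensF_in k x (fmode (gam k) n f).
Proof. exact (tens_op_in (id_lin M) (fun k => fmode_lin (gam k) n) k x f). Qed.
Lemma lop_in n k x f : lop n (tensF_in k x f) = tensF_in k (L n x) f.
Proof. exact (tens_op_in (lin_linear (L n)) (fun _ => id_lin (cpoly C)) k x f). Qed.
Lemma sop_in m k x f : sop m (tensF_in k x f) = tensF_in k x (fsug (gam k) m f).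
Proof. exact (tens_op_in (id_lin M) (fun k => fsug_lin (gam k) m) k x f). Qed.
End Operators.

Section CurrentModes.
Variables (C : numClosedFieldType) (p : nat) (M N : lmodType C).
Variables (LM : int -> {linear M -> M}) (LN : int -> {linear N -> N}).
Variables (psi : int -> {linear M -> N}) (Delta s : C).
Hypothesis prim : primary_field Delta s LM LN psi.
Hypothesis truncated : forall x, exists B : int, forall n, B < n -> psi n x = 0.
Variables (gM gN : int -> C) (kk : int -> int) (kappa : int -> int).
Local Notation alpha := (beta C p).
Hypothesis charge : forall k, gN (kk k) = gM k + alpha.
(* The total power of z is integral on each summand. *)
Hypothesis exponent : forall k, alpha * gM k - s = (kappa k)%:~R.
Implicit Types (k n j : int) (x : M) (f : cpoly C).

(** The contribution of psi_j to the mode of the current for which the exponent of the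
   vertex operator is j - c. *)
Definition cur_term k (c : int) x f j : tensF N :=
  tensF_in (kk k) (psi j x) (fvert alpha (j - c) f).

Lemma cur_term_support k (c : int) x f : exists B, forall r : seq int, {subset win B <= r} ->
  forall j, j \notin r -> cur_term k c x f j = 0.
Proof.
have [B1 h1] := truncated x; have [B2 h2] := fvert_small alpha f.
exists (absz B1 + B2 + absz c).+1 => r hr j jr.
have : j \notin win (absz B1 + B2 + absz c).+1 by apply: contra jr; exact: hr.
rewrite mem_win => hj; rewrite /cur_term; have [B1j|jB1] := ltP B1 j.
  by rewrite h1 // (lin0 (tensor_linl _ _ _)).
by rewrite h2 ?(lin0 (tensor_linr _ _)) //; lia.
Qed.

Definition cur n : tensF M -> tensF N :=
  tensF_ext (fun k => current_coef p s psi (gM k) (kk k) n).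

Lemma current_coefE n k x f r : uniq r ->
  (forall j, j \notin r -> cur_term k (n + 1 + kappa k) x f j = 0) ->
  current_coef p s psi (gM k) (kk k) n x f = \sum_(j <- r) cur_term k (n + 1 + kappa k) x f j.
Proof.
move=> ru hr; rewrite /current_coef.
pose c := n + 1 + kappa k.
have eqn (j t : int) : (- j%:~R - s + (t%:~R + alpha * gM k) = - n%:~R - 1 :> C) <-> t = j - c.
  have -> : - j%:~R - s + (t%:~R + alpha * gM k) = (t - j + kappa k)%:~R :> C.
    by rewrite rmorphD rmorphB /= -exponent; ring.
  have -> : - n%:~R - 1 = (- n - 1)%:~R :> C by rewrite rmorphB rmorphN.
  by split=> [/eqP|->]; [rewrite eqr_int => /eqP; rewrite /c; lia|congr (_%:~R); rewrite /c; lia].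
have e := @graph_sum C (tensF N)
  [set rt : int * int | - rt.1%:~R - s + (rt.2%:~R + alpha * gM k) = - n%:~R - 1 :> C] c (fun j t => tensF_in (kk k) (psi j x)
  (vertex_coef alpha (gM k) t f)) r eqn ru.
have vE j : tensF_in (kk k) (psi j x) (vertex_coef alpha (gM k) (j - c) f) = cur_term k c x f j.
  exact: (congr1 (tensF_in _ _) (vertex_coefE _ _ _ _)).
apply: etrans (e _) _ => [j jr|]; first by rewrite vE; exact: hr.
by apply: eq_bigr => j _; exact: vE.
Qed.

Let coef_linl n k f : islinear (fun x => current_coef p s psi (gM k) (kk k) n x f).
Proof.
split=> a x y.
have [B1 h1] := cur_term_support k (n + 1 + kappa k) x f.
have [B2 h2] := cur_term_support k (n + 1 + kappa k) y f.
have [B3 h3] := cur_term_support k (n + 1 + kappa k) (a *: x + y) f.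
pose r := win (B1 + B2 + B3).
have sub B : (B <= B1 + B2 + B3)%N -> {subset win B <= r} by move=> hB j; rewrite !mem_win; lia.
have s1 := h1 r (sub B1 ltac:(lia)); have s2 := h2 r (sub B2 ltac:(lia)).
have s3 := h3 r (sub B3 ltac:(lia)); have ru : uniq r := win_uniq _.
apply: etrans (current_coefE ru s3) _; apply/esym.
apply: etrans (congr2 (fun u w => a *: u + w) (current_coefE ru s1) (current_coefE ru s2)) _.
apply/esym; rewrite scaler_sumr -big_split; apply: eq_bigr => j _ /=.
apply: etrans (congr1 (fun z => tensF_in (kk k) z _) (linearP (psi j) a x y)) _.
exact: (islinearP (tensor_linl _ _ _)).
Qed.

Let coef_linr n k x : islinear (fun f => current_coef p s psi (gM k) (kk k) n x f).
Proof.
split=> a f g.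
have [B1 h1] := cur_term_support k (n + 1 + kappa k) x f.
have [B2 h2] := cur_term_support k (n + 1 + kappa k) x g.
have [B3 h3] := cur_term_support k (n + 1 + kappa k) x (a *: f + g).
pose r := win (B1 + B2 + B3).
have sub B : (B <= B1 + B2 + B3)%N -> {subset win B <= r} by move=> hB j; rewrite !mem_win; lia.
have s1 := h1 r (sub B1 ltac:(lia)); have s2 := h2 r (sub B2 ltac:(lia)).
have s3 := h3 r (sub B3 ltac:(lia)); have ru : uniq r := win_uniq _.
apply: etrans (current_coefE ru s3) _; apply/esym.
apply: etrans (congr2 (fun u w => a *: u + w) (current_coefE ru s1) (current_coefE ru s2)) _.
apply/esym; rewrite scaler_sumr -big_split; apply: eq_bigr => j _ /=.
apply: etrans (congr1 (tensF_in (kk k) _) (fvertP _ _ a f g)) _.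
exact: (islinearP (tensor_linr _ _)).
Qed.

Lemma cur_lin n : islinear (cur n).
Proof. exact: tensF_extP. Qed.

Lemma cur_in n k x f r : uniq r ->
  (forall j, j \notin r -> cur_term k (n + 1 + kappa k) x f j = 0) ->
  cur n (tensF_in k x f) = \sum_(j <- r) cur_term k (n + 1 + kappa k) x f j.
Proof.
move=> ru hr; rewrite -(current_coefE ru hr).
exact: (tensF_ext_in (coef_linl n) (coef_linr n)).
Qed.

Let window k f x f' x' f'' x'' (c c' c'' : int) : exists B, forall r : seq int, {subset win B <= r} ->
  [/\ forall j, j \notin r -> cur_term k c x f j = 0,
      forall j, j \notin r -> cur_term k c' x' f' j = 0
    & forall j, j \notin r -> cur_term k c'' x'' f'' j = 0].
Proof.
have [B1 h1] := cur_term_support k c x f.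
have [B2 h2] := cur_term_support k c' x' f'.
have [B3 h3] := cur_term_support k c'' x'' f''.
exists (B1 + B2 + B3)%N => r hr.
have sub B : (B <= B1 + B2 + B3)%N -> {subset win B <= r}.
  by move=> hB j hj; apply: hr; move: hj; rewrite !mem_win; lia.
by split; [apply: h1|apply: h2|apply: h3]; apply: sub; lia.
Qed.

Lemma hop_cur n j u : hop gN n (cur j u) = cur j (hop gM n u) + alpha *: cur (j + n) u.
Proof.
have e0 : (fun u => hop gN n (cur j u)) =1 (fun u => alpha *: cur (j + n) u + cur j (hop gM n u)).
  apply: tensor_ext_eq => [||k x f].
  - exact: (lin_comp (cur_lin j) (hop_lin _ gN n)).
  - exact: (lin_comb alpha (cur_lin (j + n)) (lin_comp (hop_lin _ gM n) (cur_lin j))).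
  pose c := j + 1 + kappa k; pose c' := j + n + 1 + kappa k.
  have [B hB] := window k f x f x (fmode (gM k) n f) x c c' c.
  have [h1 h2 h3] := hB (win B) (fun _ => id); have ru := win_uniq B.
  apply: etrans (congr1 (hop gN n) (cur_in ru h1)) _.
  apply/esym; apply: etrans (congr2 (fun u w => alpha *: u + w) (cur_in ru h2)
    (etrans (congr1 (cur j) (hop_in gM n k x f)) (cur_in ru h3))) _; apply/esym.
  apply: etrans (lin_sum (hop_lin _ gN n) _ _ _) _; rewrite scaler_sumr -big_split.
  apply: eq_bigr => i _ /=.
  apply: etrans (hop_in gN n _ _ _) _; rewrite charge.
  apply: etrans (congr1 (tensF_in _ _) (fmode_vert _ _ _ _ _)) _.
  apply: etrans (linD (tensor_linr _ _) _ _) _; rewrite addrC; congr (_ + _).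
  apply: etrans (linZ (tensor_linr _ _) _ _) _.
  congr (_ *: tensF_in _ _ (fvert _ _ _)); rewrite /c /c'; lia.
by apply: etrans (e0 u) _; exact: addrC.
Qed.

(** The current is primary for the total Virasoro algebra, of weight
   Delta + alpha^2 / 2. The weights - j - s + m Delta of psi and
   (j - c') + alpha gamma + m alpha^2 / 2 of the vertex operator depend on the summation
   index j, but their sum does not. *)
Lemma top_cur m j u : top LN gN m (cur j u) = cur j (top LM gM m u)
  + (- (j + m%:Z)%:~R + m%:R * (Delta + alpha ^+ 2 / 2%:R)) *: cur (j + m%:Z - 1) u.
Proof.
set b := (X in X *: _).
have e0 : (fun u => top LN gN m (cur j u)) =1 (fun u => b *: cur (j + m%:Z - 1) u + cur j (top LM gM m u)).
  apply: tensor_ext_eq => [||k x f].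
  - exact: (lin_comp (cur_lin j) (top_lin LN gN m)).
  - exact: (lin_comb b (cur_lin _) (lin_comp (top_lin LM gM m) (cur_lin j))).
  pose n := m%:Z - 1; pose c := j + 1 + kappa k; pose c' := j + m%:Z - 1 + 1 + kappa k.
  have cn : c' = c + n by rewrite /c /c' /n; lia.
  have [B hB] := window k f x (fsug (gM k) m f) x f (LM n x) c c c.
  have [B' hB'] := window k f x f x f x c' c' c'.
  pose r := win (B + B' + absz n); have ru : uniq r := win_uniq _.
  have [|h1 h2 h3] := hB r; first by move=> i; rewrite !mem_win; lia.
  have [|h4 _ _] := hB' r; first by move=> i; rewrite !mem_win; lia.
  have [|h5 _ _] := hB' [seq i + n | i <- r].
    move=> i; rewrite !mem_win => hi; apply/mapP; exists (i - n); rewrite ?subrK //.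
    by rewrite mem_win; lia.
  pose ct := cur_term k c' x f.
  pose a1 (i : int) : C := - i%:~R - s + m%:R * Delta.
  pose a2 (i : int) : C := (i - c')%:~R + alpha * gM k + m%:R * alpha ^+ 2 / 2%:R.
  have ab i : a1 i + a2 i = b.
    rewrite /a1 /a2 /b /c' !(rmorphB, rmorphD) /= -exponent -[m%:~R]/(m%:R).
    by field.
  apply: etrans (congr1 (top LN gN m) (cur_in ru h1)) _.
  apply/esym; apply: etrans (congr2 (fun u w => b *: u + w) (cur_in ru h4)
    (etrans (congr1 (cur j) (congr2 +%R (lop_in LM n k x f) (sop_in gM m k x f)))
    (etrans (linD (cur_lin j) _ _) (congr2 +%R (cur_in ru h3) (cur_in ru h2))))) _; apply/esym.
  apply: etrans (lin_sum (top_lin LN gN m) _ _ _) _.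
  have term i : top LN gN m (cur_term k c x f i) =
      (cur_term k c (LM n x) f i + a1 (i + n) *: ct (i + n))
      + (cur_term k c x (fsug (gM k) m f) i + a2 i *: ct i).
    apply: etrans (congr2 +%R (lop_in LN n _ _ _) (sop_in gN m _ _ _)) _; congr (_ + _).
      have e : LN n (psi i x) = psi i (LM n x) + a1 (i + n) *: psi (i + n) x.
        apply/eqP; rewrite addrC -subr_eq prim /a1 /n subrK; apply/eqP.
        by congr ((_ + _ * _) *: _).
      apply: etrans (congr1 (fun z => tensF_in _ z _) e) _.
      apply: etrans (linD (tensor_linl _ _ _) _ _) _; congr (_ + _).
      apply: etrans (linZ (tensor_linl _ _ _) _ _) _.
      rewrite /ct /cur_term cn; congr (_ *: tensF_in _ _ (fvert _ _ _)); lia.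
    rewrite charge; apply: etrans (congr1 (tensF_in _ _) (fsug_vert _ _ _ _ _)) _.
    apply: etrans (linD (tensor_linr _ _) _ _) _; congr (_ + _).
    apply: etrans (linZ (tensor_linr _ _) _ _) _.
    have ic : i - c - m%:Z + 1 = i - c' by rewrite cn /n; lia.
    by rewrite ic.
  apply: etrans (eq_bigr _ (fun i _ => term i)) _.
  exact (recombine_sum (cur_term k c (LM n x) f) (cur_term k c x (fsug (gM k) m f)) ru h4 h5 ab).
by apply: etrans (e0 u) _; exact: addrC.
Qed.

End CurrentModes.

(** * Functionals on the sectors *)

Section Closure.
Variables (C : numClosedFieldType) (V : lmodType C).
Variables (H T : nat -> V -> V) (phi0 : V -> C).

(** The functionals to which a property of phi0 extends if it is linear and compatible
   with the commutators of H and T with the current. *)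
Inductive generated : (V -> C) -> Prop :=
  | gen_base : generated phi0
  | gen_lin a p q : generated p -> generated q -> generated (fun u => a * p u + q u)
  | gen_H n p : generated p -> generated (fun u => p (H n u))
  | gen_T m p : generated p -> generated (fun u => p (T m u)).

Lemma gen_zero : generated (fun _ => 0).
Proof.
have := gen_lin (-1) gen_base gen_base; congr generated; apply/funext => u.
by rewrite mulN1r addNr.
Qed.

Lemma gen_sum n (F : 'I_n -> V -> C) : (forall i, generated (F i)) -> generated (fun u => \sum_(i < n) F i u).
Proof.
elim: n F => [|n IH] F hF.
  by have := gen_zero; congr generated; apply/funext => u; rewrite big_ord0.
have := gen_lin 1 (hF ord0) (IH _ (fun i => hF (lift ord0 i))); congr generated; apply/funext => u.
by rewrite big_ord_recl mul1r.
Qed.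

Lemma gen_islinear p : (forall n, islinear (H n)) -> (forall m, islinear (T m)) ->
  islinear (phi0 : V -> C^o) -> generated p -> islinear (p : V -> C^o).
Proof.
move=> hH hT h0; elim=> [//|a {}p q _ hp _ hq|n {}p _ hp|m {}p _ hp].
- exact: (lin_comb a hp hq).
- exact: (lin_comp (hH n) hp).
- exact: (lin_comp (hT m) hp).
Qed.

End Closure.

Section Functionals.
Variables (C : numClosedFieldType) (M : lmodType C).
Implicit Types (k : int) (x : M) (f : cpoly C) (mu : M -> C) (chi : cpoly C -> C).

(** The functional mu (x) chi on the k-th summand. *)
Definition ctr k mu chi : tensF M -> C :=
  tensF_ext (W := C^o) (fun k' x f => if k == k' then mu x * chi f else 0).

Section Pair.
Variables (mu : M -> C) (chi : cpoly C -> C).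
Hypotheses (mu_lin : islinear (mu : M -> C^o)) (chi_lin : islinear (chi : cpoly C -> C^o)).

Let linl k k' f : islinear ((fun x => if k == k' then mu x * chi f else 0) : M -> C^o).
Proof.
split=> a x y; case: ifP => _; last by rewrite scaler0 addr0.
by have -> : mu (a *: x + y) = a * mu x + mu y := islinearP mu_lin a x y; rewrite mulrDl -mulrA.
Qed.

Let linr k k' x : islinear ((fun f => if k == k' then mu x * chi f else 0) : cpoly C -> C^o).
Proof.
split=> a f g; case: ifP => _; last by rewrite scaler0 addr0.
have -> : chi (a *: f + g) = a * chi f + chi g := islinearP chi_lin a f g.
by rewrite mulrDr mulrCA.
Qed.

Lemma ctr_lin k : islinear (ctr k mu chi : tensF M -> C^o).
Proof. exact: (tensF_extP (linl k)). Qed.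

Lemma ctr_in k k' x f : ctr k mu chi (tensF_in k' x f) = if k == k' then mu x * chi f else 0.
Proof. exact: (tensF_ext_in (linl k) (linr k)). Qed.
End Pair.

(** A vector of the tensor product vanishes if all the products of a functional on M
   and of an extracted coefficient do. *)
Lemma ctr_separate (Mu : (M -> C) -> Prop) (u : tensF M) :
  (forall mu, Mu mu -> islinear (mu : M -> C^o)) ->
  (forall x, (forall mu, Mu mu -> mu x = 0) -> x = 0) ->
  (forall k mu chi, Mu mu -> fwords chi -> ctr k mu chi u = 0) -> u = 0.
Proof.
move=> Mu_lin Mu_sep hu; apply: tcoef_inj => k m; rewrite (lin0 (tcoefP M k m)).
apply: Mu_sep => mu hmu; have mul := Mu_lin _ hmu.
have [chi [c c0 [hchi chiE]]] := fwords_coef C m.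
have chil : islinear (chi : cpoly C -> C^o) by split=> a f g; exact: fwords_lin.
have e : (ctr k mu chi : tensF M -> C^o) =1 (fun u => c *: (mu (tcoef u k m) : C^o)).
  apply: tensor_ext_eq => [||k' x f].
  - exact: ctr_lin.
  - split=> a w w'; have -> : mu (tcoef (a *: w + w') k m) = a * mu (tcoef w k m) + mu (tcoef w' k m).
      apply: etrans (congr1 mu (islinearP (tcoefP M k m) a w w')) _; exact: (islinearP mul).
    by rewrite scalerDr; congr (_ + _); rewrite /GRing.scale /= mulrCA.
  apply: etrans (ctr_in mul chil _ _ _ _) _; rewrite tcoef_in eq_sym; case: eqP => _.
    rewrite chiE; have -> : mu (f@_m *: x) = f@_m * mu x := linZ mul _ _.
    by rewrite /GRing.scale /= mulrCA [mu x * _]mulrC.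
  by have -> : mu 0 = 0 := lin0 mul; rewrite scaler0.
have /eqP := hu k _ _ hmu hchi; rewrite e /GRing.scale /= mulf_eq0 (negPf c0) => /eqP.
exact.
Qed.

Variables (c hw : C) (L : int -> {linear M -> M}) (v : M) (phi : M -> C) (gam : int -> C).
Hypothesis irr : irreducible_hw_module c hw L v.
Hypothesis phiP : forall a x y, phi (a *: x + y) = a * phi x + phi y.
Hypothesis phiv : phi v = 1.
Hypothesis phi_neg : forall n x, 0 < n -> phi (L (- n) x) = 0.

Let phi_lin : islinear (phi : M -> C^o). Proof. by split. Qed.
Let vac_lin : islinear (@vac C : cpoly C -> C^o).
Proof. by split=> a f g; exact: vacP. Qed.
Let words_islin mu : words L phi mu -> islinear (mu : M -> C^o).
Proof. by move=> hmu; split=> a x y; exact: words_lin phiP _ hmu _ _ _. Qed.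
Let fwords_islin chi : fwords chi -> islinear (chi : cpoly C -> C^o).
Proof. by move=> hchi; split=> a x y; exact: fwords_lin. Qed.

Lemma ctr_hop k mu chi n : islinear (mu : M -> C^o) -> islinear (chi : cpoly C -> C^o) ->
  ctr k mu chi \o hop gam n =1 ctr k mu (fun f => chi (fmode (gam k) n f)).
Proof.
move=> hmu hchi.
have hchi' := lin_comp (fmode_lin (gam k) n) hchi.
apply: (tensor_ext_eq (W := C^o)) => [||k' x f].
- exact: (lin_comp (hop_lin _ gam n) (ctr_lin _ hmu k)).
- exact: ctr_lin.
apply: etrans (congr1 (ctr k mu chi) (hop_in gam n k' x f)) _.
apply: etrans (ctr_in hmu hchi _ _ _ _) _; apply/esym.
apply: etrans (ctr_in hmu hchi' _ _ _ _) _.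
by case: (eqVneq k k') => [->|_]; reflexivity.
Qed.

Lemma ctr_lop k mu chi n : islinear (mu : M -> C^o) -> islinear (chi : cpoly C -> C^o) ->
  ctr k mu chi \o lop L n =1 ctr k (fun x => mu (L n x)) chi.
Proof.
move=> hmu hchi.
have hmu' := lin_comp (lin_linear (L n)) hmu.
apply: (tensor_ext_eq (W := C^o)) => [||k' x f].
- exact: (lin_comp (lop_lin L n) (ctr_lin _ hmu k)).
- exact: ctr_lin.
apply: etrans (congr1 (ctr k mu chi) (lop_in L n k' x f)) _.
apply: etrans (ctr_in hmu hchi _ _ _ _) _; apply/esym.
exact: (ctr_in hmu' hchi).
Qed.

Lemma ctr_sop k mu m : islinear (mu : M -> C^o) -> forall u,
  ctr k mu (@vac C) (sop gam m u) = 2%:R^-1 * \sum_(j < m)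
     ctr k mu (@vac C) (hop gam j%:Z (hop gam (m - j.+1)%N%:Z u)).
Proof.
move=> hmu u; rewrite mulr_sumr.
pose F1 w : C^o := ctr k mu (@vac C) (sop gam m w).
pose F2 w : C^o := \sum_(j < m) 2%:R^-1 *
  ctr k mu (@vac C) (hop gam j%:Z (hop gam (m - j.+1)%N%:Z w)).
suff e : F1 =1 F2 by exact: (e u).
apply: tensor_ext_eq => [||k' x f].
- exact: (lin_comp (sop_lin M gam m) (ctr_lin _ hmu k)).
- apply: lin_bigsum => j.
  have hG : islinear ((fun u => 2%:R^-1 * ctr k mu (@vac C) u) : tensF M -> C^o).
    split=> a w w'; have -> := islinearP (ctr_lin (@vac C) hmu k) a w w'.
    by rewrite mulrDr; congr (_ + _); rewrite /GRing.scale /= mulrCA.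
  exact (lin_comp (lin_comp (hop_lin M gam _) (hop_lin M gam _)) hG).
have E w : ctr k mu (@vac C) (tensF_in k' x w) = if k == k' then mu x * vac w else 0.
  exact: ctr_in.
have EH j i : ctr k mu (@vac C) (hop gam j (hop gam i (tensF_in k' x f))) =
    if k == k' then mu x * vac (fmode (gam k') j (fmode (gam k') i f)) else 0.
  apply: etrans (congr1 (fun w => ctr k mu (@vac C) (hop gam j w)) (hop_in gam i k' x f)) _.
  apply: etrans (congr1 (ctr k mu (@vac C)) (hop_in gam j k' x _)) _; exact: E.
apply: etrans (congr1 (ctr k mu (@vac C)) (sop_in gam m k' x f)) _; apply: etrans (E _) _.
transitivity (\sum_(j < m) 2%:R^-1 * (if k == k' then mu x *
    vac (fmode (gam k') j%:Z (fmode (gam k') (m - j.+1)%N%:Z f)) else 0)); last first.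
  by apply: eq_bigr => j _; rewrite EH.
case: (k == k'); last by rewrite big1 // => j _; rewrite mulr0.
have dist (a b : C) (G : 'I_m -> C) : a * (b * \sum_j G j) = \sum_j b * (a * G j).
  by rewrite mulrCA !mulr_sumr.
exact: (etrans (congr1 _ (vac_sug _ _ _)) (dist _ _ _)).
Qed.

Local Notation H := (fun n : nat => hop gam n%:Z).
Local Notation T := (top L gam).

(** L_n on the first factor is the total T_(n + 1) minus the Sugawara operator, and the
   latter acts on the vacuum functional through Heisenberg modes. So the total
   operators generate the same functionals as those of the two factors. *)
Lemma ctr_gen k mu chi : words L phi mu -> fwords chi ->
  generated H T (ctr k phi (@vac C)) (ctr k mu chi).
Proof.
move=> hmu; elim=> [|{}chi n hchi IH].
  elim: hmu => [|{}mu n n0 hmu IH]; first exact: gen_base.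
  pose m := (absz n).+1; have nm : n = m%:Z - 1 by rewrite /m; lia.
  have hmul := words_islin hmu.
  have hsum := gen_sum (fun j : 'I_m => gen_H (m - j.+1) (gen_H j IH)).
  have := gen_lin (- 2%:R^-1) hsum (gen_T m IH); congr generated; apply/funext => u.
  have e1 : ctr k mu (@vac C) (T m u) = ctr k mu (@vac C) (lop L n u) + ctr k mu (@vac C) (sop gam m u).
    by rewrite /top -nm; exact: (linD (ctr_lin _ hmul k)).
  have alg (b S t l z : C) : t = l + z -> z = b * S -> - b * S + t = l.
    by move=> -> ->; rewrite addrCA mulNr addNr addr0.
  exact: (etrans (alg _ _ _ _ _ e1 (ctr_sop k m hmul u)) (ctr_lop k n hmul vac_lin u)).
have hchil := fwords_islin hchi.
have := gen_H n.+1 IH; congr generated; apply/funext => u.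
apply: etrans (ctr_hop k n.+1%:Z (words_islin hmu) hchil u) _.
by congr ctr; apply/funext => f; rewrite fmodeS.
Qed.

(** Irreducibility of M, carried over to its tensor product with the Fock space. *)
Lemma sector_separate u :
  (forall k p, generated H T (ctr k phi (@vac C)) p -> p u = 0) -> u = 0.
Proof.
move=> hu; apply: (ctr_separate (Mu := words L phi)) => [|x|k mu chi hmu hchi].
- exact: words_islin.
- by have [virL hwL irrL] := irr; apply: (words_separate virL hwL irrL phiP phiv phi_neg).
- exact: hu (ctr_gen k hmu hchi).
Qed.

End Functionals.

(** * The vacuum functional of a sector *)

Section VacuumFunctional.
Variables (C : numClosedFieldType) (M : lmodType C) (c hw : C).
Variables (L : int -> {linear M -> M}) (v : M) (phi : M -> C) (gam : int -> C).
Hypothesis irr : irreducible_hw_module c hw L v.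
Hypothesis phiP : forall a x y, phi (a *: x + y) = a * phi x + phi y.
Hypothesis phiv : phi v = 1.
Hypothesis phi_neg : forall n x, 0 < n -> phi (L (- n) x) = 0.

Local Notation H := (fun n : nat => hop gam n%:Z).
Local Notation T := (top L gam).

Lemma ctr_scale a k mu chi (u : tensF M) : ctr k (fun x => a * mu x) chi u = a * ctr k mu chi u.
Proof.
rewrite /ctr /tensF_ext mulr_sumr; apply: eq_bigr => km _.
by case: ifP => _; rewrite ?mulr0 // mulrA.
Qed.

Lemma ctr_scaler a k mu chi (u : tensF M) : ctr k mu (fun f => a * chi f) u = a * ctr k mu chi u.
Proof.
rewrite /ctr /tensF_ext mulr_sumr; apply: eq_bigr => km _.
by case: ifP => _; rewrite ?mulr0 // mulrCA.
Qed.

Let sum2 (F : nat -> nat -> C) : \sum_(j < 2) F j (2 - j.+1)%N = F 0%N 1%N + F 1%N 0%N.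
Proof. by rewrite !big_ord_recl big_ord0 addr0. Qed.
Let sum3 (F : nat -> nat -> C) :
  \sum_(j < 3) F j (3 - j.+1)%N = F 0%N 2%N + (F 1%N 1%N + F 2%N 0%N).
Proof. by rewrite !big_ord_recl big_ord0 addr0. Qed.

Definition vacuum k : tensF M -> C := ctr k phi (@vac C).

Let vac_lin : islinear (@vac C : cpoly C -> C^o).
Proof. by split=> a f g; exact: vacP. Qed.
Let phi_lin : islinear (phi : M -> C^o). Proof. by split. Qed.

Lemma vacuum_lin k : islinear (vacuum k : tensF M -> C^o).
Proof. exact: (ctr_lin _ phi_lin). Qed.

Lemma vacuum_in k x f : vacuum k (tensF_in k x f) = phi x * vac f.
Proof. by apply: etrans (ctr_in phi_lin vac_lin _ _ _ _) _; rewrite eqxx. Qed.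

Lemma ctr_H0 k mu chi u : islinear (mu : M -> C^o) -> islinear (chi : cpoly C -> C^o) ->
  ctr k mu chi (H 0 u) = gam k * ctr k mu chi u.
Proof.
move=> hmu hchi; apply: etrans (ctr_hop gam k 0 hmu hchi u) _.
rewrite -ctr_scaler; congr (ctr k mu _ u); apply/funext => f.
by rewrite fmode0; exact: (linZ hchi).
Qed.

Lemma vacuum_H0 k u : vacuum k (H 0 u) = gam k * vacuum k u.
Proof. exact: ctr_H0. Qed.

Lemma vacuum_T0 k u : vacuum k (T 0 u) = 0.
Proof.
apply: etrans (linD (vacuum_lin k) _ _) _.
have e : vacuum k (sop gam 0 u) = 0.
  by apply: etrans (ctr_sop gam k 0 phi_lin u) _; rewrite big_ord0 mulr0.
apply: etrans (congr1 (fun z => vacuum k (lop L (0%:Z - 1) u) + z) e) _.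
apply: etrans (addr0 _) _; apply: etrans (ctr_lop L k _ phi_lin vac_lin u) _.
have -> : (fun x => phi (L (0%:Z - 1) x)) = (fun x => 0 * phi x).
  by apply/funext => x; rewrite mul0r sub0r phi_neg.
by rewrite ctr_scale mul0r.
Qed.

Lemma vacuum_T1 k u : vacuum k (T 1 u) = (hw + gam k ^+ 2 / 2%:R) * vacuum k u.
Proof.
apply: etrans (linD (vacuum_lin k) _ _) _.
have e : vacuum k (sop gam 1 u) = gam k ^+ 2 / 2%:R * vacuum k u.
  apply: etrans (ctr_sop gam k 1 phi_lin u) _; rewrite big_ord1.
  by rewrite !(ctr_H0 _ _ phi_lin vac_lin) mulrA mulrA -expr2 [_ * gam k ^+ 2]mulrC.
apply: etrans (congr1 (fun z => vacuum k (lop L (1%:Z - 1) u) + z) e) _.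
rewrite mulrDl; congr (_ + _); apply: etrans (ctr_lop L k _ phi_lin vac_lin u) _.
have [virL hwL irrL] := irr.
have -> : (fun x => phi (L (1%:Z - 1) x)) = (fun x => hw * phi x).
  by apply/funext => x; rewrite subrr (phi_L0 virL hwL irrL).
exact: ctr_scale.
Qed.

Section Null.
Variables (k : int) (kap : C).
Hypothesis kap1 : 3%:R = kap * (4%:R * hw + 2%:R).
Hypothesis kap2 : 4%:R * hw + c / 2%:R = kap * (6%:R * hw).

(* L_1 of the first factor, in terms of the total operators. *)
Let lop1 mu u : islinear (mu : M -> C^o) ->
  ctr k (fun x => mu (L 1 x)) (@vac C) u =
  ctr k mu (@vac C) (T 2 u) - gam k * ctr k mu (@vac C) (H 1%N u).
Proof.
move=> hmu; have hl := ctr_lin (@vac C) hmu k.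
have e : ctr k mu (@vac C) (T 2 u) =
    ctr k mu (@vac C) (lop L 1 u) + ctr k mu (@vac C) (sop gam 2 u) := linD hl _ _.
have e1 := ctr_lop L k 1 hmu vac_lin u.
have e2 := ctr_sop gam k 2 hmu u; have {}e2 := etrans e2 (congr1 _ (sum2 (fun j i => ctr k mu (@vac C) (H j (H i u))))).
have e3 : ctr k mu (@vac C) (H 1%N (H 0%N u)) = gam k * ctr k mu (@vac C) (H 1%N u).
  have hchi := lin_comp (fmode_lin (gam k) 1) vac_lin.
  apply: etrans (ctr_hop gam k 1 hmu vac_lin _) _; apply: etrans (ctr_H0 _ _ hmu hchi) _.
  by congr (_ * _); exact: esym (ctr_hop gam k 1 hmu vac_lin u).
have e4 := ctr_H0 k (H 1%N u) hmu vac_lin.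
have alg (t l s a g : C) : t = l + s -> s = 2%:R^-1 * (g * a + g * a) -> l = t - g * a.
  by move=> -> ->; field.
have e5 := etrans e2 (congr1 (fun z => 2%:R^-1 * z) (congr2 +%R e4 e3)).
exact: etrans (esym e1) (alg _ _ _ _ _ e e5).
Qed.

(** The level two null vector of M, expressed by the total operators: the Sugawara
   operators of modes 1 and 2 act on the vacuum functional as gamma h_1 and as
   gamma h_2 + h_1^2 / 2. *)
Lemma vacuum_null u :
  let Psi w := vacuum k (T 2 w) - gam k * vacuum k (H 1%N w) in
  vacuum k (T 3 u) - gam k * vacuum k (H 2%N u) - vacuum k (H 1%N (H 1%N u)) / 2%:R
  = kap * (Psi (T 2 u) - gam k * Psi (H 1%N u)).
Proof.
move=> Psi.
have hphi1 : islinear ((fun x => phi (L 1 x)) : M -> C^o) := lin_comp (lin_linear (L 1)) phi_lin.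
have PsiE w : Psi w = ctr k (fun x => phi (L 1 x)) (@vac C) w by rewrite lop1.
have hl := vacuum_lin k.
have e : vacuum k (T 3 u) = vacuum k (lop L 2 u) + vacuum k (sop gam 3 u) := linD hl _ _.
have e1 : vacuum k (lop L 2 u) = kap * ctr k (fun x => phi (L 1 (L 1 x))) (@vac C) u.
  apply: etrans (ctr_lop L k 2 phi_lin vac_lin u) _; rewrite -ctr_scale; congr (ctr k _ _ u).
  by apply/funext => x; apply: (null_functional irr phiP phi_neg kap1 kap2).
have e2 := ctr_sop gam k 3 phi_lin u; have {}e2 := etrans e2 (congr1 _ (sum3 (fun j i => vacuum k (H j (H i u))))).
have e3 : vacuum k (H 2%N (H 0%N u)) = gam k * vacuum k (H 2%N u).
  have hchi := lin_comp (fmode_lin (gam k) 2) vac_lin.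
  apply: etrans (ctr_hop gam k 2 phi_lin vac_lin _) _; apply: etrans (ctr_H0 _ _ phi_lin hchi) _.
  by congr (_ * _); exact: esym (ctr_hop gam k 2 phi_lin vac_lin u).
have e4 := vacuum_H0 k (H 2%N u).
have e6 := etrans (congr2 (fun x y => x - gam k * y) (PsiE (T 2 u)) (PsiE (H 1%N u)))
  (esym (lop1 u hphi1)).
apply: etrans _ (congr1 (fun z => kap * z) (esym e6)); apply: etrans _ e1.
have alg (t l s x y g : C) : t = l + s -> s = 2%:R^-1 * (g * x + (y + g * x)) ->
    t - g * x - y / 2%:R = l by move=> -> ->; field.
have e5 := etrans e2 (congr1 (fun z => 2%:R^-1 * z) (congr2 +%R e4 (congr1 (+%R _) e3))).
exact: alg e e5.
Qed.
End Null.

End VacuumFunctional.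

(** * Arrays of correlation coefficients *)

Section Arrays.
Variable C : numClosedFieldType.
Implicit Types d : int -> int -> int -> C.

(** Multiplication by the n-th power sum and the derivation EE m, on coefficients. *)
Definition Pa (n : int) d (i j k : int) : C := d (i - n) j k + d i (j - n) k + d i j (k - n).
Definition Ea (m : int) d (i j k : int) : C :=
  (i - m + 1)%:~R * d (i - m + 1) j k + (j - m + 1)%:~R * d i (j - m + 1) k
  + (k - m + 1)%:~R * d i j (k - m + 1).

(** The translation equation determines an array from its terms without z, and there
   the null equation is a recurrence whose leading coefficient j (2 N + 1 - 3 j)
   vanishes for j = 0 only. *)
Lemma array_unique (N : nat) d : (N %% 3 != 1)%N ->
  (forall i j k, j < 0 -> d i j k = 0) -> (forall i j k, k < 0 -> d i j k = 0) ->
  (forall i j k, i + j + k != N%:Z -> d i j k = 0) ->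
  (forall i j k, Ea 0 d i j k = 0) ->
  (forall i j k, N.+2%:R * (4%:R * Ea 3 d i j k - N%:R * Pa 1 (Pa 1 d) i j k) =
     3%:R * (4%:R * Ea 2 (Ea 2 d) i j k - 2%:R * N%:R * Ea 2 (Pa 1 d) i j k
        - 2%:R * N%:R * Pa 1 (Ea 2 d) i j k + N%:R ^+ 2 * Pa 1 (Pa 1 d) i j k)) ->
  d N%:Z 0 0 = 0 -> forall i j k, d i j k = 0.
Proof.
move=> N3 dj dk dN dT dnull d00.
have plane (n : nat) i : d i n%:Z 0 = 0.
  elim/ltn_ind: n i => n IH i.
  have [iN|] := eqVneq (i + n%:Z + 0) N%:Z; last exact: dN.
  case: n IH iN => [|n] IH iN; first by have -> : i = N%:Z by lia.
  pose j := n.+1%:Z; have := dnull (i + 2) j 0.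
  have low l i' : (l < n.+1%:Z)%R -> d i' l 0 = 0.
    by case: l => l hl; [apply: IH; lia|apply: dj; lia].
  have z1 i' l : d i' l (0 - 1) = 0 by exact: dk.
  have z2 i' l : d i' l (0 - 1 - 1) = 0 by exact: dk.
  have z2' i' l : d i' l (0 - 2 + 1) = 0 by exact: dk.
  have z3 i' l : d i' l (0 - 2 + 1 - 2 + 1) = 0 by exact: dk.
  have z4 i' l : d i' l (0 - 3 + 1) = 0 by exact: dk.
  have z5 i' l : d i' l (0 - 2 + 1 - 1) = 0 by exact: dk.
  have z6 i' l : d i' l (0 - 1 - 2 + 1) = 0 by exact: dk.
  have y1 i' : d i' (j - 1) 0 = 0 by apply: low; rewrite /j; lia.
  have y2 i' : d i' (j - 1 - 1) 0 = 0 by apply: low; rewrite /j; lia.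
  have y2' i' : d i' (j - 2 + 1) 0 = 0 by apply: low; rewrite /j; lia.
  have y3 i' : d i' (j - 2 + 1 - 2 + 1) 0 = 0 by apply: low; rewrite /j; lia.
  have y4 i' : d i' (j - 3 + 1) 0 = 0 by apply: low; rewrite /j; lia.
  have y5 i' : d i' (j - 2 + 1 - 1) 0 = 0 by apply: low; rewrite /j; lia.
  have y6 i' : d i' (j - 1 - 2 + 1) 0 = 0 by apply: low; rewrite /j; lia.
  have x1 : i + 2 - 3 + 1 = i by lia.
  have x2 : i + 2 - 2 + 1 - 2 + 1 = i by lia.
  have x3 : i + 2 - 1 - 1 = i by lia.
  have x4 : i + 2 - 2 + 1 - 1 = i by lia.
  have x5 : i + 2 - 1 - 2 + 1 = i by lia.
  have x6 : i + 2 - 2 + 1 = i + 1 by lia.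
  have x7 : i + 1 - 2 + 1 = i by lia.
  have x8 : i + 1 - 1 = i by lia.
  (* Only the terms without z and with the largest power of x survive. *)
  rewrite /Ea /Pa !(z1, z2, z2', z3, z4, z5, z6) !(y1, y2, y2', y3, y4, y5, y6).
  rewrite !(x1, x2, x3, x4, x5, x6, x7, x8) !(mulr0, addr0).
  move/eqP; rewrite -subr_eq0.
  have iE : i%:~R = N%:R - n.+1%:R :> C.
    by have -> : i = N%:Z - n.+1%:Z; [lia|rewrite rmorphB].
  have cE : N.+2%:R * (4%:R * (i%:~R * d i j 0) - N%:R * d i j 0) -
     3%:R * (4%:R * ((i + 1)%:~R * (i%:~R * d i j 0)) - 2%:R * N%:R * ((i + 1)%:~R * d i j 0)
        - 2%:R * N%:R * (i%:~R * d i j 0) + N%:R ^+ 2 * d i j 0)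
     = (4%:Z * n.+1%:Z * (2%:Z * N%:Z + 1 - 3%:Z * n.+1%:Z))%:~R * d i j 0.
    rewrite !(rmorphM, rmorphD, rmorphB) /= iE -[N%:~R]/(N%:R : C) -[n.+1%:~R]/(n.+1%:R : C).
    by rewrite -[N.+2]addn2 natrD; ring.
  move=> h0; have : (4%:Z * n.+1%:Z * (2%:Z * N%:Z + 1 - 3%:Z * n.+1%:Z))%:~R * d i j 0 == 0.
    by rewrite -cE.
  rewrite mulf_eq0 intr_eq0 => /orP[|/eqP //].
  by rewrite !mulf_eq0 => h; exfalso; lia.
have all (n : nat) i j : d i j n%:Z = 0.
  elim: n i j => [|n IH] i j; first by case: j => j; [exact: plane|exact: dj].
  have := dT i j n%:Z; rewrite /Ea !subr0 !IH !mulr0 !add0r.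
  have -> : n%:Z + 1 = n.+1%:Z by lia.
  by move/eqP; rewrite mulf_eq0 intr_eq0 => /orP[|/eqP].
by move=> i j; case=> k; [exact: all|exact: dk].
Qed.

Lemma Pa_lin n a d d' : Pa n (fun i j k => a * d i j k + d' i j k) =
  fun i j k => a * Pa n d i j k + Pa n d' i j k.
Proof. by do 3!apply/funext => ?; rewrite /Pa; ring. Qed.

Lemma Ea_lin n a d d' : Ea n (fun i j k => a * d i j k + d' i j k) =
  fun i j k => a * Ea n d i j k + Ea n d' i j k.
Proof. by do 3!apply/funext => ?; rewrite /Ea; ring. Qed.

End Arrays.

(** * Correlation functions of two and three currents *)

Section Correlators.
Variables (C : numClosedFieldType) (A B : lmodType C).
Local Notation V := (A * B)%type.
Variables (a : int -> V -> V) (H T : nat -> V -> V) (v0 : V) (be : C) (N : nat).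
Hypotheses (a_lin : forall n, islinear (a n)) (H_lin : forall n, islinear (H n)).
Hypothesis T_lin : forall m, islinear (T m).
Hypothesis N_pos : (0 < N)%N.
Hypothesis be2 : be ^+ 2 = N%:R / 2%:R.
Hypothesis H_a : forall (n : nat) j u, H n (a j u) = a j (H n u) + be *: a (j + n%:Z) u.
Hypothesis T_a : forall (m : nat) j u, T m (a j u) = a j (T m u)
  + (- (j + m%:Z)%:~R + m%:R * be ^+ 2) *: a (j + m%:Z - 1) u.
Hypothesis H_v0 : forall n, H n v0 = 0.
Hypothesis T_v0 : forall m, T m v0 = 0.
Hypothesis a_v0 : forall j, 0 <= j -> a j v0 = 0.
Hypothesis a_even : forall j u, u.2 = 0 -> (a j u).1 = 0.
Hypothesis a_odd : forall j u, u.1 = 0 -> (a j u).2 = 0.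
Hypothesis v0_even : v0.2 = 0.
(** The vacuum functionals of the sectors V_(2 k) and V_(2 k + 1). *)
Variables bE bO : int -> V -> C.
Hypothesis bE_lin : forall k, islinear (bE k : V -> C^o).
Hypothesis bO_lin : forall k, islinear (bO k : V -> C^o).
Hypothesis bE_H0 : forall k u, bE k (H 0 u) = (2 * k)%:~R * be * bE k u.
Hypothesis bO_H0 : forall k u, bO k (H 0 u) = (2 * k + 1)%:~R * be * bO k u.
Hypothesis bE_T0 : forall k u, bE k (T 0 u) = 0.
Hypothesis bO_T0 : forall k u, bO k (T 0 u) = 0.
Hypothesis bE_T1 : forall k u, bE k (T 1 u) = ((2 * k)%:~R * be) ^+ 2 / 2%:R * bE k u.
Hypothesis bO_T1 : forall k u, bO k (T 1 u) =
  (N%:R / 4%:R + ((2 * k + 1)%:~R * be) ^+ 2 / 2%:R) * bO k u.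
Hypothesis sepE : forall u : V, u.2 = 0 -> (forall k p, generated H T (bE k) p -> p u = 0) -> u = 0.
Hypothesis sepO : forall u : V, u.1 = 0 -> (forall k p, generated H T (bO k) p -> p u = 0) -> u = 0.

Let be_neq0 : be != 0.
Proof.
apply/eqP => b0; move: be2; rewrite b0 expr0n /= => /esym/eqP.
by rewrite mulf_eq0 invr_eq0 !pnatr_eq0 /= orbF => /eqP; lia.
Qed.

(** Modes are numbered so that a_(-i-1) is the coefficient of z^i: the arrays below
   are then coefficients of power series. *)
Definition cre1 (i : int) := a (- i - 1).
Definition cre2 i j := cre1 i (cre1 j v0).
Definition cre3 i j k := cre1 i (cre1 j (cre1 k v0)).

Let cre1_lin i : islinear (cre1 i). Proof. exact: a_lin. Qed.

Lemma H_cre n i u : H n (cre1 i u) = cre1 i (H n u) + be *: cre1 (i - n%:Z) u.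
Proof. by rewrite /cre1 H_a; congr (_ + _ *: a _ _); lia. Qed.

Let cT (m : nat) (i : int) : C := (i - m%:Z + 1)%:~R + m%:R * be ^+ 2.

Let cT0 l : cT 0 l = (l + 1)%:~R.
Proof. by rewrite /cT mul0r addr0 subr0. Qed.

Lemma T_cre m i u : T m (cre1 i u) = cre1 i (T m u) + cT m i *: cre1 (i - m%:Z + 1) u.
Proof.
rewrite /cre1 T_a; congr (_ + _ *: a _ _); last by lia.
by rewrite /cT -rmorphN; congr (_%:~R + _); lia.
Qed.

Lemma H_cre2 n i j : H n (cre2 i j) = be *: cre2 i (j - n%:Z) + be *: cre2 (i - n%:Z) j.
Proof.
by rewrite /cre2 !H_cre H_v0 (lin0 (cre1_lin j)) add0r (linZ (cre1_lin i)).
Qed.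

Lemma T_cre2 m i j : T m (cre2 i j) =
  cT m j *: cre2 i (j - m%:Z + 1) + cT m i *: cre2 (i - m%:Z + 1) j.
Proof.
by rewrite /cre2 !T_cre T_v0 (lin0 (cre1_lin j)) add0r (linZ (cre1_lin i)).
Qed.

Lemma H_cre3 n i j k : H n (cre3 i j k) =
  be *: cre3 i j (k - n%:Z) + be *: cre3 i (j - n%:Z) k + be *: cre3 (i - n%:Z) j k.
Proof.
by rewrite {1}/cre3 H_cre H_cre2 (linD (cre1_lin i)) !(linZ (cre1_lin i)).
Qed.

Lemma T_cre3 m i j k : T m (cre3 i j k) = cT m k *: cre3 i j (k - m%:Z + 1)
  + cT m j *: cre3 i (j - m%:Z + 1) k + cT m i *: cre3 (i - m%:Z + 1) j k.
Proof.
by rewrite {1}/cre3 T_cre T_cre2 (linD (cre1_lin i)) !(linZ (cre1_lin i)).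
Qed.

Section Functional.
Variable p : V -> C.
Hypothesis p_lin : islinear (p : V -> C^o).
Lemma funD u w : p (u + w) = p u + p w. Proof. exact: (linD p_lin). Qed.
Lemma funZ c u : p (c *: u) = c * p u. Proof. exact: (linZ p_lin). Qed.
Lemma fun0 : p 0 = 0. Proof. exact: (lin0 p_lin). Qed.
End Functional.

Lemma cre2_neg j l : l < 0 -> cre2 j l = 0.
Proof.
by move=> l0; rewrite /cre2 [cre1 l v0]a_v0 ?(lin0 (cre1_lin j)) //; lia.
Qed.

(** The mode h_0 acts on the product of r currents as r beta, and on the k-th functional
   as the charge of its sector. *)
Lemma bE_charge k j l : k != 1 -> bE k (cre2 j l) = 0.
Proof.
move=> k1; have := bE_H0 k (cre2 j l).
rewrite H_cre2 !subr0 -scalerDl (funZ (bE_lin k)) => /eqP.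
rewrite -subr_eq0 -mulrBl mulf_eq0 => /orP[|/eqP //].
have -> : be + be - (2 * k)%:~R * be = (2 * (1 - k))%:~R * be.
  by rewrite !rmorphM rmorphB /=; ring.
by rewrite mulf_eq0 (negPf be_neq0) orbF intr_eq0; lia.
Qed.

Lemma bO_charge k i j l : k != 1 -> bO k (cre3 i j l) = 0.
Proof.
move=> k1; have := bO_H0 k (cre3 i j l).
rewrite H_cre3 !subr0 -!scalerDl (funZ (bO_lin k)) => /eqP.
rewrite -subr_eq0 -mulrBl mulf_eq0 => /orP[|/eqP //].
have -> : be + be + be - (2 * k + 1)%:~R * be = (2 * (1 - k))%:~R * be.
  by rewrite rmorphD !rmorphM rmorphB /=; ring.
by rewrite mulf_eq0 (negPf be_neq0) orbF intr_eq0; lia.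
Qed.

(** Translation and scale invariance force the vacuum coefficient of a_m a_n v0
   to vanish for m >= 0. *)
Lemma bE_cre2 k j l : j < 0 -> bE k (cre2 j l) = 0.
Proof.
move=> j0; have [->|k1] := eqVneq k 1; last exact: bE_charge.
have linE := bE_lin 1.
have [|jl] := eqVneq (j + l) 0; last first.
  have := bE_T1 1 (cre2 j l); rewrite T_cre2 !subrK (funD linE) !(funZ linE) -mulrDl => /eqP.
  rewrite -subr_eq0 -mulrBl mulf_eq0 => /orP[|/eqP //].
  have -> : cT 1 l + cT 1 j - ((2 * 1)%:~R * be) ^+ 2 / 2%:R = (j + l)%:~R.
    rewrite /cT !subrK mulr1 exprMn rmorphD /=; have : (2%:R : C) != 0 by rewrite pnatr_eq0.
    by move: (be ^+ 2) => b h2; field.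
  by rewrite intr_eq0 (negPf jl).
have claim (n : nat) : bE 1 (cre2 (- n.+1%:Z) n.+1%:Z) = 0.
  elim: n => [|n IH].
    have := bE_T0 1 (cre2 (-1) 0); rewrite T_cre2 (funD linE) !(funZ linE) !subr0.
    have -> : cT 0 (-1) = 0 by rewrite cT0.
    have -> : cT 0 0 = 1 by rewrite cT0.
    by rewrite mul0r addr0 mul1r.
  have := bE_T0 1 (cre2 (- n.+2%:Z) n.+1%:Z); rewrite T_cre2 (funD linE) !(funZ linE) !subr0.
  have -> : - n.+2%:Z + 1 = - n.+1%:Z by lia.
  rewrite IH mulr0 addr0 cT0; have -> : n.+1%:Z + 1 = n.+2%:Z by lia.
  by move/eqP; rewrite mulf_eq0 intr_eq0 => /eqP.
move=> jl; have := claim (absz j).-1; congr (bE _ (cre2 _ _) = _); lia.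
Qed.

Lemma gen_linE k p : generated H T (bE k) p -> islinear (p : V -> C^o).
Proof. by apply: gen_islinear. Qed.
Lemma gen_linO k p : generated H T (bO k) p -> islinear (p : V -> C^o).
Proof. by apply: gen_islinear. Qed.

(** The vanishing of the vacuum coefficient passes to all generated functionals,
   which separate points. *)
Theorem cre2_eq0 j l : j < 0 -> cre2 j l = 0.
Proof.
move=> j0; apply: sepE => [|k p hp].
  have e : (cre1 l v0).1 = 0 := a_even _ v0_even.
  exact: (a_odd _ e).
elim: hp j l j0 => [|c q r _ hq _ hr|n q hq IH|m q hq IH] j l j0.
- exact: bE_cre2.
- by rewrite hq // hr // mulr0 addr0.
- have lq := gen_linE hq; rewrite H_cre2 (funD lq) !(funZ lq) !IH ?mulr0 ?addr0 //; lia.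
- have [->|m0] := posnP m.
    have lq := gen_linE hq; rewrite T_cre2 (funD lq) !(funZ lq) IH // mulr0 add0r !subr0.
    have [->|j1] := eqVneq j (-1); first by rewrite cT0 mul0r.
    by rewrite IH ?mulr0 //; lia.
  have lq := gen_linE hq; rewrite T_cre2 (funD lq) !(funZ lq) !IH ?mulr0 ?addr0 //; lia.
Qed.

Definition arr (p : V -> C) i j k := p (cre3 i j k).

Lemma arr_H p n : islinear (p : V -> C^o) ->
  arr (fun u => p (H n u)) = fun i j k => be * Pa n%:Z (arr p) i j k.
Proof.
move=> pl; do 3!apply/funext => ?.
by rewrite /arr H_cre3 !(funD pl) !(funZ pl) /Pa; ring.
Qed.

(** T_(m - 1) acts on arrays as the vector field E_m, up to the weight beta^2 of the
   current. *)
Lemma arr_T p m : islinear (p : V -> C^o) -> arr (fun u => p (T m u)) =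
  fun i j k => m%:R * be ^+ 2 * Pa (m%:Z - 1) (arr p) i j k + Ea m%:Z (arr p) i j k.
Proof.
move=> pl; apply/funext => i; apply/funext => j; apply/funext => k.
rewrite /arr T_cre3 !(funD pl) !(funZ pl) /Pa /Ea /cT.
have e l : l - (m%:Z - 1) = l - m%:Z + 1 :> int by lia.
by rewrite !e; ring.
Qed.

(** The functional phi o L_1, in terms of the total operators. *)
Let Psi u := bO 1 (T 2 u) - 3%:R * be * bO 1 (H 1 u).
Hypothesis bO_null : forall u,
  bO 1 (T 3 u) - 3%:R * be * bO 1 (H 2 u) - bO 1 (H 1 (H 1 u)) / 2%:R
  = 3%:R / N.+2%:R * (Psi (T 2 u) - 3%:R * be * Psi (H 1 u)).
Hypothesis bO_norm : bO 1 (cre3 N%:Z 0 0) = 1.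

Let g := arr (bO 1).

Lemma g_neg1 i j k : j < 0 -> g i j k = 0.
Proof.
move=> j0; rewrite /g /arr /cre3 -/(cre2 j k) cre2_eq0 // (lin0 (cre1_lin i)).
exact: fun0 (bO_lin 1).
Qed.

Lemma g_neg2 i j k : k < 0 -> g i j k = 0.
Proof.
move=> k0; rewrite /g /arr /cre3 -/(cre2 j k) cre2_neg // (lin0 (cre1_lin i)).
exact: fun0 (bO_lin 1).
Qed.

Lemma g_degree i j k : i + j + k != N%:Z -> g i j k = 0.
Proof.
move=> ne; have e := bO_T1 1 (cre3 i j k); have h3 : (2 * 1 + 1)%:~R = 3%:R :> C by [].
rewrite h3 in e.
have := congr1 (fun F => F i j k) (arr_T 1 (bO_lin 1)); rewrite {1}/arr e.
rewrite /Pa /Ea !subr0 !subrK -/g [bO 1 _]/(g i j k) exprMn be2 => /eqP.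
rewrite -subr_eq0; set x := (X in X == 0).
have -> : x = (N%:Z - (i + j + k))%:~R * g i j k.
  rewrite /x !(rmorphB, rmorphD) /= -[N%:~R]/(N%:R : C) /=.
  by rewrite -[arr (bO 1) i j k]/(g i j k); field.
by rewrite mulf_eq0 intr_eq0 subr_eq0 eq_sym (negPf ne) => /eqP.
Qed.

Lemma g_translation i j k : Ea 0 g i j k = 0.
Proof.
have := congr1 (fun F => F i j k) (arr_T 0 (bO_lin 1)); rewrite {1}/arr bO_T0.
by rewrite !mul0r add0r => <-.
Qed.

(** The level two null vector. In terms of arrays, L_1 and L_2 of the first tensor
   factor act as E_2 - beta^2 p_1 and as E_3 - (beta^2 / 2) p_1^2, where
   beta^2 = N / 2. *)
Lemma g_null i j k : N.+2%:R * (4%:R * Ea 3 g i j k - N%:R * Pa 1 (Pa 1 g) i j k) =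
     3%:R * (4%:R * Ea 2 (Ea 2 g) i j k - 2%:R * N%:R * Ea 2 (Pa 1 g) i j k
        - 2%:R * N%:R * Pa 1 (Ea 2 g) i j k + N%:R ^+ 2 * Pa 1 (Pa 1 g) i j k).
Proof.
have l1 := bO_lin 1.
have bH n := gen_linO (gen_H n (gen_base H T (bO 1))).
have bT m := gen_linO (gen_T m (gen_base H T (bO 1))).
have T3 : arr (fun u => bO 1 (T 3 u)) i j k = 3%:R * be ^+ 2 * Pa 2 g i j k + Ea 3 g i j k.
  by rewrite arr_T.
have H2 : arr (fun u => bO 1 (H 2 u)) i j k = be * Pa 2 g i j k by rewrite arr_H.
have H11 : arr (fun u => bO 1 (H 1 (H 1 u))) i j k = be ^+ 2 * Pa 1 (Pa 1 g) i j k.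
  by rewrite (arr_H 1 (bH 1%N)) (arr_H 1 l1) -/g /Pa; ring.
have T22 : arr (fun u => bO 1 (T 2 (T 2 u))) i j k =
   2%:R * be ^+ 2 * (2%:R * be ^+ 2 * Pa 1 (Pa 1 g) i j k + Pa 1 (Ea 2 g) i j k)
   + (2%:R * be ^+ 2 * Ea 2 (Pa 1 g) i j k + Ea 2 (Ea 2 g) i j k).
  by rewrite (arr_T 2 (bT 2%N)) (arr_T 2 l1) -/g Pa_lin Ea_lin.
have T2H1 : arr (fun u => bO 1 (H 1 (T 2 u))) i j k =
   be * (2%:R * be ^+ 2 * Pa 1 (Pa 1 g) i j k + Ea 2 (Pa 1 g) i j k).
  by rewrite (arr_T 2 (bH 1%N)) (arr_H 1 l1) -/g /Pa /Ea; ring.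
have H1T2 : arr (fun u => bO 1 (T 2 (H 1 u))) i j k =
   be * (2%:R * be ^+ 2 * Pa 1 (Pa 1 g) i j k + Pa 1 (Ea 2 g) i j k).
  by rewrite (arr_H 1 (bT 2%N)) (arr_T 2 l1) -/g Pa_lin.
have := bO_null (cre3 i j k); rewrite /Psi.
move: T3 H2 H11 T22 T2H1 H1T2; rewrite /arr => -> -> -> -> -> ->.
move: (Ea 3 g i j k) (Pa 1 (Pa 1 g) i j k) (Ea 2 (Ea 2 g) i j k) (Ea 2 (Pa 1 g) i j k)
  (Pa 1 (Ea 2 g) i j k) (Pa 2 g i j k) => x1 x2 x3 x4 x5 x6 e.
have N0 : N.+2%:R != 0 :> C by rewrite pnatr_eq0.
have e' : N.+2%:R * (x1 - be ^+ 2 / 2%:R * x2) =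
    3%:R * (x3 - be ^+ 2 * x4 - be ^+ 2 * x5 + (be ^+ 2) ^+ 2 * x2).
  have el : x1 - be ^+ 2 / 2%:R * x2 = 3%:R / N.+2%:R *
      (x3 - be ^+ 2 * x4 - be ^+ 2 * x5 + (be ^+ 2) ^+ 2 * x2).
    by move: (3%:R / N.+2%:R) e => q e; apply: etrans _ (etrans e _); field.
  by rewrite el mulrA mulrCA mulfV // mulr1.
have -> : 4%:R * x1 - N%:R * x2 = 4%:R * (x1 - be ^+ 2 / 2%:R * x2) by rewrite be2; field.
by rewrite mulrCA e' be2; field.
Qed.

Variables (K : polynomials3 C) (f : {poly C}).
Hypothesis f_gr : graded 0 N f.
Hypothesis f_eq : th (N%:Z + 1) (th N f) = (4 * N * N.+1)%:R * f.
Hypothesis f_cusp : f.[2%:R] != 0.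
Hypothesis N3 : (N %% 3 != 1)%N.
Local Notation kc := (kc K).
Local Notation sol := (sol K N f).
Local Notation dsol := (dsol K N f).

Let cf_Pa n (F : K) : cf (pp K n * F) = Pa n%:Z (cf F).
Proof. by do 3!apply/funext => ?; exact: cf_pp. Qed.

Let cf_Ea m (F : K) : cf (EE m F) = Ea m%:Z (cf F).
Proof. by do 3!apply/funext => ?; exact: cf_EE. Qed.

Let cf_lin c (F G : K) : cf (kc c * F + G) = fun i j k => c * cf F i j k + cf G i j k.
Proof. by do 3!apply/funext => ?; rewrite cfD cfZ. Qed.

Let sol_null_cf i j k : N.+2%:R * (4%:R * Ea 3 (cf sol) i j k - N%:R * Pa 1 (Pa 1 (cf sol)) i j k) =
     3%:R * (4%:R * Ea 2 (Ea 2 (cf sol)) i j k - 2%:R * N%:R * Ea 2 (Pa 1 (cf sol)) i j k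
        - 2%:R * N%:R * Pa 1 (Ea 2 (cf sol)) i j k + N%:R ^+ 2 * Pa 1 (Pa 1 (cf sol)) i j k).
Proof.
have e := congr1 (fun F => cf F i j k) (sol_null K f_gr f_eq).
have {}e : cf (N.+2%:R * (4%:R * EE 3 sol - N%:R * (pp K 1 * (pp K 1 * sol)))) i j k =
   cf (3%:R * (4%:R * EE 2 (EE 2 sol) - (2 * N)%:R * EE 2 (pp K 1 * sol)
     - (2 * N)%:R * (pp K 1 * EE 2 sol) + (N ^ 2)%:R * (pp K 1 * (pp K 1 * sol)))) i j k.
  apply: etrans (etrans _ (esym e)) _; congr (cf _ i j k); first by ring.
  have -> : EE 2 (N%:R * pp K 1 * sol) = N%:R * EE 2 (pp K 1 * sol).
    by rewrite -mulrA EEM EEn mul0r add0r.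
  by rewrite natrM natrX; ring.
have eL (X Y : K) : cf (N.+2%:R * (4%:R * X - N%:R * Y)) i j k =
    N.+2%:R * (4%:R * cf X i j k - N%:R * cf Y i j k) by rewrite !(cf_nat, cfB).
have eR (X Y Z W : K) : cf (3%:R * (4%:R * X - (2 * N)%:R * Y - (2 * N)%:R * Z + (N ^ 2)%:R * W)) i j k
    = 3%:R * (4%:R * cf X i j k - 2%:R * N%:R * cf Y i j k - 2%:R * N%:R * cf Z i j k
              + N%:R ^+ 2 * cf W i j k) by rewrite !(cf_nat, cfB, cfD) natrM natrX.
by move: e; rewrite eL eR !(cf_Ea, cf_Pa).
Qed.

(** Both sides solve the equations that determine an array up to a factor. *)
Lemma g_sol : g = fun i j k => f.[2%:R]^-1 * cf sol i j k.
Proof.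
set c := f.[2%:R]^-1.
pose d i j k := (- c) * cf sol i j k + g i j k.
have solneg i j k : ~~ [&& 0 <= i, 0 <= j & 0 <= k] -> cf sol i j k = 0.
  by move=> h; apply/eqP; apply: contraNT h => /cf_neg.
have soldeg i j k : i + j + k != N%:Z -> cf sol i j k = 0.
  by move=> h; apply/eqP; apply: contraNT h => /(cf_homogeneous (EE1_sol K f_gr)) ->.
have d0 : forall i j k, d i j k = 0.
  apply: (array_unique N3) => [i j k j0|i j k k0|i j k ne|i j k|i j k|].
  - by rewrite /d g_neg1 // solneg ?mulr0 ?addr0 //; lia.
  - by rewrite /d g_neg2 // solneg ?mulr0 ?addr0 //; lia.
  - by rewrite /d g_degree // soldeg ?mulr0 ?addr0.
  - have e := congr1 (fun G => G i j k) (cf_Ea 0 sol).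
    by rewrite Ea_lin g_translation addr0 -e (EE0_sol K N f) cf0 mulr0.
  - have E3 : Ea 3 d = fun i j k => (- c) * Ea 3 (cf sol) i j k + Ea 3 g i j k by exact: Ea_lin.
    have E2 : Ea 2 d = fun i j k => (- c) * Ea 2 (cf sol) i j k + Ea 2 g i j k by exact: Ea_lin.
    have P1 : Pa 1 d = fun i j k => (- c) * Pa 1 (cf sol) i j k + Pa 1 g i j k by exact: Pa_lin.
    rewrite E3 E2 P1 !Ea_lin !Pa_lin.
    have h1 := g_null i j k; have h2 := sol_null_cf i j k.
    move: (Ea 3 g i j k) (Pa 1 (Pa 1 g) i j k) (Ea 2 (Ea 2 g) i j k) (Ea 2 (Pa 1 g) i j k)
      (Pa 1 (Ea 2 g) i j k) (Ea 3 (cf sol) i j k) (Pa 1 (Pa 1 (cf sol)) i j k)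
      (Ea 2 (Ea 2 (cf sol)) i j k) (Ea 2 (Pa 1 (cf sol)) i j k) (Pa 1 (Ea 2 (cf sol)) i j k) h1 h2.
    move=> x1 x2 x3 x4 x5 y1 y2 y3 y4 y5 h1 h2.
    transitivity (- c * (N.+2%:R * (4%:R * y1 - N%:R * y2)) + N.+2%:R * (4%:R * x1 - N%:R * x2)).
      by ring.
    by rewrite h1 h2; ring.
  - by rewrite /d /sol (cf_hom _ f_gr) mulNr mulVf // [g _ _ _]bO_norm addNr.
apply/funext => i; apply/funext => j; apply/funext => k.
by apply/eqP; have := d0 i j k; rewrite /d mulNr addrC => /eqP; rewrite subr_eq0.
Qed.

Local Notation ideal := (in_ideal N f).

(** The ideal is closed under multiplication by power sums and under the E_m. *)
Lemma gen_in_ideal k p : generated H T (bO k) p -> exists2 F : K, ideal F & arr p = cf F.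
Proof.
elim=> [|c q r _ [F hF qF] _ [G hG rG]|n q hq [F hF qF]|m q hq [F hF qF]].
- have [->|k1] := eqVneq k 1.
    exists (kc f.[2%:R]^-1 * sol); first by apply: idealM; [exact: sym_kc|exact: ideal_sol].
    by rewrite -/g g_sol; do 3!apply/funext => ?; rewrite cfZ.
  exists (0 * sol); first by apply: idealM; [exact: sym_nat 0|exact: ideal_sol].
  by do 3!apply/funext => ?; rewrite mul0r cf0 /arr bO_charge.
- exists (kc c * F + G); first by apply: idealD => //; apply: idealM => //; exact: sym_kc.
  by rewrite cf_lin -qF -rG.
- exists (kc be * (pp K n * F)).
    by apply: idealM; [exact: sym_kc|apply: idealM => //; exact: sym_pp].
  rewrite (arr_H _ (gen_linO hq)) qF -cf_Pa; do 3!apply/funext => ?; by rewrite cfZ.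
- exists (kc (m%:R * be ^+ 2) * (pp K m.-1 * F) + EE m F).
    apply: idealD; last exact: ideal_EE.
    by apply: idealM; [exact: sym_kc|apply: idealM => //; exact: sym_pp].
  rewrite (arr_T _ (gen_linO hq)) qF cf_lin cf_Ea cf_Pa; do 3!apply/funext => ?; congr (_ + _).
  case: m => [|m] /=; first by rewrite !mul0r.
  by have -> : m.+1%:Z - 1 = m%:Z by lia.
Qed.

Definition represented (F : K) := exists2 p, islinear (p : V -> C^o) & arr p = cf F.

Lemma represented_lin c F G : represented F -> represented G -> represented (kc c * F + G).
Proof.
move=> [p pl pF] [q ql qG]; exists (fun u => c * p u + q u); first exact: (lin_comb c pl ql).
by rewrite cf_lin -pF -qG.
Qed.

Lemma represented0 : represented 0.
Proof.
exists (fun _ => 0); first exact: lin_zero.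
by do 3!apply/funext => ?; rewrite cf0.
Qed.

Lemma representedZ c F : represented F -> represented (kc c * F).
Proof. by move=> hF; rewrite -[_ * _]addr0; exact: represented_lin represented0. Qed.

Lemma representedD F G : represented F -> represented G -> represented (F + G).
Proof. by move=> hF hG; rewrite -[F]mul1r -(rmorph1 kc); exact: represented_lin. Qed.

Lemma represented_nat n F : represented F -> represented (n%:R * F).
Proof. by rewrite -(rmorph_nat kc); exact: representedZ. Qed.

Lemma representedN F : represented F -> represented (- F).
Proof. by rewrite -mulN1r -(rmorph1 kc) -rmorphN; exact: representedZ. Qed.

Lemma represented_divn n F : represented (n.+1%:R * F) -> represented F.
Proof.
move=> /(representedZ n.+1%:R^-1); rewrite mulrA -(rmorph_nat kc) -rmorphM mulVf ?pnatr_eq0 //.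
by rewrite rmorph1 mul1r.
Qed.

Lemma represented_pp n F : represented F -> represented (pp K n * F).
Proof.
move=> [p pl pF]; have : represented (kc be * (pp K n * F)).
  exists (fun u => p (H n u)); first exact: (lin_comp (H_lin n) pl).
  by rewrite (arr_H _ pl) pF -cf_Pa; do 3!apply/funext => ?; rewrite cfZ.
by move=> /(representedZ be^-1); rewrite mulrA -rmorphM mulVf // rmorph1 mul1r.
Qed.

Lemma represented_EE m F : represented F -> represented (EE m.+1 F).
Proof.
move=> hF; have [p pl pF] := hF.
have : represented (kc (m.+1%:R * be ^+ 2) * (pp K m * F) + EE m.+1 F).
  exists (fun u => p (T m.+1 u)); first exact: (lin_comp (T_lin m.+1) pl).
  rewrite (arr_T _ pl) pF cf_lin cf_Ea cf_Pa.
  by have -> : m.+1%:Z - 1 = m%:Z by lia.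
move/(representedD (representedN (representedZ (m.+1%:R * be ^+ 2) (represented_pp m hF)))).
by rewrite addrA addNr add0r.
Qed.

Lemma represented_sym (S : K) : represented S -> forall F, sympoly F -> represented (F * S).
Proof.
have pp1 : pp K 1 = e1 K by [].
have hQ : 2%:R * QQ K = 3%:R * pp K 2 - pp K 1 * pp K 1 by rewrite /QQ /e2 /e1 /pp; ring.
have hR : RR K = 2%:R * (pp K 1 * (pp K 1 * pp K 1)) - 9%:R * (pp K 1 * pp K 2) + 9%:R * pp K 3.
  by rewrite /RR /e2 /e1 /e3 /pp; ring.
move=> hS F; elim=> {F} [c|F G _ hF _ hG|F _ hF|F _ hF|F _ hF].
- exact: representedZ.
- by rewrite mulrDl; exact: representedD.
- by rewrite -mulrA -pp1; exact: represented_pp.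
- apply: (@represented_divn 1); rewrite !mulrA hQ.
  have -> : (3%:R * pp K 2 - pp K 1 * pp K 1) * F * S =
    3%:R * (pp K 2 * (F * S)) - pp K 1 * (pp K 1 * (F * S)) by ring.
  by apply: representedD; [apply: represented_nat|apply: representedN]; do ?exact: represented_pp;
    apply: represented_pp; apply: represented_pp.
have -> : RR K * F * S = 2%:R * (pp K 1 * (pp K 1 * (pp K 1 * (F * S))))
  - 9%:R * (pp K 1 * (pp K 2 * (F * S))) + 9%:R * (pp K 3 * (F * S)) by rewrite hR; ring.
apply: representedD; [apply: representedD|]; [|apply: representedN|];
  apply: represented_nat; do ?apply: represented_pp => //.
Qed.

(** The represented arrays contain the solution and are closed under h_n and T_n;
   the derivative dsol is 6 E_2 sol - 4 N e1 sol. *)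
Theorem ideal_represented (F : K) : ideal F -> represented F.
Proof.
have hsol : represented sol.
  have -> : sol = kc f.[2%:R] * (kc f.[2%:R]^-1 * sol).
    by rewrite mulrA -rmorphM mulfV // rmorph1 mul1r.
  apply: representedZ; exists (bO 1) => //.
  by rewrite -/g g_sol; do 3!apply/funext => ?; rewrite cfZ.
have hdsol : represented dsol.
  rewrite -(DD_sol K f_gr) /DD (EE1_sol K f_gr).
  have -> : 2%:R * (3%:R * EE 2 sol - 2%:R * e1 K * (N%:R * sol)) =
    6%:R * EE 2 sol + - ((4 * N)%:R * (pp K 1 * sol)).
    by rewrite natrM /pp /e1 !expr1; ring.
  apply: representedD; first by apply: represented_nat; exact: represented_EE.
  by apply: representedN; apply: represented_nat; exact: represented_pp.
by move=> [P [Q [hP hQ ->]]]; apply: representedD; exact: represented_sym.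
Qed.

(** Combinations of cubic products that pair to zero with the ideal vanish, since the
   functionals with arrays in the ideal separate points. *)
Theorem ideal_separates (I : Type) (r : seq I) (c : I -> C) (x y z : I -> int) :
  (forall F : K, ideal F -> \sum_(i <- r) c i * cf F (x i) (y i) (z i) = 0) ->
  \sum_(i <- r) c i *: cre3 (x i) (y i) (z i) = 0.
Proof.
move=> h; apply: sepO => [|k p hp].
  have odd3 i j k : (cre3 i j k).1 = 0.
    by apply: a_even; apply: a_odd; exact: a_even.
  elim/big_ind: _ => // [u w /= -> ->|i _ /=]; first by rewrite addr0.
  by rewrite odd3 scaler0.
have pl := gen_linO hp; have [F hF pF] := gen_in_ideal hp.
have -> : p (\sum_(i <- r) c i *: cre3 (x i) (y i) (z i)) =
    \sum_(i <- r) c i * p (cre3 (x i) (y i) (z i)).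
  apply: etrans (lin_sum pl _ _ _) _; apply: eq_bigr => i _; exact: funZ.
apply: etrans (h F hF); apply: eq_bigr => i _.
exact: (congr1 (fun G => c i * G (x i) (y i) (z i)) pF).
Qed.

End Correlators.

(** * The current acting on V *)

Section Model.
Variables (C : numClosedFieldType) (p : nat).
Variables (M11 M21 : lmodType C).
Variables (L11 : int -> {linear M11 -> M11}) (L21 : int -> {linear M21 -> M21}).
Variables (v11 : M11) (v21 : M21).
Variables (psi_up : int -> {linear M11 -> M21}) (psi_dn : int -> {linear M21 -> M11}).
Hypotheses (p_ge4 : (4 <= p)%N) (p_n3 : ~~ (3 %| p)%N).
Hypothesis irr11 : irreducible_hw_module (central_charge C p) 0 L11 v11.
Hypothesis irr21 : irreducible_hw_module (central_charge C p) (weight21 C p) L21 v21.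
Hypothesis prim_up : primary_field (weight21 C p) 0 L11 L21 psi_up.
Hypothesis prim_dn : primary_field (weight21 C p) (shift21 C p) L21 L11 psi_dn.
Hypotheses (norm_up : psi_up 0 v11 = v21) (norm_dn : psi_dn 0 v21 = v11).

Local Notation be := (beta C p).
Local Notation N := (p - 2)%N.

Let gE (k : int) : C := (2 * k)%:~R * be.
Let gO (k : int) : C := (2 * k + 1)%:~R * be.

Let natN : (N%:R : C) = p%:R - 2%:R.
Proof. by rewrite natrB //; lia. Qed.

Lemma beta_sqr : be ^+ 2 = N%:R / 2%:R.
Proof. by rewrite /beta sqrtCK natN. Qed.

Let shift_up : 0 - 0 + weight21 C p = weight21 C p. Proof. by rewrite subrr add0r. Qed.
Let shift_dn : weight21 C p - shift21 C p + weight21 C p = 0.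
Proof. by rewrite /weight21 /shift21; field. Qed.

Let trunc_up := primary_truncated irr11 irr21 prim_up shift_up.
Let trunc_dn := primary_truncated irr21 irr11 prim_dn shift_dn.
Let vac_up := primary_vacuum irr11 irr21 prim_up shift_up.
Let vac_dn := primary_vacuum irr21 irr11 prim_dn shift_dn.

Let charge_up k : gO k = gE k + be.
Proof. by rewrite /gO /gE rmorphD mulrDl mul1r. Qed.
Let charge_dn k : gE (k + 1) = gO k + be.
Proof. by rewrite /gO /gE !(rmorphD, rmorphM) /=; ring. Qed.

Let kappa (k : int) : int := k * N%:Z.
Let exponent_up k : be * gE k - 0 = (kappa k)%:~R.
Proof.
rewrite subr0 /gE mulrCA -expr2 beta_sqr /kappa !rmorphM /= -[N%:~R]/(N%:R : C).
by rewrite -mulrA mulrC; field.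
Qed.
Let exponent_dn k : be * gO k - shift21 C p = (kappa k)%:~R.
Proof.
rewrite /gO mulrCA -expr2 beta_sqr /kappa /shift21 -natN rmorphD !rmorphM /= -[N%:~R]/(N%:R : C).
by field.
Qed.

Local Notation curU := (cur p psi_up 0 gE (fun k => k)).
Local Notation curD := (cur p psi_dn (shift21 C p) gO (fun k => k + 1)).
Local Notation VV := (tensF M11 * tensF M21)%type.

Definition am (n : int) (u : VV) : VV := a_mode p psi_up psi_dn n u.
Definition hV (n : nat) (u : VV) : VV := (hop gE n%:Z u.1, hop gO n%:Z u.2).
Definition tV (m : nat) (u : VV) : VV := (top L11 gE m u.1, top L21 gO m u.2).
Definition vV : VV := v0 M21 v11.

Let pair_lin (A1 A2 B1 B2 : lmodType C) (F : A1 -> B1) (G : A2 -> B2) :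
  islinear F -> islinear G -> islinear (fun u : A1 * A2 => (F u.1, G u.2)).
Proof.
move=> hF hG; split=> a u w; exact: (congr2 pair (islinearP hF a u.1 w.1) (islinearP hG a u.2 w.2)).
Qed.

Let swap_lin (A1 A2 B1 B2 : lmodType C) (F : A1 -> B1) (G : A2 -> B2) :
  islinear F -> islinear G -> islinear (fun u : A1 * A2 => (G u.2, F u.1)).
Proof.
move=> hF hG; split=> a u w; exact: (congr2 pair (islinearP hG a u.2 w.2) (islinearP hF a u.1 w.1)).
Qed.

Let curU_lin n : islinear (curU n). Proof. exact (cur_lin trunc_up (fun k => k) exponent_up n). Qed.
Let curD_lin n : islinear (curD n). Proof. exact (cur_lin trunc_dn (fun k => k + 1) exponent_dn n). Qed.

Let am_lin n : islinear (am n).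
Proof. exact (swap_lin (curU_lin n) (curD_lin n)). Qed.
Let hV_lin n : islinear (hV n).
Proof. exact (pair_lin (hop_lin M11 gE n%:Z) (hop_lin M21 gO n%:Z)). Qed.
Let tV_lin m : islinear (tV m).
Proof. exact (pair_lin (top_lin L11 gE m) (top_lin L21 gO m)). Qed.

Let hV_am (n : nat) j u : hV n (am j u) = am j (hV n u) + be *: am (j + n%:Z) u.
Proof.
exact (congr2 pair
  (hop_cur trunc_dn charge_dn exponent_dn n%:Z j u.2)
  (hop_cur trunc_up (kk := fun k => k) charge_up exponent_up n%:Z j u.1)).
Qed.

Let weight_beta : weight21 C p + be ^+ 2 / 2%:R = be ^+ 2.
Proof. by rewrite beta_sqr /weight21 -natN; field. Qed.

Let tV_am (m : nat) j u : tV m (am j u) = am j (tV m u)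
  + (- (j + m%:Z)%:~R + m%:R * be ^+ 2) *: am (j + m%:Z - 1) u.
Proof.
rewrite -{1}weight_beta.
exact (congr2 pair
  (top_cur prim_dn trunc_dn charge_dn exponent_dn m j u.2)
  (top_cur prim_up trunc_up (kk := fun k => k) charge_up exponent_up m j u.1)).
Qed.

(* On a highest weight vector tensored with the vacuum, psi_i contributes for i <= 0
   and the vertex operator for nonnegative exponents only. *)
Let cur_vac_zero (M M' : lmodType C) (psi : int -> {linear M -> M'}) (s : C) gM kk x
  (tr : forall x, exists B : int, forall n, B < n -> psi n x = 0)
  (ex : forall k, be * gM k - s = (kappa k)%:~R) n k :
  (forall i, 0 < i -> psi i x = 0) -> 0 < n + 1 + kappa k -> cur p psi s gM kk n (tensF_in k x 1) = 0.
Proof.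
move=> px c0; have hz (j : int) : j \notin [::] ->
    cur_term p psi kk k (n + 1 + kappa k) x (1 : cpoly C) j = 0.
  move=> _; have [j0|j0] := ltP 0 j.
    by apply: etrans (congr1 (fun z => tensF_in (kk k) z _) (px j j0)) (lin0 (tensor_linl _ _ _)).
  have neg : j - (n + 1 + kappa k) < 0 by lia.
  by apply: etrans (congr1 (tensF_in (kk k) _) (fvert_vac_neg be neg)) (lin0 (tensor_linr _ _)).
by apply: etrans (cur_in tr ex (isT : uniq [::]) hz) _; rewrite big_nil.
Qed.

Let cur_vac_one (M M' : lmodType C) (psi : int -> {linear M -> M'}) (s : C) gM kk x
  (tr : forall x, exists B : int, forall n, B < n -> psi n x = 0)
  (ex : forall k, be * gM k - s = (kappa k)%:~R) n k :
  (forall i, 0 < i -> psi i x = 0) -> n + 1 + kappa k = 0 ->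
  cur p psi s gM kk n (tensF_in k x 1) = tensF_in (kk k) (psi 0 x) 1.
Proof.
move=> px c0; have hz (j : int) : j \notin [:: 0] ->
    cur_term p psi kk k (n + 1 + kappa k) x (1 : cpoly C) j = 0.
  rewrite inE => jn; have [j0|j0] := ltP 0 j.
    by apply: etrans (congr1 (fun z => tensF_in (kk k) z _) (px j j0)) (lin0 (tensor_linl _ _ _)).
  have neg : j - (n + 1 + kappa k) < 0 by lia.
  by apply: etrans (congr1 (tensF_in (kk k) _) (fvert_vac_neg be neg)) (lin0 (tensor_linr _ _)).
apply: etrans (cur_in tr ex (isT : uniq [:: 0%:Z]) hz) _; rewrite big_seq1 /cur_term c0 subr0.
exact: (congr1 (tensF_in _ _) (fvert_vac0 be)).
Qed.

Let am_vV j : 0 <= j -> am j vV = 0.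
Proof.
move=> j0; have e : curU j (tensF_in 0 v11 1) = 0.
  by apply: (cur_vac_zero (fun k => k) trunc_up exponent_up vac_up); rewrite /kappa mul0r; lia.
exact (congr2 pair (lin0 (curD_lin j)) e).
Qed.

Let hV_vV n : hV n vV = 0.
Proof.
have e : hop gE n%:Z (tensF_in 0 v11 1) = 0.
  apply: etrans (hop_in gE n%:Z 0 v11 1) _.
  have -> : gE 0 = 0 by rewrite /gE mulr0 mul0r.
  exact: etrans (congr1 (tensF_in _ _) (fmode_vac _ n)) (lin0 (tensor_linr _ _)).
exact (congr2 pair e (lin0 (hop_lin M21 gO n%:Z))).
Qed.

Let tV_vV m : tV m vV = 0.
Proof.
have [_ [_ vL vp] _] := irr11.
have e : L11 (m%:Z - 1) v11 = 0.
  case: m => [|[|m]]; first by rewrite sub0r (vacuum_L_neg1 irr11).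
    by rewrite subrr vL scale0r.
  by rewrite vp //; lia.
have e1 : lop L11 (m%:Z - 1) (tensF_in 0 v11 1) = 0.
  apply: etrans (lop_in L11 _ 0 v11 1) _.
  exact: etrans (congr1 (fun z => tensF_in _ z _) e) (lin0 (tensor_linl _ _ _)).
have e2 : sop gE m (tensF_in 0 v11 1) = 0.
  apply: etrans (sop_in gE m 0 v11 1) _.
  have -> : gE 0 = 0 by rewrite /gE mulr0 mul0r.
  exact: etrans (congr1 (tensF_in _ _) (fsug_vac _ m)) (lin0 (tensor_linr _ _)).
have e3 : top L11 gE m (tensF_in 0 v11 1) = 0 := etrans (congr2 +%R e1 e2) (addr0 _).
exact (congr2 pair e3 (lin0 (top_lin L21 gO m))).
Qed.

Let am_even j (u : VV) : u.2 = 0 -> (am j u).1 = 0.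
Proof. move=> e; exact: etrans (congr1 (curD j) e) (lin0 (curD_lin j)). Qed.
Let am_odd j (u : VV) : u.1 = 0 -> (am j u).2 = 0.
Proof. move=> e; exact: etrans (congr1 (curU j) e) (lin0 (curU_lin j)). Qed.

(** The lowest power of z at each step picks the normalized modes psi_0. *)
Lemma cre3_norm : cre3 am vV N%:Z 0 0 = (0, tensF_in 1 v21 1).
Proof.
have e1 : am (- 0 - 1) vV = (0, tensF_in 0 v21 1).
  have e : curU (- 0 - 1) (tensF_in 0 v11 1) = tensF_in 0 v21 1.
    by apply: etrans (cur_vac_one (fun k => k) trunc_up exponent_up vac_up _) _; rewrite ?norm_up // /kappa mul0r.
  exact (congr2 pair (lin0 (curD_lin _)) e).
have e2 : am (- 0 - 1) (0, tensF_in 0 v21 1) = (tensF_in 1 v11 1, 0).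
  have e : curD (- 0 - 1) (tensF_in 0 v21 1) = tensF_in 1 v11 1.
    by apply: etrans (cur_vac_one (fun k => k + 1) trunc_dn exponent_dn vac_dn _) _; rewrite ?norm_dn // /kappa mul0r.
  exact (congr2 pair e (lin0 (curU_lin _))).
have e3 : am (- N%:Z - 1) (tensF_in 1 v11 1, 0) = (0, tensF_in 1 v21 1).
  have e : curU (- N%:Z - 1) (tensF_in 1 v11 1) = tensF_in 1 v21 1.
    by apply: etrans (cur_vac_one (fun k => k) trunc_up exponent_up vac_up _) _; rewrite ?norm_up // /kappa; lia.
  exact (congr2 pair (lin0 (curD_lin _)) e).
exact: etrans (congr1 (am (- N%:Z - 1)) (etrans (congr1 (am (- 0 - 1)) e1) e2)) e3.
Qed.

Let gen_fst b q : generated (fun n : nat => hop gE n%:Z) (top L11 gE) b q ->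
  generated hV tV (fun u => b u.1) (fun u => q u.1).
Proof.
elim=> [|a q1 q2 _ h1 _ h2|n q1 _ h1|m q1 _ h1].
- exact: gen_base.
- exact (gen_lin a h1 h2).
- exact (gen_H n h1).
- exact (gen_T m h1).
Qed.

Let gen_snd b q : generated (fun n : nat => hop gO n%:Z) (top L21 gO) b q ->
  generated hV tV (fun u => b u.2) (fun u => q u.2).
Proof.
elim=> [|a q1 q2 _ h1 _ h2|n q1 _ h1|m q1 _ h1].
- exact: gen_base.
- exact (gen_lin a h1 h2).
- exact (gen_H n h1).
- exact (gen_T m h1).
Qed.

Let N_pos : (0 < N)%N. Proof. by lia. Qed.
Let N_mod3 : (N %% 3 != 1)%N. Proof. by move: p_n3; rewrite /dvdn; lia. Qed.

(* The two conditions for a null vector at level two in the module of highest weight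
   (p - 2) / 4, with the coefficient 3 / p of L_(-1)^2. *)
Let level2a : 3%:R = 3%:R / (N.+2)%:R * (4%:R * weight21 C p + 2%:R) :> C.
Proof.
have p0 : p%:R != 0 :> C by rewrite pnatr_eq0; lia.
have -> : N.+2 = p by lia.
by rewrite /weight21; field; rewrite p0.
Qed.

Let level2b : 4%:R * weight21 C p + central_charge C p / 2%:R
  = 3%:R / (N.+2)%:R * (6%:R * weight21 C p).
Proof.
have p0 : p%:R != 0 :> C by rewrite pnatr_eq0; lia.
have -> : N.+2 = p by lia.
by rewrite /weight21 /central_charge; field; rewrite p0.
Qed.

Variables (K : polynomials3 C) (f : {poly C}).
Hypothesis f_gr : graded 0 N f.
Hypothesis f_eq : th (N%:Z + 1) (th N f) = (4 * N * N.+1)%:R * f.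
Hypothesis f_cusp : f.[2%:R] != 0.

Theorem current_ideal :
  (forall F : K, in_ideal N f F -> represented am vV F) /\
  (forall (I : Type) (r : seq I) (c : I -> C) (x y z : I -> int),
    (forall F : K, in_ideal N f F -> \sum_(i <- r) c i * cf F (x i) (y i) (z i) = 0) ->
    \sum_(i <- r) c i *: cre3 am vV (x i) (y i) (z i) = 0).
Proof.
have [vir1 hw1 ir1] := irr11; have [vir2 hw2 ir2] := irr21.
have [ph1 [ph1P ph1v ph1n]] := vacuum_functional vir1 hw1 ir1.
have [ph2 [ph2P ph2v ph2n]] := vacuum_functional vir2 hw2 ir2.
pose bE k (u : VV) : C := vacuum ph1 k u.1.
pose bO k (u : VV) : C := vacuum ph2 k u.2.
have bE_lin k : islinear (bE k : VV -> C^o).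
  by split=> a u w; exact: (islinearP (vacuum_lin ph1P k) a u.1 w.1).
have bO_lin k : islinear (bO k : VV -> C^o).
  by split=> a u w; exact: (islinearP (vacuum_lin ph2P k) a u.2 w.2).
have bE_H0 k u : bE k (hV 0 u) = (2 * k)%:~R * be * bE k u.
  exact: (vacuum_H0 gE ph1P k u.1).
have bO_H0 k u : bO k (hV 0 u) = (2 * k + 1)%:~R * be * bO k u.
  exact: (vacuum_H0 gO ph2P k u.2).
have bE_T0 k u : bE k (tV 0 u) = 0.
  exact: (vacuum_T0 gE ph1P ph1n k u.1).
have bO_T0 k u : bO k (tV 0 u) = 0.
  exact: (vacuum_T0 gO ph2P ph2n k u.2).
have bE_T1 k u : bE k (tV 1 u) = ((2 * k)%:~R * be) ^+ 2 / 2%:R * bE k u.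
  have e := vacuum_T1 gE irr11 ph1P ph1n k u.1; rewrite add0r in e; exact: e.
have bO_T1 k u : bO k (tV 1 u) =
    (N%:R / 4%:R + ((2 * k + 1)%:~R * be) ^+ 2 / 2%:R) * bO k u.
  rewrite natN; exact: (vacuum_T1 gO irr21 ph2P ph2n k u.2).
have sepE (u : VV) : u.2 = 0 -> (forall k q, generated hV tV (bE k) q -> q u = 0) -> u = 0.
  case: u => u w /= -> hu; have e : u = 0.
    apply: (sector_separate irr11 ph1P ph1v ph1n (gam := gE)) => k q hq.
    exact: (hu k _ (gen_fst hq)).
  exact (congr2 pair e (erefl 0)).
have sepO (u : VV) : u.1 = 0 -> (forall k q, generated hV tV (bO k) q -> q u = 0) -> u = 0.
  case: u => w u /= -> hu; have e : u = 0.
    apply: (sector_separate irr21 ph2P ph2v ph2n (gam := gO)) => k q hq.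
    exact: (hu k _ (gen_snd hq)).
  exact (congr2 pair (erefl 0) e).
have g3 : gO 1 = 3%:R * be by [].
have bO_null (u : VV) :
  let Psi w := bO 1 (tV 2 w) - 3%:R * be * bO 1 (hV 1 w) in
  bO 1 (tV 3 u) - 3%:R * be * bO 1 (hV 2 u) - bO 1 (hV 1 (hV 1 u)) / 2%:R
  = 3%:R / N.+2%:R * (Psi (tV 2 u) - 3%:R * be * Psi (hV 1 u)).
  exact: (vacuum_null gO irr21 ph2P ph2n 1 level2a level2b u.2).
have bO_norm : bO 1 (cre3 am vV N%:Z 0 0) = 1.
  apply: etrans (congr1 (bO 1) cre3_norm) _; apply: etrans (vacuum_in ph2P _ _ _) _.
  by rewrite ph2v vac1 mulr1.
split=> [F|I r c x y z].
  exact: (ideal_represented am_lin hV_lin tV_lin N_pos beta_sqr hV_am tV_am hV_vV tV_vV am_vV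
    am_even am_odd (erefl 0) bE_lin bO_lin bE_H0 bE_T0 bO_T0 bE_T1 bO_T1 sepE bO_null bO_norm
    f_gr f_eq f_cusp N_mod3).
exact: (ideal_separates am_lin hV_lin tV_lin N_pos beta_sqr hV_am tV_am hV_vV tV_vV am_vV
    am_even am_odd (erefl 0) bE_lin bO_lin bE_H0 bO_H0 bE_T0 bO_T0 bE_T1 bO_T1 sepE sepO bO_null
    bO_norm f_gr f_eq f_cusp N_mod3).
Qed.

End Model.

(** * Cubic monomials *)

Section Monomials.
Implicit Types (m : {cmonom nat}) (s : seq nat).

Definition letters m : seq nat := flatten [seq nseq (m i) i | i <- finsupp m].

Lemma count_letters m l : count_mem l (letters m) = m l.
Proof.
rewrite /letters count_flatten -map_comp sumnE big_map.
under eq_bigr do rewrite /= count_nseq.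
have [h|h] := boolP (l \in finsupp m).
  rewrite (bigD1_seq _ h) ?fset_uniq //= eqxx mul1n big1 ?addn0 // => i.
  by move=> /negPf ->.
have -> : m l = 0%N by apply/eqP; rewrite cmE_eq0.
rewrite big_seq big1 // => i hi; have /negPf il : i != l by apply: contraNneq h => <-.
by rewrite /= il mul0n.
Qed.

Lemma size_letters m : size (letters m) = mdeg m.
Proof.
rewrite /letters size_flatten /shape -map_comp sumnE big_map mdegE.
by apply: eq_bigr => i _; rewrite /= size_nseq.
Qed.

Lemma weight_letters m : weight m = (\sum_(l <- letters m) l.+1)%N.
Proof.
rewrite /letters big_flatten big_map /weight; apply: eq_bigr => i _.
by rewrite big_nseq iter_addn_0 mulnC.
Qed.

Lemma letters_inj m m' : perm_eq (letters m) (letters m') -> m = m'.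
Proof.
move=> h; apply/eqP/cmP => l; rewrite -!count_letters.
by move/permP: h; exact.
Qed.

Lemma foldr_letters (V : Type) (g : nat -> V -> V) (v : V) m :
  foldr (fun i w => iter (m i) (g i) w) v (finsupp m) = foldr g v (letters m).
Proof.
rewrite /letters; elim: (enum_fset (finsupp m)) => //= i s ->; rewrite foldr_cat.
by elim: (m i) => //= n ->.
Qed.

Definition mon3 (p : nat * nat * nat) : {cmonom nat} :=
  mulcm (mulcm (ucm p.1.1) (ucm p.1.2)) (ucm p.2).

Lemma perm_mon3 i j k : perm_eq (letters (mon3 (i, j, k))) [:: i; j; k].
Proof.
apply/allP => l _ /=; rewrite count_letters /mon3 !mulcmE !ucmE /= addn0.
by rewrite addnA.
Qed.

Lemma mon3_letters m : mdeg m = 3%N -> exists i j k : nat,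
  [/\ (i <= j)%N, (j <= k)%N & m = mon3 (i, j, k)].
Proof.
move=> m3; pose s := sort leq (letters m).
have ss : sorted leq s by exact: (sort_sorted leq_total).
have hs : perm_eq s (letters m) by rewrite perm_sort.
have : size s = 3%N by rewrite size_sort size_letters.
case: s ss hs => [|i [|j [|k [|? ?]]]] //= /and3P[ij jk _] hs _.
exists i, j, k; split=> //; apply: letters_inj.
by rewrite -(permPl hs) perm_sym; exact: perm_mon3.
Qed.

Lemma mdeg_mon3 p : mdeg (mon3 p) = 3%N.
Proof. by case: p => -[i j] k; rewrite -size_letters (perm_size (perm_mon3 i j k)). Qed.

Lemma weight_mon3 i j k : weight (mon3 (i, j, k)) = (i + j + k + 3)%N.
Proof.
rewrite weight_letters (perm_big _ (perm_mon3 i j k)) /= !big_cons big_nil.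
lia.
Qed.

Lemma mon3_inj i j k i' j' k' : (i <= j <= k)%N -> (i' <= j' <= k')%N ->
  mon3 (i, j, k) = mon3 (i', j', k') -> [/\ i = i', j = j' & k = k'].
Proof.
move=> h h' e; have hp : perm_eq [:: i; j; k] [:: i'; j'; k'].
  by rewrite -(permPl (perm_mon3 i j k)) e perm_mon3.
suff [-> -> ->] : [:: i; j; k] = [:: i'; j'; k'] by [].
by apply: (sorted_eq leq_trans anti_leq) => //=; rewrite !andbT.
Qed.

Lemma letters_mon3 p : exists x y z : nat,
  letters (mon3 p) = [:: x; y; z] /\ perm_eq [:: x; y; z] [:: p.1.1; p.1.2; p.2].
Proof.
case: p => -[i j] k; have h := perm_mon3 i j k; have := perm_size h.
move: h; case: (letters _) => [|x [|y [|z [|? ?]]]] //= h _.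
by exists x, y, z.
Qed.

End Monomials.

Section SymmetricCoefficients.
Variables (C : numClosedFieldType) (K : polynomials3 C) (F : K).
Hypothesis F_sym : cf_symm F.

Lemma cf_perm (x y z i j k : nat) : perm_eq [:: x; y; z] [:: i; j; k] ->
  cf F x%:Z y%:Z z%:Z = cf F i%:Z j%:Z k%:Z.
Proof.
pose G (s : seq nat) := if s is [:: a; b; c] then cf F a%:Z b%:Z c%:Z else 0.
have h := F_sym.
have s12 a b c : cf F a b c = cf F b a c by case: (h a b c).
have s23 a b c : cf F a b c = cf F a c b by case: (h a b c).
suff: forall s1 s2, perm_eq s1 s2 -> G s1 = G s2 by move/(_ [:: x; y; z] [:: i; j; k]).
apply: catCA_perm_subst => s1 s2 s3.
have rot a b c : cf F a b c = cf F b c a by rewrite s12 s23.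
case: s1 => [|a1 [|a2 [|a3 [|a4 s1]]]]; case: s2 => [|b1 [|b2 [|b3 [|b4 s2]]]];
  case: s3 => [|c1 [|c2 [|c3 s3]]] //=; rewrite ?cats0 //=;
  try by [exact: s12|exact: s23|exact: rot|exact: esym (rot _ _ _)].
Qed.

End SymmetricCoefficients.

(** * The character *)

Section CubicPolynomials.
Variables (C : numClosedFieldType) (W : lmodType C) (act : {cmonom nat} -> W) (n : nat).
Implicit Types (P : cpoly C).

(** The exponents (i <= j <= k) of the pairing, from (a, c) = (k - j, i). *)
Definition triple (q : nat * nat) : nat * nat * nat :=
  let b := (n - q.1 - 3 * q.2)./2 in (q.2, q.2 + b, q.2 + b + q.1)%N.

Local Notation sz := (size (idx 0 n)).
Definition point (i : 'I_sz) := nth (0, 0)%N (idx 0 n) i.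
Definition cubic (i : 'I_sz) : {cmonom nat} := mon3 (triple (point i)).

Lemma point_idx i : point i \in idx 0 n.
Proof. exact: mem_nth. Qed.

Lemma weight_cubic i : weight (cubic i) = (n + 3)%N.
Proof.
rewrite /cubic /triple weight_mon3; have := point_idx i; case: (point i) => a c.
rewrite mem_idx /= => h; lia.
Qed.

Lemma cubic_inj : injective cubic.
Proof.
move=> i j; rewrite /cubic /triple => e.
have := mon3_inj _ _ e; rewrite -!addnA !leq_add2l !leq_addr /= => /(_ isT isT) [e1 e2 e3].
have pE : point i = point j.
  move: e1 e2 e3; case: (point i) => a c; case: (point j) => a' c' /= -> e2 e3.
  congr (_, _); lia.
by apply/val_inj/eqP; rewrite -(nth_uniq (0, 0)%N (ltn_ord i) (ltn_ord j) (idx_uniq 0 n)); apply/eqP.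
Qed.

Lemma cubic_exists m : weight m = (n + 3)%N -> mdeg m = 3%N -> exists i, m = cubic i.
Proof.
move=> wm /mon3_letters[i [j [k [ij jk mE]]]].
have wE : (i + j + k = n)%N by move: wm; rewrite mE weight_mon3; lia.
have h : (k - j, i)%N \in idx 0 n by rewrite mem_idx; lia.
have hi : (index (k - j, i)%N (idx 0 n) < sz)%N by rewrite index_mem.
exists (Ordinal hi); rewrite mE /cubic.
have -> : point (Ordinal hi) = (k - j, i)%N by rewrite /point nth_index.
rewrite /triple /=; have -> : ((n - (k - j) - 3 * i)./2 = j - i)%N by lia.
by rewrite (subnKC ij) (subnKC jk).
Qed.

Definition row_poly (w : 'rV[C]_sz) : cpoly C := \sum_i << w 0 i *g cubic i >>.

Let coefE w m : (row_poly w)@_m = \sum_i w 0 i *+ (cubic i == m).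
Proof.
rewrite /row_poly raddf_sum /=.
by under eq_bigr do rewrite mcoeffU.
Qed.

Lemma row_poly_coef w i : (row_poly w)@_(cubic i) = w 0 i.
Proof.
apply: etrans (coefE _ _) _; rewrite (bigD1 i) //= eqxx big1 ?addr0 // => j ji.
by rewrite (inj_eq cubic_inj) (negPf ji).
Qed.

Lemma row_poly_out w m : (forall i, m != cubic i) -> (row_poly w)@_m = 0.
Proof.
move=> hm; apply: etrans (coefE _ _) _; rewrite big1 // => j _.
by rewrite eq_sym (negPf (hm j)).
Qed.

Lemma row_poly_bihomog w : bihomog (n + 3) 3 (row_poly w).
Proof.
move=> m; rewrite -mcoeff_neq0 => h.
have [[i ->]|no] := pselect (exists i, m = cubic i).
  by split; [exact: weight_cubic|exact: mdeg_mon3].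
case/eqP: h; apply: row_poly_out => i; apply/eqP => mi; apply: no; by exists i.
Qed.

Lemma bihomog_row P : bihomog (n + 3) 3 P -> P = row_poly (\row_i P@_(cubic i)).
Proof.
move=> hP; apply/malgP => m.
have [[i ->]|no] := pselect (exists i, m = cubic i); first by rewrite row_poly_coef mxE.
rewrite row_poly_out => [|i]; last by apply/eqP => mi; apply: no; exists i.
apply/eqP/negPn/negP; rewrite mcoeff_neq0 => /hP[wm dm].
by apply: no; exact: cubic_exists.
Qed.

Lemma act_row_poly w : \sum_(m <- msupp (row_poly w)) (row_poly w)@_m *: act m
  = \sum_i w 0 i *: act (cubic i).
Proof.
pose r := [seq cubic i | i <- enum 'I_sz].
rewrite (support_sum (r2 := r)) ?fset_uniq //.
- rewrite big_map big_enum /=; apply: eq_bigr => i _; by rewrite row_poly_coef.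
- by rewrite map_inj_uniq ?enum_uniq //; exact: cubic_inj.
- by move=> m hm; rewrite (mcoeff_outdom hm) scale0r.
move=> m hm; rewrite row_poly_out ?scale0r // => i; apply: contra hm => /eqP ->.
by apply/mapP; exists i => //; rewrite mem_enum.
Qed.

Lemma row_polyP a w w' : row_poly (a *: w + w') = a *: row_poly w + row_poly w'.
Proof.
apply/malgP => m; apply: etrans (coefE _ _) _; apply/esym.
apply: etrans (coefP _ _ _ _) _.
apply: etrans (congr2 (fun x y => a * x + y) (coefE _ _) (coefE _ _)) _.
by rewrite mulr_sumr -big_split; apply: eq_bigr => i _; rewrite !mxE mulrnDl mulrnAr.
Qed.

Lemma has_dim_cubic r (B : 'M[C]_(r, sz)) : row_free B ->
  (forall w : 'rV_sz, (w <= B)%MS <-> \sum_i w 0 i *: act (cubic i) = 0) ->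
  has_dim ([set P | \sum_(m <- msupp P) P@_m *: act m = 0] `&` bihomog (n + 3) 3) r.
Proof.
move=> Bf hB; have lin : islinear row_poly by split=> a w w'; exact: row_polyP.
have comb (c : 'I_r -> C) : \sum_i c i *: row_poly (row i B) = row_poly ((\row_i c i) *m B).
  rewrite mulmx_sum_row (lin_sum lin); apply: eq_bigr => i _.
  by rewrite mxE; exact: esym (linZ lin _ _).
exists (fun i => row_poly (row i B)); split=> [i|c|P [hP Pb]].
- split; last exact: row_poly_bihomog.
  by apply: etrans (act_row_poly _) _; apply/hB; exact: row_sub.
- rewrite comb => e i.
  have z : (\row_i c i) *m B = 0.
    by apply/rowP => j; rewrite -row_poly_coef e mcoeff0 mxE.
  have /row_free_inj inj := Bf.
  have : \row_i c i = 0 by apply: inj; rewrite z mul0mx.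
  by move/rowP/(_ i); rewrite !mxE.
pose w : 'rV_sz := \row_i P@_(cubic i); have PE : P = row_poly w := bihomog_row Pb.
have : (w <= B)%MS by apply/hB; rewrite -act_row_poly -PE.
move=> /submxP[u uE]; exists (fun i => u 0 i); rewrite comb PE uE; congr (row_poly (_ *m _)).
by apply/rowP => i; rewrite mxE.
Qed.

End CubicPolynomials.

Section CubicRelations.
Variables (C : numClosedFieldType) (p : nat).
Variables (M11 M21 : lmodType C).
Variables (L11 : int -> {linear M11 -> M11}) (L21 : int -> {linear M21 -> M21}).
Variables (v11 : M11) (v21 : M21).
Variables (psi_up : int -> {linear M11 -> M21}) (psi_dn : int -> {linear M21 -> M11}).
Hypotheses (p_ge4 : (4 <= p)%N) (p_n3 : ~~ (3 %| p)%N).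
Hypothesis irr11 : irreducible_hw_module (central_charge C p) 0 L11 v11.
Hypothesis irr21 : irreducible_hw_module (central_charge C p) (weight21 C p) L21 v21.
Hypothesis prim_up : primary_field (weight21 C p) 0 L11 L21 psi_up.
Hypothesis prim_dn : primary_field (weight21 C p) (shift21 C p) L21 L11 psi_dn.
Hypotheses (norm_up : psi_up 0 v11 = v21) (norm_dn : psi_dn 0 v21 = v11).
Local Notation N := (p - 2)%N.
Local Notation a := (am p psi_up psi_dn).
Local Notation vv := (vV M21 v11).

Lemma monomial_act_letters m (x y z : nat) : letters m = [:: x; y; z] ->
  monomial_act p v11 psi_up psi_dn m = cre3 a vv x%:Z y%:Z z%:Z.
Proof.
move=> e; have s (i : nat) : - (i.+1)%:Z = - i%:Z - 1 by lia.
pose g (i : nat) := a_mode p psi_up psi_dn (- (i.+1)%:Z).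
have gE (i : nat) w : g i w = cre1 a i%:Z w := congr1 (fun n => a_mode p psi_up psi_dn n w) (s i).
apply: etrans (foldr_letters g vv m) _; apply: etrans (congr1 (foldr g vv) e) _.
exact: etrans (gE x _) (congr1 (cre1 a x) (etrans (gE y _) (congr1 (cre1 a y) (gE z _)))).
Qed.

Lemma cubic_relations_dim n : exists r,
  has_dim (ideal_a p v11 psi_up psi_dn `&` bihomog (n + 3) 3) r /\
  (r + size (idx N n) + size (idx N.+1 n) = size (idx 0 n) + size (idx (2 * N + 1) n))%N.
Proof.
have N3 : (N %% 3 != 1)%N by move: p_n3; rewrite /dvdn; lia.
have [K] := polynomials3_inhabited C.
have [f [f_gr f_eq f_cusp f_cusp']] := graded_solution_exists C N3.
have [rep sep] := current_ideal p_ge4 p_n3 irr11 irr21 prim_up prim_dn norm_up norm_dn K f_gr f_eq f_cusp.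
have [r [B [Bf hB hdim]]] := annihilator_dim K f_gr f_eq f_cusp f_cusp' n.
exists r; split=> //; apply: has_dim_cubic Bf _ => w.
pose I := 'I_(size (idx 0 n)).
pose x (i : I) := nth 0%N (letters (cubic i)) 0.
pose y (i : I) := nth 0%N (letters (cubic i)) 1.
pose z (i : I) := nth 0%N (letters (cubic i)) 2.
have xyz i : letters (cubic i) = [:: x i; y i; z i].
  have [x0 [y0 [z0 [e _]]]] := letters_mon3 (triple n (point i)).
  by rewrite -[mon3 _]/(cubic i) in e; rewrite /x /y /z e.
have actE i : monomial_act p v11 psi_up psi_dn (cubic i) = cre3 a vv (x i)%:Z (y i)%:Z (z i)%:Z.
  exact: monomial_act_letters (xyz i).
have cfE (F : K) i : in_ideal N f F -> pairing n F (point i) = cf F (x i)%:Z (y i)%:Z (z i)%:Z.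
  move=> /ideal_sym/sym_cf hF; have [x0 [y0 [z0 [e h]]]] := letters_mon3 (triple n (point i)).
  by rewrite -[mon3 _]/(cubic i) xyz in e; case: e h => -> -> -> h; exact: esym (cf_perm hF h).
have sumE (F : K) : in_ideal N f F -> \sum_(q <- idx 0 n) frow w q * pairing n F q =
    \sum_i w 0 i * cf F (x i)%:Z (y i)%:Z (z i)%:Z.
  move=> hF; rewrite (big_nth (0, 0)%N) big_mkord; apply: eq_bigr => i _.
  rewrite -(cfE F i hF); congr (_ * _).
  by rewrite -[in RHS](frowK (0, 0)%N w (idx_uniq 0 n)) mxE.
have -> : \sum_i w 0 i *: monomial_act p v11 psi_up psi_dn (cubic i) =
    \sum_i w 0 i *: cre3 a vv (x i)%:Z (y i)%:Z (z i)%:Z.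
  by apply: eq_bigr => i _; rewrite actE.
split=> [/hB h|e].
  apply: (sep _ (index_enum I) (fun i => w 0 i)
    (fun i => (x i)%:Z) (fun i => (y i)%:Z) (fun i => (z i)%:Z)) => F hF.
  by rewrite -(sumE F hF); exact: h.
apply/hB => F hF; rewrite (sumE F hF); have [q ql qF] := rep F hF.
transitivity (q (\sum_i w 0 i *: cre3 a vv (x i)%:Z (y i)%:Z (z i)%:Z)).
  apply/esym; apply: etrans (lin_sum ql _ _ _) _; apply: eq_bigr => i _.
  apply: etrans (linZ ql _ _) _.
  exact: (congr1 (fun G => w 0 i * G (x i)%:Z (y i)%:Z (z i)%:Z) qF).
by rewrite e; exact: (lin0 ql).
Qed.

(** A cubic monomial has weight at least 3. *)
Lemma low_weight_relations d : (d < 3)%N ->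
  has_dim (ideal_a p v11 psi_up psi_dn `&` bihomog d 3) 0.
Proof.
move=> d3; exists (fun _ => 0); split=> [[]|c _ []|P [_ hP]] //.
exists (fun _ => 0); rewrite big_ord0; apply/malgP => m; rewrite mcoeff0.
apply/eqP/negPn/negP; rewrite mcoeff_neq0 => /hP[wm dm].
have [i [j [k [_ _ mE]]]] := mon3_letters dm.
by move: wm; rewrite mE weight_mon3; lia.
Qed.

End CubicRelations.

Lemma size_idx_shift t d : (size (idx (t + 3) d))%:Z =
  if (3 <= d)%N then (size (idx t (d - 3)))%:Z else 0.
Proof.
case: ifP => d3.
  congr (_%:Z); apply: perm_size; apply: uniq_perm; rewrite ?idx_uniq // => -[a c].
  by rewrite !mem_idx; lia.
case E : (idx (t + 3) d) => [|[a c] s] //.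
have : (a, c) \in idx (t + 3) d by rewrite E mem_head.
by rewrite mem_idx; lia.
Qed.

(** The dimensions are an alternating sum of numbers of exponents, one for each term of
   the numerator. *)
Lemma expansion_of_relations (N : nat) (u : nat -> int) :
  (forall d, u d = (size (idx 3 d))%:Z - (size (idx (N + 3) d))%:Z
     - (size (idx (N.+1 + 3) d))%:Z + (size (idx (2 * N + 1 + 3) d))%:Z) ->
  expansion_of u ('X^3 * ((1 - 'X^N) * (1 - 'X^(N.+1))))
    ((1 - 'X) * (1 - 'X^2) * (1 - 'X^3)).
Proof.
move=> uE; split=> [|d].
  by rewrite !coef0M !coefB !coef1 !coefXn coefX.
have lin (q : {poly int}) (u1 u2 u3 u4 : nat -> int) : conv q (fun d => u1 d - u2 d - u3 d + u4 d) d
    = conv q u1 d - conv q u2 d - conv q u3 d + conv q u4 d.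
  rewrite /conv -!sumrB -big_split; apply: eq_bigr => i _ /=; ring.
rewrite -[LHS]/(conv _ u d) (eq_conv _ _ uE) lin !conv_idx.
have -> : 'X^3 * ((1 - 'X^N) * (1 - 'X^(N.+1))) =
    'X^3 - 'X^(N + 3) - 'X^(N.+1 + 3) + 'X^(2 * N + 1 + 3) :> {poly int}.
  have -> : (2 * N + 1 + 3 = N + N.+1 + 3)%N by lia.
  by rewrite !exprD; ring.
by rewrite coefD !coefB !coefXn.
Qed.

Theorem proposition2p7 (R : realType) (p : nat)
    (M11 M21 : lmodType R[i])
    (L11 : int -> {linear M11 -> M11}) (L21 : int -> {linear M21 -> M21})
    (v11 : M11) (v21 : M21)
    (psi_up : int -> {linear M11 -> M21}) (psi_dn : int -> {linear M21 -> M11})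
    (p_ge4 : (4 <= p)%N) (p_n3 : ~~ (3 %| p)%N)
    (irr11 : irreducible_hw_module (central_charge R[i] p) 0 L11 v11)
    (irr21 : irreducible_hw_module (central_charge R[i] p) (weight21 R[i] p)
               L21 v21)
    (prim_up : primary_field (weight21 R[i] p) 0 L11 L21 psi_up)
    (prim_dn : primary_field (weight21 R[i] p) (shift21 R[i] p) L21 L11 psi_dn)
    (norm_up : psi_up 0 v11 = v21) (norm_dn : psi_dn 0 v21 = v11) :
  exists dim_a3 : nat -> nat,
    (forall d : nat,
       has_dim (ideal_a p v11 psi_up psi_dn `&` bihomog d 3) (dim_a3 d)) /\
    expansion_of (fun d => (dim_a3 d)%:Z)
      ('X^3 * ((1 - 'X^(p - 2)) * (1 - 'X^(p - 1))))
      ((1 - 'X) * (1 - 'X^2) * (1 - 'X^3)).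
Proof.
have dims n := cubic_relations_dim p_ge4 p_n3 irr11 irr21 prim_up prim_dn norm_up norm_dn n.
have [r rP] := choice dims.
exists (fun d => if (d < 3)%N then 0%N else r (d - 3)%N); split=> [d|].
  case: ltnP => d3; first exact: low_weight_relations.
  by have [h _] := rP (d - 3)%N; rewrite subnK in h.
have -> : (p - 1 = (p - 2).+1)%N by lia.
apply: expansion_of_relations => d.
rewrite (size_idx_shift 0 d) !size_idx_shift.
case: leqP => d3 //; have [_ {rP}] := rP (d - 3)%N.
move: (r _) (size (idx 0 _)) (size (idx (p - 2) _)) (size (idx (p - 2).+1 _)) (size (idx (_ + 1) _)).
by lia.
Qed.
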